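(* Let $J,\gamma\in\mathbb R$. Let $\mathcal A=B(\mathcal H_{spin})\otimes\mathcal L^+(\mathcal D)$ with the topology $\tau$ described in the context. For a finite nonempty $V\subset\mathbb Z^d$ and $L\in\mathbb N$ put $\sigma_3^V=\frac1{|V|}\sum_{i\in V}\sigma_3^i$, $a_L=Q_LaQ_L$, $a_L^\dagger=Q_La^\dagger Q_L$, $$H_{V,L}=J|V|(\sigma_3^V)^2+\gamma(a_L+a_L^\dagger)\sigma_3^V,$$ and, for $t\in\mathbb R$ and $X\in\mathcal A$, $\alpha_{V,L}^t(X)=e^{iH_{V,L}t}Xe^{-iH_{V,L}t}$. Then: (1) the limit of $\alpha_{V,L}^t(a)$ for $|V|$ and $L$ both diverging exists in $\mathcal A[\tau]$; (2) under the hypothesis that the two cutoffs are related by $|V|=L^r$, where $r$ is an integer bigger than $1$, the same holds true also for $\alpha_{V,L}^t(\sigma_\alpha^i)$ (for a lattice site $i\in\mathbb Z^d$ and $\alpha\in\{1,2,3\}$).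
   Context: Bosons. $a,a^\dagger$ satisfy $[a,a^\dagger]=1$; $\Phi_0$ is a vector with $a\Phi_0=0$; $\mathcal H$ is the Fock space, the completion of the linear span $\mathcal D_o$ of $\{(a^\dagger)^n\Phi_0:n\in\mathbb N\}$ ($n=0$ included). $N$ is the unique self-adjoint extension of $a^\dagger a$ on $\mathcal D_o$, $M=N+1$, and $\mathcal D=\bigcap_{k\ge0}D(N^k)$. $Q_L$ is the orthogonal projection onto the span of $(a^\dagger)^l\Phi_0$, $0\le l\le L$. $\mathcal L^+(\mathcal D)$ is the *-algebra of all closable operators defined on $\mathcal D$ which, together with their adjoints, map $\mathcal D$ into itself. The coupling $\gamma$ is thought of as a 'small' real parameter. Spins. $\mathcal H_{spin}$ is the infinite tensor product of the two-dimensional complex spaces $\mathbb C^2_i$, $i\in\mathbb Z^d$; $\sigma_\alpha^i$ ($\alpha=1,2,3$) is the Pauli matrix at site $i$, so that $[\sigma_\alpha^i,\sigma_\beta^j]=2\sqrt{-1}\,\epsilon_{\alpha\beta\delta}\,\delta_{i,j}\,\sigma_\delta^i$ (sum over the index $\delta$). The $C^*$-spin algebra is the norm closure of $\bigcup_V\mathcal A_V$, where $\mathcal A_V$ is the $C^*$-algebra generated by the $\sigma_\alpha^i$ with $i\in V$, $V\subset\mathbb Z^d$ finite; the spin observables are identified with their canonical representatives in $B(\mathcal H_{spin})$. The set of relevant vectors is $$\mathcal F=\Big\{\Psi\in\mathcal H_{spin}:\ \lim_{|V|\to\infty}\frac1{|V|}\sum_{p\in V}\sigma_3^p\Psi=\sigma_3^\infty\Psi,\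 \ \|\sigma_3^\infty\|\le1\Big\},$$ $\sigma_3^\infty$ being a certain element of the center of the $C^*$-spin algebra. Algebra and topology. In $\mathcal A=B(\mathcal H_{spin})\otimes\mathcal L^+(\mathcal D)$ one identifies $a$ with $1\otimes a$, $\sigma_\alpha^i$ with $\sigma_\alpha^i\otimes1$, and functions of $M$ with $1\otimes f(M)$. $\mathcal C$ is the set of positive, bounded, continuous functions $f$ on $\mathbb R_+$ which decrease faster than any inverse power. For $\Psi\in\mathcal F$ and $Y=Y_1\otimes Y_2\in B(\mathcal H_{spin})\otimes B(\mathcal H)$ put $$\|Y\|^\Psi=\sup\{|\langle\chi_1\otimes\chi_2,\,(Y_1\otimes Y_2)(\Psi\otimes\phi_2)\rangle|:\ \chi_1\in\mathcal H_{spin},\ \chi_2,\phi_2\in\mathcal H,\ \|\chi_1\|,\|\chi_2\|,\|\phi_2\|\le1\}=\|Y_1\Psi\|\,\|Y_2\|,$$ the supremum formula being used for general $Y$ as well. For $X_2\in\mathcal L^+(\mathcal D)$ the operators $f(M)X_2M^k$ and $M^kX_2f(M)$ are bounded. The topology $\tau$ on $\mathcal A$ is generated by the seminorms $$X\mapsto\max\{\|f(M)XM^k\|^\Psi,\ \|M^kXf(M)\|^\Psi\},\qquad f\in\mathcal C,\ k\in\mathbb N,\ \Psi\in\mathcal F.$$ In part (2), the condition $|V|=L^r$ means that the finite volumes $V\subset\mathbb Z^d$ used in the regularization are those whose number of sites is the $r$-th power of an integer, and the two cutoffs are removed together.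
   Formalization: In part (2) the volumes V are assumed to eventually contain the site i (the usual thermodynamic limit); if |V| diverges through volumes both containing and missing i, the limit in general fails to exist. *)

(* Defs.v *)
From HB Require Import structures.
From mathcomp Require Import all_boot all_order all_algebra.
From mathcomp Require Import finmap complex.
From mathcomp Require Import all_classical all_reals all_analysis.
From mathcomp.analysis.showcase Require summability.

Set Implicit Arguments.
Unset Strict Implicit.
Unset Printing Implicit Defensive.

Import Order.TTheory GRing.Theory Num.Theory.
Import numFieldNormedType.Exports.

Local Open Scope classical_set_scope.
Local Open Scope ring_scope.
Local Open Scope complex_scope.

(* The library norm of a normed space over [R[i]] takes its values in [R[i]];
   this is the same number, seen in [R]. *)
Definition rnorm (R : realType) (E : normedZmodType R[i]) (x : E) : R :=
  complex.Re `|x|.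

(* Complex Hilbert spaces. The inner product is linear in its second argument. *)
HB.mixin Record isHilbert (R : realType) E of CompleteNormedModule R[i] E := {
  dot : E -> E -> R[i];
  dotDr : forall x y z, dot x (y + z) = dot x y + dot x z;
  dotZr : forall (c : R[i]) x y, dot x (c *: y) = c * dot x y;
  dotC : forall x y, dot y x = (dot x y)^*%C;
  dotxx : forall x, dot x x = `|x| ^+ 2
}.

#[short(type="hilbertType")]
HB.structure Definition Hilbert (R : realType) :=
  {E of isHilbert R E & CompleteNormedModule R[i] E}.

Section Operators.
Context {R : realType} {E : hilbertType R}.
Implicit Types (B : E -> E) (P : set (E -> E)).

Definition bounded_op B :=
  (forall (c : R[i]) x y, B (c *: x + y) = c *: B x + B y) /\
  exists M : R, forall x, rnorm (B x) <= M * rnorm x.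

Definition adjoint_op B B' := forall x y, dot (B x) y = dot x (B' y).

Definition norm_closure P : set (E -> E) := [set B |
  forall e : R, 0 < e ->
    exists2 B', P B' & forall x, rnorm (B x - B' x) <= e * rnorm x].

Definition Cstar_subalgebra P :=
  [/\ P `<=` bounded_op,
      forall (c : R[i]) B B', P B -> P B' -> P (fun x => c *: B x + B' x),
      forall B B', P B -> P B' -> P (B \o B'),
      forall B B', P B -> bounded_op B' -> adjoint_op B B' -> P B' &
      norm_closure P `<=` P].

Definition Cstar_generated (S : set (E -> E)) : set (E -> E) := [set B |
  forall P, Cstar_subalgebra P -> S `<=` P -> P B].

End Operators.

Definition lattice (d : nat) := {ffun 'I_d -> int}.

Variant axis := ax1 | ax2 | ax3.

Section C2.
Context {R : realType}.

Definition pauli (al : axis) : 'M[R[i]]_2 :=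
  match al with
  | ax1 => \matrix_(i, j) (i != j)%:R
  | ax2 => \matrix_(i, j) (if (i < j)%N then - 'i%C
                           else if (j < i)%N then 'i%C else 0)
  | ax3 => \matrix_(i, j) (if i == j then (-1) ^+ i else 0)
  end.

Definition dot2 (u v : 'cV[R[i]]_2) : R[i] :=
  \sum_(k < 2) (u k ord0)^*%C * v k ord0.

Definition norm2 (u : 'cV[R[i]]_2) : R := Num.sqrt (complex.Re (dot2 u u)).

End C2.

(* Unordered infinite products and the complete infinite tensor product are
   those of von Neumann (On infinite direct products, 1939). *)
Section InfiniteProducts.
Context {R : realType} {I : choiceType}.

Definition prod_cvg (z : I -> R[i]) (p : R[i]) :=
  rnorm (\prod_(i <- V) z i - p) @[V --> @summability.totally I] --> (0 : R).

(* The value of a quasi-convergent product: the product if it converges, and 0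
   if it does not (i.e. if only its phases fail to converge). *)
Definition quasi_prod (z : I -> R[i]) (p : R[i]) :=
  prod_cvg z p \/ ((forall q, ~ prod_cvg z q) /\ p = 0).

Definition C_sequence (psi : I -> 'cV[R[i]]_2) :=
  exists p : R,
    \prod_(i <- V) norm2 (psi i) @[V --> @summability.totally I] --> p.

End InfiniteProducts.

(* The infinite tensor product of the spaces C^2_i, i in Z^d, with the Pauli
   matrices acting on it. It is characterized up to unitary equivalence by the
   inner products of the product vectors and by their totality; the operators
   [sigma] are then determined by their action on product vectors. *)
Record spinSystem (R : realType) (d : nat) := SpinSystem {
  Hspin :> hilbertType R;
  tens : (lattice d -> 'cV[R[i]]_2) -> Hspin;
  tens_dot : forall phi psi, C_sequence phi -> C_sequence psi ->
    quasi_prod (fun i => dot2 (phi i) (psi i)) (dot (tens phi) (tens psi));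
  tens_total : dense [set x | exists n (c : 'I_n -> R[i]) psi,
    (forall l : 'I_n, C_sequence (psi l)) /\
    x = \sum_(l < n) c l *: tens (psi l)];
  sigma : axis -> lattice d -> Hspin -> Hspin;
  sigma_bounded : forall al i, bounded_op (sigma al i);
  sigma_tens : forall al i psi, C_sequence psi ->
    sigma al i (tens psi) =
    tens (fun j => if j == i then pauli al *m psi j else psi j)
}.
Arguments sigma {R d s}.

Section SpinAlgebra.
Context {R : realType} {d : nat} (S : spinSystem R d).

Definition local_algebra (V : {fset lattice d}) : set (S -> S) :=
  Cstar_generated [set B | exists al i, i \in V /\ B = sigma al i].

Definition spin_algebra : set (S -> S) :=
  norm_closure [set B | exists V, local_algebra V B].

Definition spin_center : set (S -> S) := [set z |
  spin_algebra z /\ forall B, spin_algebra B -> z \o B = B \o z].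

Definition sigma3 (V : {fset lattice d}) (x : S) : S :=
  (#|` V|%:R)^-1 *: \sum_(i <- V) sigma ax3 i x.

(* The finite volumes are taken along a filter [VV], for instance that of all V
   with |V| large, or that of the supersets of larger and larger boxes. The
   central element sigma_3^oo is not fixed in advance: central elements act as
   scalars, and each sector of H_spin has its own value. *)
Definition relevant (VV : set_system {fset lattice d}) : set S := [set Psi |
  exists z : S -> S, [/\ spin_center z,
    forall x, rnorm (z x) <= rnorm x &
    sigma3 V Psi @[V --> VV] --> z Psi]].

End SpinAlgebra.

(* Fock space is l^2(N), the n-th basis vector being (a^dagger)^n Phi_0 / sqrt n!
   (see [cre_vacuum] below), and H_spin (x) Fock space is l^2(N; H_spin), psi (x) x
   being the sequence x_n psi. The operators of this section act on sequences in
   any space E: on Fock space for E = C, and as 1 (x) _ for E = H_spin. *)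
Section Sequences.
Context {R : realType} {E : lmodType R[i]}.
Implicit Types x : nat -> E.

Definition ann x : nat -> E := fun n => (Num.sqrt n.+1%:R)%:C *: x n.+1.

Definition cre x : nat -> E :=
  fun n => if n is m.+1 then (Num.sqrt n%:R)%:C *: x m else 0.

Definition opN x : nat -> E := fun n => n%:R *: x n.

Definition opM x : nat -> E := fun n => opN x n + x n.

Definition funM (f : R -> R) x : nat -> E := fun n => (f n.+1%:R)%:C *: x n.

Definition opQ (L : nat) x : nat -> E := fun n => if (n <= L)%N then x n else 0.

Definition annL L x : nat -> E := opQ L (ann (opQ L x)).
Definition creL L x : nat -> E := opQ L (cre (opQ L x)).

Lemma sqrt_natC n : (Num.sqrt n%:R : R)%:C * (Num.sqrt n%:R)%:C = n%:R :> R[i].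
Proof. by rewrite -rmorphM -expr2 sqr_sqrtr ?ler0n// rmorph_nat. Qed.

Lemma cre_annE x : cre (ann x) = opN x.
Proof.
apply/funext => -[|n]; rewrite /cre /ann /opN ?scale0r//.
by rewrite scalerA sqrt_natC.
Qed.

Lemma ccr x n : ann (cre x) n - cre (ann x) n = x n.
Proof.
by rewrite cre_annE /ann /cre /opN scalerA sqrt_natC -scalerBl -natrB// subSnn scale1r.
Qed.

End Sequences.

Section L2.
Context {R : realType} {E : normedZmodType R[i]}.
Implicit Types x : nat -> E.

Definition l2 x := cvgn (series (fun n => rnorm (x n) ^+ 2)).

(* Meaningful only when [l2 x]: otherwise [limn] is a default value. *)
Definition l2norm x : R := Num.sqrt (limn (series (fun n => rnorm (x n) ^+ 2))).

Definition l2_cvg (u : nat -> nat -> E) x :=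
  [/\ forall m, l2 (u m), l2 x &
      l2norm (fun n => u m n - x n) @[m --> \oo] --> (0 : R)].

End L2.

Definition csum (R : realType) (u : nat -> R[i]) : R[i] :=
  limn (series (fun n => complex.Re (u n))) +i*
  limn (series (fun n => complex.Im (u n))).

Section Fock.
Context {R : realType}.
Implicit Types (x y : nat -> R[i]^o) (T : (nat -> R[i]^o) -> nat -> R[i]^o).

Definition fdot x y : R[i] := csum (fun n => (x n)^*%C * y n).

Definition vacuum : nat -> R[i]^o := fun n => (n == 0)%:R.

Lemma ann_vacuum : ann vacuum = 0.
Proof. by apply/funext => n; rewrite /ann /vacuum scaler0. Qed.

Lemma cre_vacuum n :
  iter n cre vacuum = fun m => (Num.sqrt n`!%:R)%:C * (m == n)%:R.
Proof.
elim: n => [|n IHn]; apply/funext => m.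
  by rewrite /= /vacuum fact0 sqrtr1 mul1r.
rewrite iterS IHn /cre; case: m => [|m]; first by rewrite mulr0.
rewrite eqSS /GRing.scale/= mulrA -rmorphM -sqrtrM ?ler0n// -natrM.
by case: eqP => [->|_]; rewrite ?mulr0// -factS.
Qed.

(* [opN] is self-adjoint on {x in l^2 : N x in l^2}, which determines the
   domains of its powers. *)
Definition domN (k : nat) : set (nat -> R[i]^o) := [set x |
  forall j, (j <= k)%N -> l2 (iter j opN x)].

Definition domD : set (nat -> R[i]^o) := \bigcap_k domN k.

Definition closable T := forall (u : nat -> nat -> R[i]^o) y,
  (forall m, domD (u m)) ->
  l2_cvg u (fun=> 0) -> l2_cvg (fun m => T (u m)) y -> y = fun=> 0.

Definition Lplus T :=
  [/\ forall (c : R[i]) x y, domD x -> domD y ->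
        T (fun n => c *: x n + y n) = fun n => c *: T x n + T y n,
      closable T,
      forall x, domD x -> domD (T x) &
      forall y, domD y -> exists2 y', domD y' &
        forall x, domD x -> fdot (T x) y = fdot x y'].

Definition classC (f : R -> R) :=
  [/\ forall s, 0 <= s -> 0 < f s,
      exists c, forall s, 0 <= s -> f s <= c,
      {within `[0, +oo[, continuous f} &
      forall k : nat, s ^+ k * f s @[s --> +oo] --> 0].

End Fock.

Section Algebra.
Context {R : realType} {d : nat} {S : spinSystem R d}.
Implicit Types (X Y : (nat -> S) -> nat -> S) (VV : set_system {fset lattice d}).

Definition ptens (psi : S) (x : nat -> R[i]^o) : nat -> S := fun n => x n *: psi.

(* Elements of the algebra are operators on the algebraic tensor product of
   H_spin and D; their values elsewhere are irrelevant. *)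
Definition in_algebra X :=
  exists m (B : 'I_m -> S -> S) (T : 'I_m -> (nat -> R[i]^o) -> nat -> R[i]^o),
  [/\ forall j, bounded_op (B j),
      forall j, Lplus (T j) &
      forall n (psi : 'I_n -> S) (x : 'I_n -> nat -> R[i]^o),
        (forall l, domD (x l)) ->
        X (fun r => \sum_l ptens (psi l) (x l) r) =
        fun r => \sum_j \sum_l ptens (B j (psi l)) (T j (x l)) r].

Definition kdot (xi eta : nat -> S) : R[i] := csum (fun n => dot (xi n) (eta n)).

(* f(M) X M^k is only defined on D; since D is dense, the supremum over the
   unit ball of D is that of the bounded extension over the unit ball of H. *)
Definition Psi_norm (Psi : S) Y : \bar R := ereal_sup [set r |
  exists (chi1 : S) (chi2 phi2 : nat -> R[i]^o),
  [/\ rnorm chi1 <= 1, l2 chi2 /\ l2norm chi2 <= 1,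
      domD phi2 /\ l2norm phi2 <= 1 &
      r = (rnorm (kdot (ptens chi1 chi2) (Y (ptens Psi phi2))))%:E]].

Definition tau_seminorm (f : R -> R) (k : nat) (Psi : S) X : \bar R :=
  maxe (Psi_norm Psi (funM f \o X \o iter k opM))
       (Psi_norm Psi (iter k opM \o X \o funM f)).

(* Convergence of a net in the algebra, along the filter [G]; [VV] only enters
   through the set of relevant vectors. *)
Definition tau_cvg VV (I : Type) (G : set_system I)
    (Y : I -> (nat -> S) -> nat -> S) X :=
  [/\ forall p, in_algebra (Y p), in_algebra X &
      forall f k Psi, classC f -> relevant VV Psi ->
        tau_seminorm f k Psi (fun xi n => Y p xi n - X xi n) @[p --> G]
          --> (0%E : \bar R)].

Definition hamiltonian (J gamma : R) (V : {fset lattice d}) (L : nat)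
    (xi : nat -> S) : nat -> S := fun n =>
  (J * #|` V|%:R)%:C *: sigma3 V (sigma3 V (xi n)) +
  gamma%:C *: (annL L (fun m => sigma3 V (xi m)) n
               + creL L (fun m => sigma3 V (xi m)) n).

(* The exponential exp(c H) is the sum of the exponential series, in the norm of
   l^2(N; H_spin). *)
Definition op_exp (c : R[i]) (H : (nat -> S) -> nat -> S)
    (xi : nat -> S) : nat -> S :=
  xget (fun=> 0) [set eta |
    l2_cvg (fun m n => \sum_(k < m) (c ^+ k / k`!%:R) *: iter k H xi n) eta].

Definition alpha (J gamma : R) (t : R) X (p : {fset lattice d} * nat)
    (xi : nat -> S) : nat -> S :=
  let H := hamiltonian J gamma p.1 p.2 in
  op_exp ('i%C * t%:C) H (X (op_exp (- ('i%C * t%:C)) H xi)).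

(* sigma (x) 1; the operator 1 (x) a is [ann]. *)
Definition spin_obs (al : axis) (i : lattice d) (xi : nat -> S) : nat -> S :=
  fun n => sigma al i (xi n).

End Algebra.

(* Main.v *)
Require Import Defs.
From mathcomp Require Import all_boot all_order all_algebra.
From mathcomp Require Import finmap complex spectral.
From mathcomp Require Import all_classical all_reals all_analysis.
From mathcomp.analysis.showcase Require summability.
From mathcomp Require Import ring lra.

(* The sigma_3^i with i in V are commuting self-adjoint involutions and
   a_L + a_L^dagger is a Hermitian matrix of size L + 1, so that exp(itH) is a
   finite sum of spectral projections with scalar phases.

   On the sector where sigma_3^V equals mu, alpha^t(a) is U a U^-1 with
   U = exp(i gamma t mu (a_L + a_L^dagger)). The commutator of a_L + a_L^dagger
   with a is -1 up to terms living on the levels >= L - 1, hence U a U^-1 differs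
   from a - i gamma t mu by an integral of conjugates of these terms. A Gronwall
   argument bounds U in each norm |M^k x|, uniformly in L and mu, and the
   regularization by f(M) and M^k makes the error O(1/L). The limit is therefore
   a - i gamma t sigma_3^oo.

   For alpha = 1, 2 the matrix sigma_alpha^i flips the eigenvalue eps of sigma_3^i,
   which turns alpha^t(sigma_alpha^i) into sigma_alpha^i times a spin phase
   exp(-4itJ (mu eps - 1/|V|)) and a boson factor
   exp(-2i gamma t eps (a_L + a_L^dagger)/|V|). The latter tends to 1 and the former
   converges strongly on relevant vectors, because the sigma_3^V commute with each
   other and converge there.

   The limits of the spin operators exist on a closed subspace only; the orthogonal
   projection onto it extends them to bounded operators on H_spin. *)

Set Implicit Arguments.
Unset Strict Implicit.
Unset Printing Implicit Defensive.

Import Order.TTheory GRing.Theory Num.Theory.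
Import numFieldNormedType.Exports.

Local Open Scope classical_set_scope.
Local Open Scope ring_scope.
Local Open Scope complex_scope.

(** * Norms and completeness *)

(** [Psi_norm] tests only simple tensors, so for fixed [Psi] the error is a finite sum of tensors of
    a spin vector psi_q with a boson operator F_q applied to phi. Two obstacles shape the estimates.
    The number of spin sectors is 2^|V|, so boson errors cannot simply be added over sectors;
    instead the sum over q of |<chi, P_q Psi>| is at most |chi|^2 + |Psi|^2 whatever the number of
    projections, and the boson bounds need only be uniform in q. The ladder operators are unbounded,
    and commutators cost powers of M; since f(M) M^p is bounded for every p, it suffices to control
    M^k F M^-p for some p, with crude constants. Passing to adjoints turns f(M) X M^k into M^k X'
    f(M), X' the adjoint of X, hence every boson estimate is made for an operator together with its
    adjoint. Calculus stays scalar: matrix elements of the evolution are finite sums of exponentials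
    with real frequencies, whose real and imaginary parts are estimated separately. This is the
    origin of many factors 2. *)

Section Rnorm.
Context {R : realType}.

Lemma rnormE (E : normedZmodType R[i]) (x : E) : `|x| = (rnorm x)%:C.
Proof. by rewrite /rnorm RRe_real// normr_real. Qed.

Lemma rnorm_ge0 (E : normedZmodType R[i]) (x : E) : 0 <= rnorm x.
Proof. by rewrite -lecR -rnormE normr_ge0. Qed.

Lemma rnorm0 (E : normedZmodType R[i]) : rnorm (0 : E) = 0.
Proof. by rewrite /rnorm normr0. Qed.

Lemma rnorm_eq0 (E : normedZmodType R[i]) (x : E) : rnorm x = 0 -> x = 0.
Proof. by move=> h; apply/normr0_eq0; rewrite rnormE h. Qed.

Lemma rnormN (E : normedZmodType R[i]) (x : E) : rnorm (- x) = rnorm x.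
Proof. by rewrite /rnorm normrN. Qed.

Lemma rnormB (E : normedZmodType R[i]) (x y : E) : rnorm (x - y) = rnorm (y - x).
Proof. by rewrite -rnormN opprB. Qed.

Lemma rnormD (E : normedZmodType R[i]) (x y : E) :
  rnorm (x + y) <= rnorm x + rnorm y.
Proof. by rewrite -lecR rmorphD/= -!rnormE ler_normD. Qed.

Lemma rnorm_sum (E : normedZmodType R[i]) (I : Type) (r : seq I) (P : pred I)
    (F : I -> E) :
  rnorm (\sum_(i <- r | P i) F i) <= \sum_(i <- r | P i) rnorm (F i).
Proof.
elim/big_ind2 : _ => [|x a y b xa yb|//]; first by rewrite rnorm0.
by rewrite (le_trans (rnormD _ _))// lerD.
Qed.

Lemma rnormZ (E : normedModType R[i]) (c : R[i]) (x : E) :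
  rnorm (c *: x) = rnorm c * rnorm x.
Proof. by apply: complexI; rewrite rmorphM/= -!rnormE normrZ. Qed.

Lemma rnormM (a b : R[i]) : rnorm (a * b) = rnorm a * rnorm b.
Proof. by apply: complexI; rewrite rmorphM/= -!rnormE normrM. Qed.

Lemma rnorm_def (z : R[i]) : rnorm z = Num.sqrt (complex.Re z ^+ 2 + complex.Im z ^+ 2).
Proof. by rewrite /rnorm normc_def. Qed.

Lemma rnorm_sq (z : R[i]) : rnorm z ^+ 2 = complex.Re z ^+ 2 + complex.Im z ^+ 2.
Proof. by rewrite rnorm_def sqr_sqrtr// addr_ge0// sqr_ge0. Qed.

Lemma rnormC (r : R) : rnorm (r%:C : R[i]) = `|r|.
Proof. by rewrite rnorm_def/= expr0n addr0 sqrtr_sqr. Qed.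

Lemma rnorm_conj (z : R[i]) : rnorm z^*%C = rnorm z.
Proof. by case: z => a b; rewrite !rnorm_def/= sqrrN. Qed.

Lemma Re_le_rnorm (z : R[i]) : `|complex.Re z| <= rnorm z.
Proof. by rewrite rnorm_def -sqrtr_sqr ler_wsqrtr// lerDl sqr_ge0. Qed.

Lemma Im_le_rnorm (z : R[i]) : `|complex.Im z| <= rnorm z.
Proof. by rewrite rnorm_def -sqrtr_sqr ler_wsqrtr// lerDr sqr_ge0. Qed.

Lemma rnorm_le_ReIm (z : R[i]) : rnorm z <= `|complex.Re z| + `|complex.Im z|.
Proof.
rewrite -[leRHS]ger0_norm ?addr_ge0// -sqrtr_sqr rnorm_def ler_wsqrtr//.
rewrite sqrrD !real_normK ?num_real// -addrA lerD2l lerDr mulrn_wge0//.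
Qed.

Lemma complex_ReD (a b : R[i]) : complex.Re (a + b) = complex.Re a + complex.Re b.
Proof. by case: a => ? ?; case: b. Qed.

Lemma complex_ImD (a b : R[i]) : complex.Im (a + b) = complex.Im a + complex.Im b.
Proof. by case: a => ? ?; case: b. Qed.

Lemma complex_ReM (a b : R[i]) : complex.Re (a * b) =
  complex.Re a * complex.Re b - complex.Im a * complex.Im b.
Proof. by case: a => ? ?; case: b. Qed.

Lemma complex_ImM (a b : R[i]) : complex.Im (a * b) =
  complex.Re a * complex.Im b + complex.Im a * complex.Re b.
Proof. by case: a => ? ?; case: b. Qed.

Lemma complex_Re_sum (I : Type) (r : seq I) (P : pred I) (F : I -> R[i]) :
  complex.Re (\sum_(i <- r | P i) F i) = \sum_(i <- r | P i) complex.Re (F i).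
Proof. by elim/big_ind2 : _ => [//|x a y b <- <-|//]; rewrite complex_ReD. Qed.

Lemma complex_Im_sum (I : Type) (r : seq I) (P : pred I) (F : I -> R[i]) :
  complex.Im (\sum_(i <- r | P i) F i) = \sum_(i <- r | P i) complex.Im (F i).
Proof. by elim/big_ind2 : _ => [//|x a y b <- <-|//]; rewrite complex_ImD. Qed.

Lemma conjc_sum (I : Type) (r : seq I) (P : pred I) (F : I -> R[i]) :
  (\sum_(i <- r | P i) F i)^*%C = \sum_(i <- r | P i) (F i)^*%C.
Proof. exact: (rmorph_sum (@conjc R)). Qed.

Lemma conjcD (a b : R[i]) : (a + b)^*%C = a^*%C + b^*%C.
Proof. exact: (rmorphD (@conjc R)). Qed.

Lemma conjcM (a b : R[i]) : (a * b)^*%C = a^*%C * b^*%C.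
Proof. exact: (rmorphM (@conjc R)). Qed.

Lemma conjcN (a : R[i]) : (- a)^*%C = - a^*%C.
Proof. exact: (rmorphN (@conjc R)). Qed.

Lemma mulcJ (a : R[i]) : a^*%C * a = ((rnorm a) ^+ 2)%:C.
Proof.
case: a => x y; rewrite rnorm_sq/=; apply/eqP.
by rewrite eq_complex/=; apply/andP; split; apply/eqP; ring.
Qed.

End Rnorm.

Section NormLimits.
Context {R : realType} {E : normedModType R[i]}.

Lemma cvg_rnormP (T : Type) (F : set_system T) (FF : Filter F) (f : T -> E) (l : E) :
  f @ F --> l <-> (forall e : R, 0 < e -> \forall t \near F, rnorm (f t - l) < e).
Proof.
split=> [/cvgrPdist_lt fl e e0|h].
  have e0' : 0 < e%:C by rewrite ltcR.
  have := fl _ e0'; apply: filterS => t; rewrite rnormE ltcR rnormB.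
  by [].
(* A positive element of [R[i]] has zero imaginary part, so its real part serves as the radius. *)
apply/cvgrPdist_lt => e; rewrite ltcE/= => /andP[/eqP ie re].
have := h _ re; apply: filterS => t; rewrite rnormB -ltcR -rnormE.
suff -> : (complex.Re e)%:C = e by [].
by case: e ie {re} => a b /= ->.
Qed.

End NormLimits.

Section CauchyComplete.
Context {R : realType} {E : completeNormedModType R[i]}.

(** Stated for the values of [f]: with [F^~ x] in place of [f] it becomes a condition on the vector
    x, and the vectors satisfying it form the closed subspace on which a strong limit exists. *)
Definition rcauchy (T : Type) (F : set_system T) (f : T -> E) :=
  forall e : R, 0 < e -> exists2 A, F A &
    forall s t, A s -> A t -> rnorm (f s - f t) <= e.

Lemma rcauchy_cvg (T : Type) (F : set_system T) (FF : ProperFilter F) (f : T -> E) :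
  rcauchy F f -> exists l : E, f @ F --> l.
Proof.
move=> cf.
have : cauchy (f @ F).
  apply/cauchyP => e; rewrite ltcE/= => /andP[/eqP ie re].
  have [A FA HA] := cf _ (divr_gt0 re (ltr0n R 2)).
  have [s As] := filter_ex FA.
  exists (f s); rewrite /fmap/=; apply: filterS FA => t At /=.
  rewrite -ball_normE /= rnormE.
  have -> : e = (complex.Re e)%:C by case: e ie {re HA} => a b /= ->.
  rewrite ltcR (le_lt_trans (HA _ _ As At))//.
  by rewrite ltr_pdivrMr// ltr_pMr// ltr1n.
by move=> /cauchy_cvg; move=> /cvg_ex.
Qed.

Lemma cvg_rcauchy (T : Type) (F : set_system T) (FF : Filter F) (f : T -> E) (l : E) :
  f @ F --> l -> rcauchy F f.
Proof.
move=> /cvg_rnormP fl e e0.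
exists [set t | rnorm (f t - l) < e / 2]; first exact: fl (divr_gt0 e0 (ltr0n R 2)).
move=> s t /= hs ht.
rewrite -(subrKA l) (le_trans (rnormD _ _))// (splitr e) lerD 1?ltW//.
by rewrite rnormB.
Qed.

End CauchyComplete.


(** * Hilbert spaces *)

Lemma subrBB (V : zmodType) (x a b : V) : (x - a) - (x - b) = b - a.
Proof. by rewrite opprB [LHS]addrC addrA subrK. Qed.

Section HilbertTheory.
Context {R : realType} {E : hilbertType R}.
Implicit Types x y z w : E.

Lemma dotDl x y z : dot (x + y) z = dot x z + dot y z.
Proof. by rewrite dotC dotDr conjcD -!dotC. Qed.

Lemma dotZl (c : R[i]) x y : dot (c *: x) y = c^*%C * dot x y.
Proof. by rewrite dotC dotZr conjcM -dotC. Qed.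

Lemma dotNr x y : dot x (- y) = - dot x y.
Proof. by rewrite -scaleN1r dotZr mulN1r. Qed.

Lemma dot0r x : dot x 0 = 0.
Proof. by rewrite -(scale0r 0) dotZr mul0r. Qed.

Lemma dot0l x : dot 0 x = 0.
Proof. by rewrite dotC dot0r conjc0. Qed.

Lemma dot_sumr (I : Type) (r : seq I) (P : pred I) x (F : I -> E) :
  dot x (\sum_(i <- r | P i) F i) = \sum_(i <- r | P i) dot x (F i).
Proof.
elim/big_rec2 : _ => [|i a b _ <-]; first exact: dot0r.
by rewrite dotDr.
Qed.

Lemma dot_suml (I : Type) (r : seq I) (P : pred I) x (F : I -> E) :
  dot (\sum_(i <- r | P i) F i) x = \sum_(i <- r | P i) dot (F i) x.
Proof.
elim/big_rec2 : _ => [|i a b _ <-]; first exact: dot0l.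
by rewrite dotDl.
Qed.

Lemma dot_rnorm x : dot x x = (rnorm x ^+ 2)%:C.
Proof. by rewrite dotxx rnormE -rmorphXn. Qed.

Lemma rnormD_sq x y :
  rnorm (x + y) ^+ 2 = rnorm x ^+ 2 + rnorm y ^+ 2 + complex.Re (dot x y) *+ 2.
Proof.
apply: complexI; rewrite -dot_rnorm dotDl !dotDr !dot_rnorm.
rewrite [dot y x]dotC; case: (dot x y) => a b; apply/eqP.
by rewrite eq_complex/=; apply/andP; split; apply/eqP; ring.
Qed.

Lemma parallelogram x y :
  rnorm (x - y) ^+ 2 = (rnorm x ^+ 2 + rnorm y ^+ 2) *+ 2 - rnorm (x + y) ^+ 2.
Proof. by rewrite !rnormD_sq rnormN dotNr raddfN/=; ring. Qed.

Lemma rnormD_orth x y : dot x y = 0 ->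
  rnorm (x + y) ^+ 2 = rnorm x ^+ 2 + rnorm y ^+ 2.
Proof. by move=> h; rewrite rnormD_sq h mul0rn addr0. Qed.

(** Cauchy-Schwarz, from the nonnegative squared distance between [x] and its component along
    [y]. *)
Lemma rnorm_dot x y : rnorm (dot x y) <= rnorm x * rnorm y.
Proof.
have [/eqP y0|y0] := boolP (rnorm y == 0).
  by rewrite (rnorm_eq0 y0) dot0r !rnorm0 mulr0.
have yp : 0 < rnorm y by rewrite lt_neqAle eq_sym y0 rnorm_ge0.
set n := rnorm y ^+ 2; have n0 : 0 < n by rewrite exprn_gt0.
set c := dot y x.
have : 0 <= rnorm (x - (n^-1%:C * c) *: y) ^+ 2 by rewrite sqr_ge0.
have -> : rnorm (x - (n^-1%:C * c) *: y) ^+ 2 = rnorm x ^+ 2 - n^-1 * rnorm c ^+ 2.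
  rewrite rnormD_sq rnormN rnormZ rnormM rnormC ger0_norm ?invr_ge0 ?ltW//.
  rewrite !exprMn -/n dotNr dotZr [dot x y]dotC -/c -[_ * c * _]mulrA [c * _]mulrC mulcJ.
  rewrite raddfN /= mul0r subr0; field.
  by rewrite gt_eqF.
rewrite subr_ge0 -ler_pdivlMl ?invr_gt0// invrK => h.
rewrite dotC -/c rnorm_conj -(@ler_pXn2r _ 2) ?nnegrE ?mulr_ge0 ?rnorm_ge0//.
by rewrite exprMn mulrC.
Qed.

(** * Orthogonal projection onto a closed subspace *)

Section Projection.
Variable W : set E.
Hypothesis W0 : W 0.
Hypothesis Wlin : forall (c : R[i]) x y, W x -> W y -> W (c *: x + y).
Hypothesis Wclosed : forall x,
  (forall e : R, 0 < e -> exists2 w, W w & rnorm (x - w) <= e) -> W x.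

Let WD x y : W x -> W y -> W (x + y).
Proof. by move=> /(Wlin 1) h /h; rewrite scale1r. Qed.

Let WZ (c : R[i]) x : W x -> W (c *: x).
Proof. by move=> Wx; have := Wlin c Wx W0; rewrite addr0. Qed.

(** A minimizing sequence is Cauchy by the parallelogram law, the midpoint of two of its terms being
    again in [W]. *)
Lemma closest_point x : exists y, W y /\ forall w, W w -> rnorm (x - y) <= rnorm (x - w).
Proof.
pose A := [set r : R | exists2 w, W w & r = rnorm (x - w)].
have Ainf : has_inf A.
  split; first by exists (rnorm (x - 0)); exists 0.
  by exists 0 => _ [w _ ->]; rewrite rnorm_ge0.
pose d := inf A.
have dle w : W w -> d <= rnorm (x - w).
  by move=> Ww; apply: ge_inf; [case: Ainf | exists w].
have d0 : 0 <= d by apply: lb_le_inf; [case: Ainf|move=> _ [w _ ->]; rewrite rnorm_ge0].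
have /choice[w wP] : forall n : nat, exists w, W w /\ rnorm (x - w) < d + n.+1%:R^-1.
  move=> n; have n0 : 0 < n.+1%:R^-1 :> R by rewrite invr_gt0.
  have [_ [w Ww ->] h] := inf_adherent n0 Ainf.
  by exists w.
(* Both distances are at most d + e with e <= 1, so the parallelogram law leaves 4 (d^2 + 2 d e + e)
   - 4 d^2 = 4 e (2 d + 1). *)
have wcauchy (e : R) (n m : nat) : e <= 1 -> n.+1%:R^-1 <= e -> m.+1%:R^-1 <= e ->
    rnorm (w n - w m) ^+ 2 <= 4 * e * (2 * d + 1).
  move=> e1 ne me.
  have [Wn wn] := wP n; have [Wm wm] := wP m.
  have mid : d <= rnorm (x - 2^-1%:C *: (w n + w m)) by apply/dle/WZ/WD.
  have e0 : 0 < e by rewrite (lt_le_trans _ ne)// invr_gt0.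
  have -> : w n - w m = (x - w m) - (x - w n) by rewrite subrBB.
  rewrite parallelogram.
  have -> : x - w m + (x - w n) = 2%:C *: (x - 2^-1%:C *: (w n + w m)).
    rewrite scalerBr scalerA -rmorphM/= divff// scale1r rmorph_nat scaler_nat mulr2n.
    by rewrite addrACA -opprD [w m + _]addrC.
  rewrite rnormZ rnormC ger0_norm// exprMn.
  move: (rnorm (x - 2^-1%:C *: _)) (rnorm (x - w m)) (rnorm (x - w n)) wn wm mid
    (dle _ Wn) (dle _ Wm) (ltW e0) e1 ne me d0 => c a b.
  move: n.+1%:R^-1 m.+1%:R^-1 => i j ai bj dc da db e0' e1' ie je dp.
  have sq u : 0 <= u -> u <= d + e -> u ^+ 2 <= d ^+ 2 + 2 * d * e + e.
    move=> u0 ud; apply: (@le_trans _ _ ((d + e) ^+ 2)).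
      by rewrite ler_pXn2r ?nnegrE// addr_ge0.
    have : e * e <= e by rewrite ger_pMr.
    by nra.
  have sa := sq a ltac:(lra) ltac:(lra).
  have sb := sq b ltac:(lra) ltac:(lra).
  have sc : d ^+ 2 <= c ^+ 2 by rewrite ler_pXn2r ?nnegrE//; lra.
  by lra.
have [y wy] : exists y : E, w @ \oo --> y.
  apply: rcauchy_cvg => e e0.
  pose D := 4 * (2 * d + 1); have D0 : 0 < D by rewrite /D; lra.
  pose e' := Num.min 1 (e ^+ 2 / D).
  have e'0 : 0 < e' by rewrite /e' lt_min ltr01 divr_gt0// exprn_gt0.
  have e'D : D * e' <= e ^+ 2 by rewrite -ler_pdivlMl// mulrC /e' ge_min lexx orbT.
  exists [set n | n.+1%:R^-1 < e' :> R].
    exact: near_infty_natSinv_lt (PosNum e'0).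
  move=> n m /= ne me; rewrite -(@ler_pXn2r _ 2) ?nnegrE ?rnorm_ge0 ?(ltW e0)//.
  rewrite (le_trans _ e'D)// (le_trans (wcauchy e' n m _ (ltW ne) (ltW me)))//.
    by rewrite /e' ge_min lexx.
  by rewrite /D; lra.
have near_y (e : R) : 0 < e -> exists n, rnorm (w n - y) < e /\ n.+1%:R^-1 < e :> R.
  move=> e0; have /cvg_rnormP/(_ _ e0) h1 := wy.
  have h2 := near_infty_natSinv_lt (PosNum e0).
  by have [n [? ?]] := filter_ex (filterI h1 h2); exists n.
exists y; split.
  apply: Wclosed => e /near_y[n [h _]]; exists (w n); first by case: (wP n).
  by rewrite rnormB ltW.
move=> v Wv; apply: (le_trans _ (dle _ Wv)).
apply/ler_addgt0Pr => e e0; have [n [h1 h2]] := near_y _ (divr_gt0 e0 (ltr0n R 2)).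
rewrite -(subrKA (w n)) (le_trans (rnormD _ _))//.
have [_ h3] := wP n.
by move: (rnorm (x - w n)) (rnorm (w n - y)) n.+1%:R^-1 h1 h2 h3 => a b c; move: d {dle d0 wP wcauchy} => d; lra.
Qed.

(** If c = <w, x - y> were non-zero, moving the closest point [y] by t c w would bring it nearer to
    [x]. The step t = 1 / (|w|^2 + 1) is short enough and also defined for w = 0. *)
Lemma orthogonal_decomposition x :
  exists y, W y /\ forall w, W w -> dot w (x - y) = 0.
Proof.
have [y [Wy ymin]] := closest_point x; exists y; split=> // w Ww.
set z := x - y; set c := dot w z; pose n := rnorm w ^+ 2.
have n0 : 0 <= n by rewrite sqr_ge0.
pose t := (n + 1)^-1; have t0 : 0 < t by rewrite invr_gt0; lra.
have tn : t * (n + 1) = 1 by rewrite mulVf// gt_eqF//; lra.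
have : rnorm z ^+ 2 <= rnorm (z - (t%:C * c) *: w) ^+ 2.
  rewrite ler_pXn2r ?nnegrE ?rnorm_ge0// /z -addrA -opprD ymin//.
  by rewrite addrC; exact: Wlin.
rewrite rnormD_sq rnormN rnormZ rnormM rnormC gtr0_norm// !exprMn -/n.
rewrite dotNr dotZr [dot z w]dotC -/c -[_ * c * _]mulrA [c * _]mulrC mulcJ raddfN/= mul0r subr0.
have := sqr_ge0 (rnorm c); move: (rnorm c) (@rnorm_eq0 _ _ c) => a ac a0 h.
have t1 : t * (a ^+ 2) * (t * (n + 1)) <= t * a ^+ 2 by rewrite tn mulr1.
have ta : 0 <= t * t * a ^+ 2 by rewrite mulr_ge0// mulr_ge0// ltW.
have t2 : t * a ^+ 2 <= 0 by nra.
apply: ac; apply/eqP; rewrite -sqrf_eq0 eq_le a0 andbT.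
by rewrite -(ler_pM2l t0) mulr0.
Qed.

(** The decomposition is unique, since a vector of [W] orthogonal to [W] vanishes. Linearity and
    [p x = x] on [W] follow from uniqueness, the contraction property from Pythagoras. *)
Lemma orthogonal_projection : exists p : E -> E,
  [/\ forall x, W (p x), forall x, W x -> p x = x,
      forall (c : R[i]) x y, p (c *: x + y) = c *: p x + p y &
      forall x, rnorm (p x) <= rnorm x].
Proof.
have /choice[p pP] := orthogonal_decomposition.
have WB x y : W x -> W y -> W (x - y).
  by move=> Wx Wy; apply: WD => //; rewrite -scaleN1r; exact: WZ.
have uniq x y : W y -> (forall w, W w -> dot w (x - y) = 0) -> p x = y.
  move=> Wy yx; have [Wp px] := pP x; apply/eqP; rewrite -subr_eq0; apply/eqP.
  apply: rnorm_eq0; apply/eqP; rewrite -sqrf_eq0; apply/eqP/complexI.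
  have e : p x - y = (x - y) - (x - p x) by rewrite subrBB.
  have Wd : W (p x - y) by exact: WB.
  by rewrite -dot_rnorm {2}e dotDr dotNr yx// px// oppr0 addr0.
exists p; split=> [x|x Wx|c x y|x].
- by case: (pP x).
- by apply: uniq => // w _; rewrite subrr dot0r.
- have [Wx px] := pP x; have [Wy py] := pP y; apply: uniq; first exact: Wlin.
  move=> w Ww; rewrite opprD addrACA -scalerBr dotDr dotZr px// py//.
  by rewrite mulr0 addr0.
- have [Wx px] := pP x.
  have h : dot (p x) (x - p x) = 0 by exact: px.
  rewrite -(@ler_pXn2r _ 2) ?nnegrE ?rnorm_ge0//.
  rewrite -{2}(subrKC (p x) x) rnormD_orth//.
  by rewrite lerDl sqr_ge0.
Qed.

End Projection.

(* The strong limit of contractions is extended from the closed subspace on which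
   it exists by the orthogonal projection onto that subspace. *)
Lemma bounded_strong_limit (T : Type) (VV : set_system T) (FF : ProperFilter VV)
    (F : T -> E -> E) :
  (forall V (c : R[i]) x y, F V (c *: x + y) = c *: F V x + F V y) ->
  (forall V x, rnorm (F V x) <= rnorm x) ->
  exists2 B : E -> E, bounded_op B &
    forall x, rcauchy VV (F^~ x) -> F V x @[V --> VV] --> B x.
Proof.
move=> Flin Fle.
have FB V x y : F V (x - y) = F V x - F V y.
  by rewrite -scaleN1r addrC Flin scaleN1r addrC.
pose W := [set x | rcauchy VV (F^~ x)].
have W0 : W 0.
  move=> e e0; exists setT; first exact: filterT.
  move=> s t _ _; have F0 V : F V 0 = 0 by have := FB V 0 0; rewrite !subrr.
  by rewrite !F0 subrr rnorm0 ltW.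
have Wlin (c : R[i]) x y : W x -> W y -> W (c *: x + y).
  move=> Wx Wy e e0; pose k := rnorm c + 1; rewrite /W /= /rcauchy in Wx Wy.
  have k0 : 0 < k by rewrite ltr_wpDl// rnorm_ge0.
  have [A VA hA] := Wx (e / 2 / k) (divr_gt0 (divr_gt0 e0 (ltr0n _ 2)) k0).
  have [B VB hB] := Wy (e / 2) (divr_gt0 e0 (ltr0n _ 2)).
  exists (A `&` B); first exact: filterI.
  move=> s t [As Bs] [At Bt]; rewrite !Flin opprD addrACA -scalerBr.
  rewrite (le_trans (rnormD _ _))// (splitr e) lerD ?hB// rnormZ.
  rewrite (le_trans (ler_wpM2l (rnorm_ge0 _) (hA _ _ As At)))//.
  rewrite mulrCA ler_piMr// ?divr_ge0 ?ltW// ltr_pdivrMr// mul1r /k.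
  by rewrite ltrDl.
(* All [F V] are contractions, so the Cauchy property passes to limits of vectors by splitting the
   difference into three terms. *)
have Wcl x : (forall e : R, 0 < e -> exists2 w, W w & rnorm (x - w) <= e) -> W x.
  move=> h e e0.
  have [w Ww xw] := h (e / 3) (divr_gt0 e0 (ltr0n _ 3)).
  rewrite /W /= /rcauchy in Ww; have [A VA hA] := Ww (e / 3) (divr_gt0 e0 (ltr0n _ 3)).
  exists A => // s t As At.
  have -> : F s x - F t x = F s (x - w) + (F s w - F t w) + F t (w - x).
    by rewrite !FB !subrKA.
  have h1 := le_trans (Fle s _) xw.
  have h2 := le_trans (Fle t _) (eq_ind _ (fun r => r <= _) xw _ (rnormB _ _)).
  have h3 := hA _ _ As At.
  have := rnormD (F s (x - w) + (F s w - F t w)) (F t (w - x)).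
  have := rnormD (F s (x - w)) (F s w - F t w).
  by move: h1 h2 h3; move: (rnorm _) => a1; move: (rnorm (F t _)) => a2; lra.
have [p [Wp pid plin ple]] := orthogonal_projection W0 Wlin Wcl.
have lim x : exists l : E, F V (p x) @[V --> VV] --> l.
  exact: rcauchy_cvg (Wp x).
have /choice[B BP] := lim.
exists B; last by move=> x Wx; have := BP x; rewrite pid.
split=> [c x y|].
  apply: (cvg_unique _ (BP _)) => //.
  have -> : F^~ (p (c *: x + y)) = fun V => c *: F V (p x) + F V (p y).
    by apply/funext => V; rewrite plin Flin.
  by apply: cvgD => //; exact: cvgZr.
exists 1 => x; rewrite mul1r; apply/ler_addgt0Pr => e e0.
have /cvg_rnormP/(_ _ e0)/filter_ex[V hV] := BP x.
rewrite -(subrK (F V (p x)) (B x)) (le_trans (rnormD _ _))// addrC lerD//.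
  by rewrite (le_trans (Fle _ _)).
by rewrite rnormB ltW.
Qed.

End HilbertTheory.


(** * Commuting self-adjoint involutions *)

Section LinearMaps.
Context {R : realType} {E F : lmodType R[i]}.

Definition lin (f : E -> F) := forall (c : R[i]) x y, f (c *: x + y) = c *: f x + f y.

Variable f : E -> F.
Hypothesis flin : lin f.

Lemma linD x y : f (x + y) = f x + f y.
Proof. by rewrite -[x in LHS]scale1r flin scale1r. Qed.

Lemma lin0 : f 0 = 0.
Proof. by apply: (addrI (f 0)); rewrite -linD !addr0. Qed.

Lemma linZ (c : R[i]) x : f (c *: x) = c *: f x.
Proof. by rewrite -[c *: x]addr0 flin lin0 addr0. Qed.

Lemma linB x y : f (x - y) = f x - f y.
Proof. by rewrite linD -scaleN1r linZ scaleN1r. Qed.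

Lemma lin_sum (I : Type) (r : seq I) (P : pred I) (h : I -> E) :
  f (\sum_(i <- r | P i) h i) = \sum_(i <- r | P i) f (h i).
Proof.
elim/big_rec2 : _ => [|i a b _ <-]; first exact: lin0.
by rewrite linD.
Qed.

End LinearMaps.

Section JointSpectrum.
Context {R : realType} {E : hilbertType R} {K : eqType}.
Variable Z : K -> E -> E.

(** Projections onto the joint eigenspaces of the [Z j], [j] in [l]; some may vanish. They are
    polynomials in the [Z j], and [proj_comm] records the consequence of this that is used. The
    values [eigv] have square 1 off [l] as well, so that sign arguments need no membership. *)
Record joint_resolution (l : seq K) := JointResolution {
  idx : finType;
  jproj : idx -> E -> E;
  eigv : idx -> K -> R;
  proj_lin : forall q, lin (jproj q);
  proj_sum : forall x, \sum_q jproj q x = x;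
  proj_eig : forall q j x, j \in l -> Z j (jproj q x) = (eigv q j)%:C *: jproj q x;
  eigv_sq : forall q j, eigv q j ^+ 2 = 1;
  proj_orth : forall q q' x, jproj q (jproj q' x) = if q == q' then jproj q x else 0;
  proj_sa : forall q x y, dot (jproj q x) y = dot x (jproj q y);
  proj_comm : forall G q x, lin G -> (forall j y, j \in l -> G (Z j y) = Z j (G y)) ->
    G (jproj q x) = jproj q (G x)
}.

Arguments jproj {l} j q _ : rename.
Arguments eigv {l} j q _ : rename.
Arguments proj_lin {l} j q : rename.
Arguments proj_sum {l} j x : rename.
Arguments proj_eig {l} j q [j0] x _ : rename.
Arguments eigv_sq {l} j q j0 : rename.
Arguments proj_orth {l} j q q' x : rename.
Arguments proj_sa {l} j q x y : rename.
Arguments proj_comm {l} j [G] q x _ _ : rename.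

Hypothesis Zlin : forall i, lin (Z i).
Hypothesis Zsa : forall i x y, dot (Z i x) y = dot x (Z i y).
Hypothesis ZZ : forall i x, Z i (Z i x) = x.
Hypothesis Zcomm : forall i j x, Z i (Z j x) = Z j (Z i x).

Let half (i : K) (b : bool) (x : E) : E := 2^-1%:C *: (x + (-1) ^+ b *: Z i x).

Let half_lin i b : lin (half i b).
Proof.
move=> c x y; rewrite /half (Zlin i).
have -> : c *: x + y + (-1) ^+ b *: (c *: Z i x + Z i y) =
    c *: (x + (-1) ^+ b *: Z i x) + (y + (-1) ^+ b *: Z i y).
  by rewrite !scalerDr addrACA !scalerA [_ * c]mulrC.
by rewrite scalerDr !scalerA [c * _]mulrC.
Qed.

Let half_sum i x : \sum_(b : bool) half i b x = x.
Proof.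
rewrite big_bool /half/= expr1 expr0 scale1r scaleN1r -scalerDr addrACA addNr addr0.
by rewrite -mulr2n -[x *+ 2]scaler_nat scalerA -(rmorph_nat (real_complex R)) -rmorphM/= mulVf// scale1r.
Qed.

Let half_eig i b x : Z i (half i b x) = (-1) ^+ b *: half i b x.
Proof.
rewrite /half (linZ (Zlin i)) (linD (Zlin i)) (linZ (Zlin i)) ZZ scalerA mulrC -scalerA.
congr (_ *: _); rewrite scalerDr scalerA -signr_addb addbb scale1r addrC.
by [].
Qed.

Let half_orth i b b' x : half i b (half i b' x) = if b == b' then half i b x else 0.
Proof.
rewrite {1}/half half_eig scalerA -{1}[half i b' x]scale1r -scalerDl scalerA.
rewrite -signr_addb.
have [->|] := eqVneq b b'.
  rewrite addbb expr0 -(natrD _ 1 1) -(rmorph_nat (real_complex R)) -rmorphM/=.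
  by rewrite mulVf// scale1r.
by case: b b' => -[]//= _; rewrite expr1 subrr mulr0 scale0r.
Qed.

Let half_sa i b x y : dot (half i b x) y = dot x (half i b y).
Proof.
rewrite /half dotZl dotZr conjc_real dotDl dotDr dotZl dotZr Zsa.
by rewrite (rmorphXn (@conjc R)) (rmorphN (@conjc R)) (rmorph1 (@conjc R)).
Qed.

Let half_comm G i b x : lin G -> (forall y, G (Z i y) = Z i (G y)) ->
  G (half i b x) = half i b (G x).
Proof. by move=> Gl GZ; rewrite /half (linZ Gl) (linD Gl) (linZ Gl) GZ. Qed.

(** Each new element [i] splits every projection by (1 + Z i)/2 and (1 - Z i)/2. *)
Lemma joint_resolution_exists (l : seq K) : joint_resolution l.
Proof.
elim: l => [|i l r].
  apply: (@JointResolution [::] unit (fun _ x => x) (fun _ _ => 1)) => //.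
  - by move=> x; rewrite big_const card_unit /= addr0.
  - by move=> *; rewrite expr1n.
have hZ j b x : Z j (half i b x) = half i b (Z j x).
  by apply: half_comm => // y; exact: Zcomm.
have hP q b x : jproj r q (half i b x) = half i b (jproj r q x).
  by rewrite (proj_comm _ _ _ (half_lin i b))// => j y _; rewrite hZ.
(* If [i] already occurs in [l], the new sign overrides the old one; where the two disagree the
   composed projection is zero. *)
apply: (@JointResolution _ (idx r * bool)%type (fun q x => half i q.2 (jproj r q.1 x))
  (fun q j => if j == i then (-1) ^+ q.2 else eigv r q.1 j)).
- by move=> q c x y /=; rewrite (proj_lin r) half_lin.
- move=> x; rewrite -(pair_big xpredT xpredT (fun q b => half i b (jproj r q x)))/=.
  by under eq_bigr do rewrite half_sum; rewrite proj_sum.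
- move=> q j x; rewrite in_cons; case: eqP => [->|_]/= jl.
    rewrite half_eig; congr (_ *: _).
    by rewrite (rmorphXn (real_complex R)) (rmorphN (real_complex R)) (rmorph1 (real_complex R)).
  by rewrite hZ (proj_eig r _ _ jl) (linZ (half_lin _ _)).
- by move=> q j; case: eqP => _; rewrite ?eigv_sq// sqrr_sign.
- move=> [q b] [q' b'] x /=; rewrite hP half_orth xpair_eqE proj_orth.
  case: (b == b'); rewrite ?andbF// andbT; case: (q == q') => //.
  exact: lin0 (half_lin _ _).
- by move=> q x y; rewrite half_sa proj_sa hP.
- move=> G [q b] x Gl GZ /=; rewrite half_comm//.
    rewrite (proj_comm _ _ _ Gl)// => j y jl.
    by rewrite GZ// in_cons jl orbT.
  by move=> y; rewrite GZ// mem_head.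
Qed.

Section Calculus.
Variables (l : seq K) (r : joint_resolution l).
Implicit Types x y : E.

Lemma rnorm_sum_proj (c : idx r -> R[i]) x :
  rnorm (\sum_q c q *: jproj r q x) ^+ 2 =
  \sum_q rnorm (c q) ^+ 2 * rnorm (jproj r q x) ^+ 2.
Proof.
apply: complexI; rewrite -dot_rnorm rmorph_sum/= dot_suml; apply: eq_bigr => q _.
rewrite dot_sumr (bigD1 q)//= big1 => [|q' q'q]; last first.
  by rewrite dotZl dotZr proj_sa proj_orth eq_sym (negbTE q'q) dot0r !mulr0.
by rewrite addr0 dotZl dotZr dot_rnorm mulrA mulcJ -rmorphM.
Qed.

Lemma sum_rnorm_proj x : \sum_q rnorm (jproj r q x) ^+ 2 = rnorm x ^+ 2.
Proof.
have := rnorm_sum_proj (fun=> 1) x.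
under eq_bigr do rewrite scale1r; rewrite proj_sum => ->.
apply: eq_bigr => q _; have -> : rnorm (1 : R[i]) = 1 by rewrite /rnorm normr1.
by rewrite expr1n mul1r.
Qed.

Lemma rnorm_sum_proj_le (c : idx r -> R[i]) x : (forall q, rnorm (c q) <= 1) ->
  rnorm (\sum_q c q *: jproj r q x) <= rnorm x.
Proof.
move=> c1; rewrite -(@ler_pXn2r _ 2) ?nnegrE ?rnorm_ge0//.
rewrite rnorm_sum_proj -sum_rnorm_proj; apply: ler_sum => q _.
by rewrite ler_piMl ?sqr_ge0// expr_le1// rnorm_ge0.
Qed.

Lemma rnorm_proj q x : rnorm (jproj r q x) <= rnorm x.
Proof.
rewrite -(@ler_pXn2r _ 2) ?nnegrE ?rnorm_ge0// -[leRHS]sum_rnorm_proj.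
by rewrite (bigD1 q)//= lerDl sumr_ge0// => q' _; rewrite sqr_ge0.
Qed.

Lemma proj_bounded q : bounded_op (jproj r q).
Proof.
split; first exact: (proj_lin r).
by exists 1 => x; rewrite mul1r rnorm_proj.
Qed.

Lemma dot_proj q x y : dot x (jproj r q y) = dot (jproj r q x) (jproj r q y).
Proof. by rewrite proj_sa proj_orth eqxx. Qed.

(** Cauchy-Schwarz in each sector, then a b <= a^2 + b^2. The bound does not see the number of
    projections, which doubles with every site. *)
Lemma sum_rnorm_dot_proj x y : \sum_q rnorm (dot x (jproj r q y)) <=
  rnorm x ^+ 2 + rnorm y ^+ 2.
Proof.
rewrite -!sum_rnorm_proj -big_split/=; apply: ler_sum => q _.
rewrite dot_proj (le_trans (rnorm_dot _ _))//.
have := rnorm_ge0 (jproj r q x); have := rnorm_ge0 (jproj r q y).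
move: (rnorm (jproj r q x)) (rnorm (jproj r q y)) => a b a0 b0.
have := sqr_ge0 (a - b); have := sqr_ge0 (a + b); rewrite sqrrD sqrrB.
move=> *; nra.
Qed.

Definition spectral_fun (phi : (K -> R) -> R[i]) x :=
  \sum_q phi (eigv r q) *: jproj r q x.

Lemma spectral_fun_lin phi : lin (spectral_fun phi).
Proof.
move=> c x y; rewrite /spectral_fun scaler_sumr -big_split/=; apply: eq_bigr => q _.
by rewrite (proj_lin r) scalerDr !scalerA [c * _]mulrC.
Qed.

Lemma proj_joint_eigenvector (eps : K -> R) y q :
  (forall j, j \in l -> Z j y = (eps j)%:C *: y) ->
  jproj r q y = 0 \/ (forall j, j \in l -> eigv r q j = eps j).
Proof.
move=> yeig; have [p0|p0] := eqVneq (jproj r q y) 0; [by left|right=> j jl].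
have : (eigv r q j)%:C *: jproj r q y = (eps j)%:C *: jproj r q y.
  rewrite -proj_eig// -(linZ (proj_lin r q)) -yeig//.
  by rewrite (proj_comm _ _ _ (Zlin j))// => k z _; exact: Zcomm.
move/eqP; rewrite -subr_eq0 -scalerBl scaler_eq0 (negbTE p0) orbF subr_eq0.
by move=> /eqP /complexI.
Qed.

(** This lets functional calculi over different lists be compared on a common refinement. Eigenvalue
    functions are determined on [l] only, whence the extensionality condition on [phi]. *)
Lemma spectral_fun_eigenvector (phi : (K -> R) -> R[i]) (eps : K -> R) y :
  (forall e e', {in l, e =1 e'} -> phi e = phi e') ->
  (forall j, j \in l -> Z j y = (eps j)%:C *: y) ->
  spectral_fun phi y = phi eps *: y.
Proof.
move=> phil yeig; rewrite -{2}(proj_sum r y) scaler_sumr; apply: eq_bigr => q _.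
have [->|h] := proj_joint_eigenvector q yeig; first by rewrite !scaler0.
by rewrite (phil _ eps).
Qed.

End Calculus.

End JointSpectrum.

Arguments jproj {R E K Z l} j q _ : rename.
Arguments eigv {R E K Z l} j q _ : rename.
Arguments proj_lin {R E K Z l} j q : rename.
Arguments proj_sum {R E K Z l} j x : rename.
Arguments proj_eig {R E K Z l} j q [j0] x _ : rename.
Arguments eigv_sq {R E K Z l} j q j0 : rename.
Arguments proj_orth {R E K Z l} j q q' x : rename.
Arguments proj_sa {R E K Z l} j q x y : rename.
Arguments proj_comm {R E K Z l} j [G] q x _ _ : rename.


(** * The spin system *)

Section PauliMatrices.
Context {R : realType}.
Implicit Types (al : axis) (u v : 'cV[R[i]]_2).

Lemma ord2_ind (P : 'I_2 -> Prop) : P ord0 -> P (lift ord0 ord0) -> forall i, P i.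
Proof.
by move=> P0 P1 [[|[|//]] h]; [have -> : Ordinal h = ord0 | have -> : Ordinal h = lift ord0 ord0];
  do ?exact: val_inj.
Qed.

Lemma pauli_herm al (k m : 'I_2) : (pauli al k m : R[i])^*%C = pauli al m k.
Proof.
by case: al; elim/ord2_ind: k; elim/ord2_ind: m; rewrite !mxE/=;
  apply/eqP; rewrite eq_complex/= ?oppr0 ?opprK !eqxx.
Qed.

Let mulii : 'i%C * 'i%C = -1 :> R[i]. Proof. exact: sqr_i. Qed.

Lemma pauli_sq al : pauli al *m pauli al = 1 :> 'M[R[i]]_2.
Proof.
apply/matrixP; case: al; elim/ord2_ind; elim/ord2_ind;
  rewrite !mxE !big_ord_recl !big_ord0 !mxE/=;
  rewrite ?[bump 0 0]/(1%N) ?expr0 ?expr1 ?(mulNr, mulrN, mulii, mulr0, mul0r, mulr1, mul1r).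
all: by rewrite ?(opprK, oppr0, addr0, add0r).
Qed.

Lemma pauli_anticomm al : al <> ax3 ->
  pauli al *m pauli ax3 = - (pauli ax3 *m pauli al) :> 'M[R[i]]_2.
Proof.
move=> al3; apply/matrixP; case: al al3 => // _; elim/ord2_ind; elim/ord2_ind;
  rewrite !mxE !big_ord_recl !big_ord0 !mxE/=;
  rewrite ?[bump 0 0]/(1%N) ?expr0 ?expr1 ?(mulNr, mulrN, mulii, mulr0, mul0r, mulr1, mul1r).
all: by rewrite ?(opprK, oppr0, addr0, add0r).
Qed.

Lemma dot2_pauli al u v : dot2 (pauli al *m u) v = dot2 u (pauli al *m v).
Proof.
rewrite /dot2; under eq_bigr do rewrite mxE conjc_sum mulr_suml.
rewrite exchange_big/=; apply: eq_bigr => k _.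
rewrite mxE mulr_sumr; apply: eq_bigr => m _.
by rewrite conjcM pauli_herm; ring.
Qed.

Lemma norm2_pauli al v : norm2 (pauli al *m v) = norm2 v.
Proof. by rewrite /norm2 dot2_pauli mulmxA pauli_sq mul1mx. Qed.

End PauliMatrices.

(** * Infinite products and changes of sign in one factor *)

Section QuasiProducts.
Context {R : realType} {I : choiceType}.
Implicit Types (z : I -> R[i]).

Lemma prod_cvgP z p : prod_cvg z p <-> forall e : R, 0 < e ->
  exists A : {fset I}, forall V : {fset I}, (A `<=` V)%fset ->
    rnorm (\prod_(i <- V) z i - p) < e.
Proof.
split=> [h e e0|h].
  have [A _ hA] := h _ (nbhsx_ballx (0 : R) e e0); exists A => V AV.
  have := hA V AV; rewrite /= -ball_normE /= sub0r normrN.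
  exact: le_lt_trans (ler_norm _).
move=> B /nbhs_ballP[e /= e0 eB]; have [A hA] := h _ e0.
exists A => // V AV; apply: eB; rewrite -ball_normE /= sub0r normrN.
by rewrite ger0_norm ?rnorm_ge0// hA.
Qed.

Lemma prod_cvg_uniq z p q : prod_cvg z p -> prod_cvg z q -> p = q.
Proof.
move=> /prod_cvgP zp /prod_cvgP zq; apply/eqP; rewrite -subr_eq0; apply/eqP/rnorm_eq0/eqP.
rewrite eq_le rnorm_ge0 andbT; apply/ler_addgt0Pr => e e0; rewrite add0r.
have e2 : 0 < e / 2 by rewrite divr_gt0.
have [A hA] := zp _ e2; have [B hB] := zq _ e2.
rewrite -(subrKA (\prod_(i <- (A `|` B)%fset) z i)) (le_trans (rnormD _ _))// (splitr e).
by rewrite rnormB lerD// ltW// ?hA ?hB// ?fsubsetUl ?fsubsetUr.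
Qed.

Lemma quasi_prod_uniq z p q : quasi_prod z p -> quasi_prod z q -> p = q.
Proof.
move=> [zp|[zn ->]] [zq|[zm ->]] //; first exact: prod_cvg_uniq zp zq.
  by have := zm _ zp.
by have := zn _ zq.
Qed.

(** A finite product changes sign exactly once its index set contains [i]; adding [i] to [A] ensures
    this. *)
Lemma prod_cvgN z z' i p : z' i = - z i -> (forall j, j != i -> z' j = z j) ->
  prod_cvg z p -> prod_cvg z' (- p).
Proof.
move=> zi zj /prod_cvgP h; apply/prod_cvgP => e e0; have [A hA] := h _ e0.
exists (i |` A)%fset => V; rewrite fsubUset fsub1set => /andP[iV AV].
suff -> : \prod_(j <- V) z' j - - p = - (\prod_(j <- V) z j - p) by rewrite rnormN hA.
rewrite !(bigD1_seq i iV (fset_uniq V))/= zi mulNr opprB opprK addrC.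
by congr (_ - _ * _); apply: eq_bigr => j /zj.
Qed.

(** The change of sign is an involution, so non-convergence is inherited too, and the default value
    0 is its own opposite. *)
Lemma quasi_prodN z z' i p : z' i = - z i -> (forall j, j != i -> z' j = z j) ->
  quasi_prod z p -> quasi_prod z' (- p).
Proof.
move=> zi zj [zp|[zn ->]]; first by left; exact: prod_cvgN zi zj zp.
right; split; last by rewrite oppr0.
have zi' : z i = - z' i by rewrite zi opprK.
have zj' j : j != i -> z j = z' j by move=> /zj ->.
by move=> q z'q; apply: (zn (- q)); exact: prod_cvgN zi' zj' z'q.
Qed.

Lemma C_sequence_norm2 (psi psi' : I -> 'cV[R[i]]_2) :
  (forall j, norm2 (psi' j) = norm2 (psi j)) -> C_sequence psi -> C_sequence psi'.
Proof.
move=> h [p hp]; exists p => A /hp[B BT hB]; exists B => // V BV.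
have := hB V BV; rewrite /= (_ : \prod_(i <- V) norm2 (psi' i) = \prod_(i <- V) norm2 (psi i))//.
by apply: eq_bigr => j _; rewrite h.
Qed.

End QuasiProducts.

Section SpinSystem.
Context {R : realType} {d : nat} {S : spinSystem R d}.
Implicit Types (x y : S) (psi : lattice d -> 'cV[R[i]]_2).

Definition flip (al : axis) (i : lattice d) psi : lattice d -> 'cV[R[i]]_2 :=
  fun j => if j == i then pauli al *m psi j else psi j.

Lemma C_sequence_flip al i psi : C_sequence psi -> C_sequence (flip al i psi).
Proof.
apply: C_sequence_norm2 => j; rewrite /flip; case: eqP => // _; exact: norm2_pauli.
Qed.

Lemma sigma_flip al i psi : C_sequence psi ->
  sigma al i (tens S psi) = tens S (flip al i psi).
Proof. exact: sigma_tens. Qed.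

Lemma sigma_lin al i : lin (@sigma R d S al i).
Proof. by case: (sigma_bounded S al i). Qed.

(* [phi] is the identity for linear and the conjugation for antilinear maps. *)
Lemma tens_eq0 (F : normedModType R[i]) (f : S -> F) (phi : R[i] -> R[i]) (M : R) :
  (forall x y, f (x + y) = f x + f y) ->
  (forall (c : R[i]) x, f (c *: x) = phi c *: f x) ->
  (forall x, rnorm (f x) <= M * rnorm x) ->
  (forall psi, C_sequence psi -> f (tens S psi) = 0) ->
  forall x, f x = 0.
Proof.
move=> fD fZ fM f0 x; apply: rnorm_eq0; apply/eqP; rewrite eq_le rnorm_ge0 andbT.
have M0 : 0 < `|M| + 1 by rewrite ltr_wpDl.
apply/ler_addgt0Pr => e e0; rewrite add0r.
pose k := e / (`|M| + 1); have k0 : 0 < k by rewrite divr_gt0.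
have kC : 0 < k%:C by rewrite ltcR.
have [y [xy [n [c [psi [Cpsi yE]]]]]] : (ball x k%:C)^° `&` [set y : S | exists n (c : 'I_n -> R[i]) (chi : 'I_n -> lattice d -> 'cV[R[i]]_2),
    (forall l, C_sequence (chi l)) /\ y = \sum_(l < n) c l *: tens S (chi l)] !=set0.
  apply: tens_total; last exact: open_interior.
  by exists x; exact: nbhsx_ballx.
have f00 : f 0 = 0 by apply: (addrI (f 0)); rewrite -fD !addr0.
have fy : f y = 0.
  rewrite yE; elim/big_rec : _ => [//|l z _ fz].
  by rewrite fD fz addr0 fZ f0// scaler0.
have xyk : rnorm (x - y) < k.
  have /= := interior_subset xy; rewrite -ball_normE/= rnormE ltcR.
  by [].
have -> : f x = f (x - y).
  by have := fD (x - y) y; rewrite subrK fy addr0.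
rewrite (le_trans (fM _))// (@le_trans _ _ ((`|M| + 1) * rnorm (x - y)))//.
  by rewrite ler_wpM2r ?rnorm_ge0// (le_trans (ler_norm M))// lerDl.
by rewrite -ler_pdivlMl// mulrC ltW.
Qed.

(** Totality of the product vectors, applied to the difference; this is how relations between Pauli
    matrices become operator identities. *)
Lemma bounded_ext (f g : S -> S) : bounded_op f -> bounded_op g ->
  (forall psi, C_sequence psi -> f (tens S psi) = g (tens S psi)) -> f =1 g.
Proof.
move=> [fl [M fM]] [gl [N gN]] fg x; apply/eqP; rewrite -subr_eq0; apply/eqP.
apply: (@tens_eq0 _ (fun x => f x - g x) id (M + N)) => {x}.
- by move=> x y; rewrite (linD fl) (linD gl) opprD addrACA.
- by move=> c x; rewrite (linZ fl) (linZ gl) scalerBr.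
- move=> x; rewrite (le_trans (rnormD _ _))// rnormN mulrDl lerD//.
- by move=> psi /fg ->; rewrite subrr.
Qed.

Lemma bounded_comp (f g : S -> S) : bounded_op f -> bounded_op g ->
  bounded_op (fun x => f (g x)).
Proof.
move=> [fl [M fM]] [gl [N gN]]; split=> [c x y|]; first by rewrite gl fl.
exists (`|M| * `|N|) => x; rewrite (le_trans (fM _))// -mulrA.
rewrite (@le_trans _ _ (`|M| * rnorm (g x)))//.
  by rewrite ler_wpM2r ?rnorm_ge0 ?ler_norm.
rewrite ler_wpM2l// (le_trans (gN _))//.
by rewrite ler_wpM2r ?rnorm_ge0 ?ler_norm.
Qed.

Lemma bounded_scale (c : R[i]) (f : S -> S) : bounded_op f ->
  bounded_op (fun x => c *: f x).
Proof.
move=> [fl [M fM]]; split=> [a x y|]; first by rewrite fl scalerDr !scalerA mulrC.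
exists (rnorm c * M) => x.
by rewrite rnormZ -mulrA ler_wpM2l// rnorm_ge0.
Qed.

Lemma bounded_id : bounded_op (fun x : S => x).
Proof. by split=> //; exists 1 => x; rewrite mul1r. Qed.

Lemma sigma_sq al i x : sigma al i (sigma al i x) = x.
Proof.
apply: (bounded_ext (bounded_comp (sigma_bounded S al i) (sigma_bounded S al i)) bounded_id).
move=> psi Cpsi; rewrite !sigma_flip//; last exact: C_sequence_flip.
congr tens; apply/funext => j; rewrite /flip; case: eqP => // _.
by rewrite mulmxA pauli_sq mul1mx.
Qed.

Lemma sigma_comm al be i j x : i != j ->
  sigma al i (sigma be j x) = sigma be j (sigma al i x).
Proof.
move=> ij; have b := bounded_comp (sigma_bounded S _ _) (sigma_bounded S _ _).
apply: (bounded_ext (b al i be j) (b be j al i)) => psi Cpsi.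
rewrite !sigma_flip//; do 1?exact: C_sequence_flip.
congr tens; apply/funext => k; rewrite /flip.
case: (eqVneq k i) => [->|//]; case: (eqVneq i j) ij => //.
Qed.

Lemma sigma3_comm i j x : sigma ax3 i (sigma ax3 j x) = sigma ax3 j (sigma ax3 i x).
Proof. by case: (eqVneq i j) => [->//|]; exact: sigma_comm. Qed.

Lemma dot_bounded_l (f : S -> S) y : bounded_op f -> exists M : R, forall x,
  rnorm (dot (f x) y) <= M * rnorm x.
Proof.
move=> [fl [M fM]]; exists (M * rnorm y) => x.
by rewrite (le_trans (rnorm_dot _ _))// mulrAC ler_wpM2r// rnorm_ge0.
Qed.

(** On product vectors both sides are quasi-products of the same factors. The identity is then
    extended one argument at a time: to all left vectors against a fixed product vector and, after
    conjugation, to all right vectors. *)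
Lemma sigma_sa al i x y : dot (sigma al i x) y = dot x (sigma al i y).
Proof.
have key psi : C_sequence psi -> forall z,
    dot (sigma al i z) (tens S psi) = dot z (sigma al i (tens S psi)).
  move=> Cpsi z; apply/eqP; rewrite -subr_eq0; apply/eqP.
  have [M1 hM1] := dot_bounded_l (tens S psi) (sigma_bounded S al i).
  have [M2 hM2] := dot_bounded_l (sigma al i (tens S psi)) bounded_id.
  apply: (@tens_eq0 R[i]^o (fun z => dot (sigma al i z) (tens S psi) -
    dot z (sigma al i (tens S psi))) conjc (M1 + M2)) => {z}.
  - by move=> x' y'; rewrite (linD (@sigma_lin _ _)) !dotDl opprD addrACA.
  - by move=> c x'; rewrite (linZ (@sigma_lin _ _)) !dotZl -mulrBr.
  - move=> x'; rewrite (le_trans (rnormD _ _))// rnormN mulrDl lerD//.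
  - move=> chi Cchi; rewrite !sigma_flip//; apply/eqP; rewrite subr_eq0; apply/eqP.
    have h1 := @tens_dot _ _ S _ _ (C_sequence_flip al i Cchi) Cpsi.
    have := @tens_dot _ _ S _ _ Cchi (C_sequence_flip al i Cpsi).
    rewrite (_ : (fun j => _) = (fun j => dot2 (flip al i chi j) (psi j))).
      by move=> h2; exact: quasi_prod_uniq h1 h2.
    apply/funext => j; rewrite /flip; case: eqP => // _; by rewrite dot2_pauli.
have [M1 hM1] := dot_bounded_l x (sigma_bounded S al i).
have [M2 hM2] := dot_bounded_l (sigma al i x) bounded_id.
rewrite [LHS]dotC [RHS]dotC; congr (_^*%C).
apply/eqP; rewrite eq_sym -subr_eq0; apply/eqP.
apply: (@tens_eq0 R[i]^o (fun z => dot (sigma al i z) x - dot z (sigma al i x)) conjc (M1 + M2)).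
- by move=> x' y'; rewrite (linD (@sigma_lin _ _)) !dotDl opprD addrACA.
- by move=> c x'; rewrite (linZ (@sigma_lin _ _)) !dotZl -mulrBr.
- move=> x'; rewrite (le_trans (rnormD _ _))// rnormN mulrDl lerD//.
- by move=> psi Cpsi; rewrite dotC -key// -dotC subrr.
Qed.

Lemma rnorm_sigma al i x : rnorm (sigma al i x) = rnorm x.
Proof.
apply/eqP; rewrite -(@eqrXn2 _ 2) ?rnorm_ge0//; apply/eqP/complexI.
by rewrite -!dot_rnorm sigma_sa sigma_sq.
Qed.

(** Product vectors are known through their inner products, so the sign is extracted weakly: the sum
    of the two tensors is orthogonal to every product vector, hence zero. *)
Lemma tens_opp psi psi' i : C_sequence psi -> psi' i = - psi i ->
  (forall j, j != i -> psi' j = psi j) -> tens S psi' = - tens S psi.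
Proof.
move=> Cpsi hi hj.
have Cpsi' : C_sequence psi'.
  apply: C_sequence_norm2 Cpsi => j; case: (eqVneq j i) => [->|/hj->//].
  rewrite hi /norm2 /dot2; congr (Num.sqrt (complex.Re _)); apply: eq_bigr => k _.
  by rewrite !mxE conjcN mulrNN.
apply/eqP; rewrite -subr_eq0 opprK; apply/eqP; set w := _ + _.
suff h z : dot z w = 0.
  by apply: rnorm_eq0; apply/eqP; rewrite -sqrf_eq0; apply/eqP/complexI; rewrite -dot_rnorm h.
have [M hM] := dot_bounded_l w bounded_id.
apply: (@tens_eq0 R[i]^o (fun z => dot z w) conjc M) => // {z}.
- by move=> *; rewrite dotDl.
- by move=> *; rewrite dotZl.
move=> chi Cchi; rewrite /w dotDr.
have h1 := @tens_dot _ _ S _ _ Cchi Cpsi; have h2 := @tens_dot _ _ S _ _ Cchi Cpsi'.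
suff -> : dot (tens S chi) (tens S psi') = - dot (tens S chi) (tens S psi) by rewrite addNr.
apply: quasi_prod_uniq h2 _; apply: (quasi_prodN (i := i)) h1.
  by rewrite hi /dot2 -sumrN; apply: eq_bigr => k _; rewrite mxE mulrN.
by move=> j /hj ->.
Qed.

Lemma sigma_anticomm al i x : al <> ax3 ->
  sigma al i (sigma ax3 i x) = - sigma ax3 i (sigma al i x).
Proof.
move=> al3; have b := bounded_comp (sigma_bounded S _ _) (sigma_bounded S _ _).
rewrite -scaleN1r.
apply: (bounded_ext (b al i ax3 i) (bounded_scale (-1) (b ax3 i al i))) => psi Cpsi.
rewrite !sigma_flip// ?scaleN1r; do 1?exact: C_sequence_flip.
apply: (@tens_opp _ _ i); first by do 2!apply: C_sequence_flip.
  by rewrite /flip eqxx !mulmxA pauli_anticomm// mulNmx.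
by move=> j /negbTE ji; rewrite /flip ji.
Qed.

End SpinSystem.


(** * Square-summable sequences *)

Section RealSums.
Context {R : realType}.

Lemma ge0_bounded_series_cvg (u : nat -> R) (B : R) : (forall n, 0 <= u n) ->
  (forall m, \sum_(0 <= n < m) u n <= B) -> cvgn (series u) /\ limn (series u) <= B.
Proof.
move=> u0 uB; have c : cvgn (series u).
  apply: nondecreasing_is_cvgn; first exact: nondecreasing_series.
  by exists B => _ [m _ <-]; exact: uB.
by split=> //; apply: limr_le => //; near=> m; exact: uB.
Unshelve. all: by end_near. Qed.

Lemma ge0_series_le_limn (u : nat -> R) m : (forall n, 0 <= u n) ->
  cvgn (series u) -> \sum_(0 <= n < m) u n <= limn (series u).
Proof.
by move=> u0 c; apply: (nondecreasing_cvgn_le _ c); exact: nondecreasing_series.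
Qed.

(** Cauchy-Schwarz with upper bounds in place of norms, from (B a - A b)^2 >= 0. A factor A B is
    cancelled at the end, so vanishing bounds are treated apart. *)
Lemma sum_mul_le (a b : nat -> R) (A B : R) m : 0 <= A -> 0 <= B ->
  (forall n, 0 <= a n) -> (forall n, 0 <= b n) ->
  \sum_(0 <= n < m) a n ^+ 2 <= A ^+ 2 -> \sum_(0 <= n < m) b n ^+ 2 <= B ^+ 2 ->
  \sum_(0 <= n < m) a n * b n <= A * B.
Proof.
move=> A0 B0 a0 b0 hA hB.
have null (c : nat -> R) n : (n < m)%N -> \sum_(0 <= k < m) c k ^+ 2 <= 0 ^+ 2 -> c n = 0.
  rewrite expr0n/= => nm h.
  have : \sum_(0 <= k < m) c k ^+ 2 == 0.
    by rewrite eq_le h sumr_ge0// => k _; rewrite sqr_ge0.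
  rewrite psumr_eq0; last by move=> k _; rewrite sqr_ge0.
  by move/allP => /(_ n); rewrite mem_index_iota nm => /(_ isT)/=; rewrite sqrf_eq0 => /eqP.
have [A00|An] := eqVneq A 0.
  rewrite A00 in hA; rewrite A00 mul0r big_nat big1// => n /andP[_ nm].
  by rewrite (null a n nm hA) mul0r.
have [B00|Bn] := eqVneq B 0.
  rewrite B00 in hB; rewrite B00 mulr0 big_nat big1// => n /andP[_ nm].
  by rewrite (null b n nm hB) mulr0.
have Ap : 0 < A by rewrite lt_neqAle eq_sym An.
have Bp : 0 < B by rewrite lt_neqAle eq_sym Bn.
have h n : (A * B) * (a n * b n) *+ 2 <= B ^+ 2 * a n ^+ 2 + A ^+ 2 * b n ^+ 2.
  rewrite -subr_ge0 (_ : _ - _ = (B * a n - A * b n) ^+ 2) ?sqr_ge0//; ring.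
rewrite -(ler_pM2l (mulr_gt0 Ap Bp)) -(@ler_pMn2r _ 2)//.
rewrite mulr_sumr -sumrMnl (le_trans (ler_sum _ (fun n _ => h n)))//.
rewrite big_split/= -!mulr_sumr.
rewrite (le_trans (lerD (ler_wpM2l (sqr_ge0 B) hA) (ler_wpM2l (sqr_ge0 A) hB)))//.
by rewrite le_eqVlt; apply/orP; left; apply/eqP; ring.
Qed.

End RealSums.

Section L2Theory.
Context {R : realType}.

Lemma l2norm_ge0 (E : normedZmodType R[i]) (x : nat -> E) : 0 <= l2norm x.
Proof. exact: sqrtr_ge0. Qed.

Lemma l2P (E : normedZmodType R[i]) (x : nat -> E) :
  l2 x <-> exists B : R, forall m, \sum_(0 <= n < m) rnorm (x n) ^+ 2 <= B.
Proof.
split=> [h|[B h]]; last by have [] := ge0_bounded_series_cvg (fun n => sqr_ge0 (rnorm (x n))) h.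
exists (limn (series (fun n => rnorm (x n) ^+ 2))) => m.
exact: (ge0_series_le_limn m (fun n => sqr_ge0 (rnorm (x n)))).
Qed.

Lemma sum_le_l2norm (E : normedZmodType R[i]) (x : nat -> E) m : l2 x ->
  \sum_(0 <= n < m) rnorm (x n) ^+ 2 <= l2norm x ^+ 2.
Proof.
move=> h; have le := fun m => ge0_series_le_limn m (fun n => sqr_ge0 (rnorm (x n))) h.
rewrite /l2norm sqr_sqrtr//.
by have := le 0%N; rewrite big_nil.
Qed.

(** Membership and bound come together, because a bound on [l2norm] alone says nothing when the
    series diverges. *)
Lemma l2norm_le (E : normedZmodType R[i]) (x : nat -> E) (b : R) : 0 <= b ->
  (forall m, \sum_(0 <= n < m) rnorm (x n) ^+ 2 <= b ^+ 2) -> l2 x /\ l2norm x <= b.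
Proof.
move=> b0 h; have [c l] := ge0_bounded_series_cvg (fun n => sqr_ge0 (rnorm (x n))) h.
split=> //; rewrite -[leRHS]ger0_norm// -sqrtr_sqr.
exact: ler_wsqrtr.
Qed.

Lemma rnorm_le_l2norm (E : normedZmodType R[i]) (x : nat -> E) n :
  l2 x -> rnorm (x n) <= l2norm x.
Proof.
move=> /(sum_le_l2norm n.+1); rewrite big_nat_recr//= => h.
rewrite -(@ler_pXn2r _ 2) ?nnegrE ?rnorm_ge0 ?l2norm_ge0//.
by rewrite (le_trans _ h)// lerDr sumr_ge0// => k _; rewrite sqr_ge0.
Qed.

Lemma l2_dom (E F : normedZmodType R[i]) (x : nat -> E) (y : nat -> F) (C : R) :
  0 <= C -> (forall n, rnorm (y n) <= C * rnorm (x n)) -> l2 x ->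
  l2 y /\ l2norm y <= C * l2norm x.
Proof.
move=> C0 yx lx; apply: l2norm_le => [|m]; first by rewrite mulr_ge0// l2norm_ge0.
rewrite exprMn (le_trans _ (ler_wpM2l (sqr_ge0 C) (sum_le_l2norm m lx)))//.
rewrite mulr_sumr; apply: ler_sum => n _; rewrite -exprMn.
by rewrite ler_pXn2r ?nnegrE ?rnorm_ge0// mulr_ge0// rnorm_ge0.
Qed.

(** The factor 2 replaces Minkowski's inequality by the termwise (a + b)^2 <= 2 (a^2 + b^2). *)
Lemma l2_dom2 (E F G : normedZmodType R[i]) (x : nat -> E) (y : nat -> F) (z : nat -> G) :
  (forall n, rnorm (z n) <= rnorm (x n) + rnorm (y n)) -> l2 x -> l2 y ->
  l2 z /\ l2norm z <= 2 * (l2norm x + l2norm y).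
Proof.
move=> zxy lx ly; apply: l2norm_le => [|m].
  by rewrite mulr_ge0// addr_ge0// l2norm_ge0.
apply: (@le_trans _ _ (2 * (l2norm x ^+ 2 + l2norm y ^+ 2))); last first.
  have := l2norm_ge0 x; have := l2norm_ge0 y.
  move: (l2norm x) (l2norm y) => a b b0 a0; have := mulr_ge0 a0 b0.
  by have := sqr_ge0 a; have := sqr_ge0 b; nra.
rewrite (le_trans _ (ler_wpM2l (ler0n R 2) (lerD (sum_le_l2norm m lx) (sum_le_l2norm m ly))))//.
rewrite -big_split mulr_sumr; apply: ler_sum => n _ /=.
have := zxy n; have := rnorm_ge0 (x n); have := rnorm_ge0 (y n); have := rnorm_ge0 (z n).
move: (rnorm (x n)) (rnorm (y n)) (rnorm (z n)) => a b c c0 b0 a0 h.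
have : c ^+ 2 <= (a + b) ^+ 2 by rewrite ler_pXn2r ?nnegrE// addr_ge0.
by have := sqr_ge0 (a - b); nra.
Qed.

Lemma l2D (E : normedZmodType R[i]) (x y : nat -> E) : l2 x -> l2 y ->
  l2 (fun n => x n + y n).
Proof. by move=> lx ly; case: (l2_dom2 (fun n => rnormD (x n) (y n)) lx ly). Qed.

Lemma l2B (E : normedZmodType R[i]) (x y : nat -> E) : l2 x -> l2 y ->
  l2 (fun n => x n - y n).
Proof.
move=> lx ly; case: (@l2_dom2 _ _ _ x y (fun n => x n - y n)) => // n.
by rewrite (le_trans (rnormD _ _))// rnormN.
Qed.

Lemma l2norm0 (E : normedZmodType R[i]) : l2 (fun=> 0 : E) /\ l2norm (fun=> 0 : E) = 0.
Proof.
have [l le] : l2 (fun=> 0 : E) /\ l2norm (fun=> 0 : E) <= 0.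
  by apply: l2norm_le => // m; rewrite expr0n big1// => n _; rewrite rnorm0 expr0n.
by split=> //; apply/eqP; rewrite eq_le le l2norm_ge0.
Qed.

Lemma l2Z (E : normedModType R[i]) (c : R[i]) (x : nat -> E) : l2 x ->
  l2 (fun n => c *: x n) /\ l2norm (fun n => c *: x n) <= rnorm c * l2norm x.
Proof. by apply: l2_dom; rewrite ?rnorm_ge0// => n; rewrite rnormZ. Qed.

Lemma l2_sum (E : normedZmodType R[i]) (I : Type) (r : seq I) (P : pred I)
    (y : I -> nat -> E) : (forall i, l2 (y i)) ->
  l2 (fun n => \sum_(i <- r | P i) y i n).
Proof.
move=> ly; elim: r => [|i r IH].
  have -> : (fun n => \sum_(i <- [::] | P i) y i n) = fun=> 0.
    by apply/funext => n; rewrite big_nil.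
  by case: (l2norm0 E).
rewrite (_ : (fun n => _) = (fun n => (if P i then y i n else 0) + \sum_(i <- r | P i) y i n)).
  by apply: l2D => //; case: (P i) => //; case: (l2norm0 E).
by apply/funext => n; rewrite big_cons; case: (P i); rewrite ?add0r.
Qed.

Lemma l2_finite (E : normedZmodType R[i]) (x : nat -> E) m :
  (forall n, (m <= n)%N -> x n = 0) -> l2 x.
Proof.
move=> x0; apply/l2P; exists (\sum_(0 <= n < m) rnorm (x n) ^+ 2) => k.
have [km|mk] := leqP k m.
  rewrite [leRHS](big_cat_nat (leq0n _) km)//= lerDl sumr_ge0// => n _.
  by rewrite sqr_ge0.
rewrite (big_cat_nat (leq0n _) (ltnW mk))//= [X in _ + X]big_nat [X in _ + X]big1 ?addr0// => n /andP[mn _].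
by rewrite x0// rnorm0 expr0n.
Qed.

Lemma l2_shift (E : normedZmodType R[i]) (x : nat -> E) : l2 x ->
  l2 (fun n => x n.+1) /\ l2norm (fun n => x n.+1) <= l2norm x.
Proof.
move=> lx; apply: l2norm_le => [|m]; first exact: l2norm_ge0.
rewrite (le_trans _ (sum_le_l2norm m.+1 lx))// [leRHS]big_nat_recl//=.
by rewrite lerDr sqr_ge0.
Qed.

Lemma l2_unshift (E : normedZmodType R[i]) (x : nat -> E) : l2 x ->
  l2 (fun n => if n is m.+1 then x m else 0) /\
  l2norm (fun n => if n is m.+1 then x m else 0) <= l2norm x.
Proof.
move=> lx; apply: l2norm_le => [|[|m]]; first exact: l2norm_ge0.
  by rewrite big_nil sqr_ge0.
by rewrite big_nat_recl//= rnorm0 expr0n add0r sum_le_l2norm.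
Qed.

Lemma l2_cvg_uniq (E : normedZmodType R[i]) (u : nat -> nat -> E) x y :
  l2_cvg u x -> l2_cvg u y -> x = y.
Proof.
move=> [lu lx ux] [_ ly uy]; apply/funext => n; apply/eqP; rewrite -subr_eq0; apply/eqP.
apply: rnorm_eq0; apply/eqP; rewrite eq_le rnorm_ge0 andbT.
apply/ler_addgt0Pr => e e0; rewrite add0r.
have e2 : 0 < e / 2 by rewrite divr_gt0.
move/cvgr0Pnorm_lt : ux => /(_ _ e2) ux; move/cvgr0Pnorm_lt : uy => /(_ _ e2) uy.
have [m [h1 h2]] := filter_ex (filterI ux uy).
rewrite -(subrKA (u m n)) (le_trans (rnormD _ _))// (splitr e) rnormB lerD//.
- apply: le_trans (ltW h1); rewrite ger0_norm ?l2norm_ge0//.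
  exact: (rnorm_le_l2norm n (l2B (lu m) lx)).
- apply: le_trans (ltW h2); rewrite ger0_norm ?l2norm_ge0//.
  exact: (rnorm_le_l2norm n (l2B (lu m) ly)).
Qed.

End L2Theory.

(** * Sums of complex series *)

Section ComplexSums.
Context {R : realType}.
Implicit Types (u v : nat -> R[i]) (s t : R[i]).

(** Retains the convergence of both parts, which the equation [csum u = s] loses because [limn] has
    a default value. *)
Definition has_csum u s :=
  (series (fun n => complex.Re (u n)) @ \oo --> complex.Re s) /\
  (series (fun n => complex.Im (u n)) @ \oo --> complex.Im s).

Lemma has_csumE u s : has_csum u s -> csum u = s.
Proof.
move=> [hr hi]; rewrite /csum (cvg_lim _ hr)// (cvg_lim _ hi)//.
by case: s {hr hi}.
Qed.

(** Real and imaginary parts are each bounded by [B]; this is where the factor 2 in the bounds on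
    [fdot] comes from. *)
Lemma abs_has_csum u (B : R) : (forall m, \sum_(0 <= n < m) rnorm (u n) <= B) ->
  has_csum u (csum u) /\ rnorm (csum u) <= B + B.
Proof.
move=> h.
have key (f : R[i] -> R) : (forall z, `|f z| <= rnorm z) ->
    cvgn (series (fun n => f (u n))) /\ `|limn (series (fun n => f (u n)))| <= B.
  move=> fle.
  have [c l] : cvgn (series (fun n => `|f (u n)|)) /\ limn (series (fun n => `|f (u n)|)) <= B.
    apply: ge0_bounded_series_cvg => // m; apply: le_trans (h m).
    by apply: ler_sum => n _; exact: fle.
  split; first exact: normed_cvg.
  by rewrite (le_trans _ l)// lim_series_norm.
have [c1 l1] := key _ (@Re_le_rnorm R); have [c2 l2] := key _ (@Im_le_rnorm R).
split; first by split.
by rewrite (le_trans (rnorm_le_ReIm _))// lerD.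
Qed.

Lemma series_lin (f g h : nat -> R) (a b x y : R) :
  (forall n, h n = a * f n + b * g n) ->
  series f @ \oo --> x -> series g @ \oo --> y -> series h @ \oo --> a * x + b * y.
Proof.
move=> hfg fx gy.
have -> : series h = fun m => a * series f m + b * series g m.
  apply/funext => m; rewrite /series/= !mulr_sumr -big_split/=.
  by apply: eq_bigr => k _; rewrite hfg.
by apply: cvgD; apply: cvgM => //; exact: cvg_cst.
Qed.

Lemma has_csumD u v s t : has_csum u s -> has_csum v t ->
  has_csum (fun n => u n + v n) (s + t).
Proof.
move=> [u1 u2] [v1 v2]; split.
- rewrite complex_ReD -[complex.Re s]mul1r -[complex.Re t]mul1r.
  by apply: (series_lin _ u1 v1) => n; rewrite !mul1r complex_ReD.
- rewrite complex_ImD -[complex.Im s]mul1r -[complex.Im t]mul1r.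
  by apply: (series_lin _ u2 v2) => n; rewrite !mul1r complex_ImD.
Qed.

Lemma has_csumZ (c : R[i]) u s : has_csum u s -> has_csum (fun n => c * u n) (c * s).
Proof.
move=> [u1 u2]; split.
- by rewrite complex_ReM -mulNr; apply: (series_lin _ u1 u2) => n; rewrite complex_ReM mulNr.
- by rewrite complex_ImM; apply: (series_lin _ u2 u1) => n; rewrite complex_ImM.
Qed.

Lemma has_csum_conj u s : has_csum u s -> has_csum (fun n => (u n)^*%C) s^*%C.
Proof.
move=> [u1 u2]; split.
- have -> : complex.Re s^*%C = 1 * complex.Re s + 0 * complex.Re s by case: (s) => ? ? /=; ring.
  by apply: (series_lin _ u1 u1) => n; case: (u n) => ? ? /=; ring.
- have -> : complex.Im s^*%C = -1 * complex.Im s + 0 * complex.Im s by case: (s) => ? ? /=; ring.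
  by apply: (series_lin _ u2 u2) => n; case: (u n) => ? ? /=; ring.
Qed.

Lemma series_shift (f : nat -> R) (x : R) : f 0%N = 0 ->
  series (fun n => f n.+1) @ \oo --> x -> series f @ \oo --> x.
Proof.
move=> f0 fx; rewrite -cvg_shiftS/=.
rewrite (_ : (fun n => series f n.+1) = series (fun n => f n.+1))//.
by apply/funext => m; rewrite /series/= big_nat_recl//= f0 add0r.
Qed.

Lemma has_csum_shift u s : u 0%N = 0 -> has_csum (fun n => u n.+1) s -> has_csum u s.
Proof. by move=> u0 [u1 u2]; split; apply: series_shift => //; rewrite u0. Qed.

Lemma has_csum_finite u m : (forall n, (m <= n)%N -> u n = 0) ->
  has_csum u (\sum_(0 <= n < m) u n).
Proof.
move=> u0; have e k : (m <= k)%N -> \sum_(0 <= n < k) u n = \sum_(0 <= n < m) u n.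
  move=> mk; rewrite (big_cat_nat (leq0n _) mk)//= [X in _ + X]big_nat [X in _ + X]big1 ?addr0// => n /andP[mn _].
  exact: u0.
split; apply: cvg_near_cst; near=> k; rewrite /series/=.
- by rewrite -complex_Re_sum e//; near: k; exact: nbhs_infty_ge.
- by rewrite -complex_Im_sum e//; near: k; exact: nbhs_infty_ge.
Unshelve. all: by end_near. Qed.

Lemma has_csum0 : has_csum (fun=> 0) 0.
Proof. by have := @has_csum_finite (fun=> 0) 0 (fun _ _ => erefl); rewrite big_nil. Qed.

Lemma has_csum_sum (I : Type) (r : seq I) (P : pred I) (u : I -> nat -> R[i]) (s : I -> R[i]) :
  (forall i, has_csum (u i) (s i)) ->
  has_csum (fun n => \sum_(i <- r | P i) u i n) (\sum_(i <- r | P i) s i).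
Proof.
move=> us; elim: r => [|i r IH].
  by rewrite big_nil; under eq_fun do rewrite big_nil; exact: has_csum0.
rewrite big_cons; under eq_fun do rewrite big_cons.
by case: (P i) => //; exact: has_csumD.
Qed.

End ComplexSums.


(** * Vectors and operators of Fock space *)

Section Weights.
Context {R : realType}.

Lemma rnorm_nat n : rnorm (n%:R : R[i]) = n%:R.
Proof. by rewrite -(rmorph_nat (real_complex R)) rnormC ger0_norm. Qed.

Lemma rnorm_natX n k : rnorm (n%:R ^+ k : R[i]) = n%:R ^+ k.
Proof. by rewrite -!natrX rnorm_nat. Qed.

Lemma iter_opN (E : lmodType R[i]) k (x : nat -> E) n :
  iter k opN x n = (n%:R ^+ k : R[i]) *: x n.
Proof.
elim: k => [|k IH]; first by rewrite expr0 scale1r.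
by rewrite iterS /opN IH scalerA exprS.
Qed.

Lemma iter_opM (E : lmodType R[i]) k (x : nat -> E) n :
  iter k opM x n = (n.+1%:R ^+ k : R[i]) *: x n.
Proof.
elim: k => [|k IH]; first by rewrite expr0 scale1r.
rewrite iterS /opM /opN IH -{2}[_ *: x n]scale1r -scalerDl scalerA exprS.
by rewrite -[n.+1%:R]natr1.
Qed.

Lemma rnorm_iter_opN (E : normedModType R[i]) k (x : nat -> E) n :
  rnorm (iter k opN x n) = n%:R ^+ k * rnorm (x n).
Proof. by rewrite iter_opN rnormZ rnorm_natX. Qed.

Lemma rnorm_iter_opM (E : normedModType R[i]) k (x : nat -> E) n :
  rnorm (iter k opM x n) = n.+1%:R ^+ k * rnorm (x n).
Proof. by rewrite iter_opM rnormZ rnorm_natX. Qed.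

Lemma le_exp_nat (a b k : nat) : (a <= b)%N -> a%:R ^+ k <= b%:R ^+ k :> R.
Proof. by move=> ab; rewrite lerXn2r ?nnegrE ?ler_nat. Qed.

End Weights.

Section FockVectors.
Context {R : realType}.
Implicit Types (x y z : nat -> R[i]^o) (E : normedZmodType R[i]).

(** [M] is preferred to [N] as a weight because it is at least 1, so that its powers increase. One
    direction rests on (n + 1)^k <= 2^k n^k + 2^k. *)
Lemma domDP x : domD x <-> forall k, l2 (iter k opM x).
Proof.
split=> [xD k|h k _ j _]; last first.
  case: (@l2_dom _ _ _ (iter j opM x) (iter j opN x) 1 ler01) => // n.
  by rewrite mul1r rnorm_iter_opM rnorm_iter_opN ler_wpM2r ?rnorm_ge0// le_exp_nat.
have lj j : l2 (iter j opN x) by apply: (xD j).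
pose y n := (2 ^+ k : R[i]) *: (iter k opN x n : R[i]^o).
pose z n := (2 ^+ k : R[i]) *: (x n : R[i]^o).
case: (@l2_dom2 _ _ _ _ y z (iter k opM x)) => // [n||]; last 2 first.
- by case: (l2Z (2 ^+ k) (lj k)).
- by case: (l2Z (2 ^+ k) (lj 0%N)).
rewrite /y /z !rnormZ rnorm_iter_opN rnorm_iter_opM rnorm_natX.
rewrite mulrA -mulrDl ler_wpM2r ?rnorm_ge0//.
case: n => [|n]; first by rewrite expr1n ler_wpDl ?mulr_ge0 ?exprn_ge0// exprn_ege1// ler1n.
rewrite -exprMn -natrM (le_trans (le_exp_nat _ (_ : (_ <= 2 * n.+1)%N)))//.
  by rewrite mul2n -addnn addSn addnS !ltnS leq_addl.
by rewrite lerDl exprn_ge0.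
Qed.

Lemma domD_l2 x : domD x -> l2 x.
Proof. by move=> /domDP/(_ 0%N). Qed.

Lemma domD_opM k x : domD x -> domD (iter k opM x).
Proof. by move=> /domDP xD; apply/domDP => j; rewrite -iterD. Qed.

Lemma domD_dom x y (C : R) : 0 <= C -> (forall n, rnorm (y n) <= C * rnorm (x n)) ->
  domD x -> domD y.
Proof.
move=> C0 yx /domDP xD; apply/domDP => k.
case: (@l2_dom _ _ _ (iter k opM x) (iter k opM y) C C0) => // n.
by rewrite !rnorm_iter_opM mulrCA ler_wpM2l.
Qed.

Lemma domDD x y : domD x -> domD y -> domD (fun n => x n + y n).
Proof.
move=> /domDP xD /domDP yD; apply/domDP => k.
have := l2D (xD k) (yD k); congr l2; apply/funext => n.
by rewrite !iter_opM scalerDr.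
Qed.

Lemma domDZ (c : R[i]) x : domD x -> domD (fun n => c *: x n).
Proof. by apply: (@domD_dom _ _ (rnorm c)); rewrite ?rnorm_ge0// => n; rewrite rnormZ. Qed.

Lemma domD_finite x m : (forall n, (m <= n)%N -> x n = 0) -> domD x.
Proof.
move=> x0; apply/domDP => k; apply: (@l2_finite _ _ _ m) => n mn.
by rewrite iter_opM x0// scaler0.
Qed.

Lemma domD0 : domD (fun=> 0 : R[i]^o).
Proof. exact: (@domD_finite _ 0). Qed.

Lemma sqrt_le_nat n : Num.sqrt n%:R <= n%:R :> R.
Proof.
case: n => [|n]; first by rewrite sqrtr0.
rewrite -[leRHS]ger0_norm// -sqrtr_sqr ler_wsqrtr// expr2 ler_peMr// ler1n.
by [].
Qed.

Lemma rnorm_sqrt n (x : R[i]^o) : rnorm ((Num.sqrt n%:R)%:C *: x) <= n%:R * rnorm x.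
Proof.
by rewrite rnormZ rnormC ger0_norm ?sqrtr_ge0// ler_wpM2r ?rnorm_ge0// sqrt_le_nat.
Qed.

(** Through sqrt n <= n a ladder operator is charged a full power of [M]. The loss is harmless,
    since f(M) absorbs any power. *)
Lemma weight_ann k x : domD x -> l2 (iter k opM (ann x)) /\
  l2norm (iter k opM (ann x)) <= l2norm (iter k.+1 opM x).
Proof.
move=> /domDP xD; have [ls le] := l2_shift (xD k.+1).
case: (@l2_dom _ _ _ _ (iter k opM (ann x)) 1 ler01 _ ls) => [n|lk lek].
  rewrite mul1r !rnorm_iter_opM exprSr -mulrA ler_pM ?exprn_ge0 ?rnorm_ge0 ?le_exp_nat//.
  by rewrite (le_trans (rnorm_sqrt _ _))// ler_wpM2r ?rnorm_ge0// ler_nat.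
by split=> //; rewrite (le_trans lek)// mul1r.
Qed.

Lemma domD_ann x : domD x -> domD (ann x).
Proof. by move=> xD; apply/domDP => k; case: (weight_ann k xD). Qed.

(** Raising the level turns the weight n + 1 into n + 2 <= 2 (n + 1), hence [2 ^+ k]. *)
Lemma weight_cre k x : domD x -> l2 (iter k opM (cre x)) /\
  l2norm (iter k opM (cre x)) <= 2 ^+ k * l2norm (iter k.+1 opM x).
Proof.
move=> /domDP xD; have [ls le] := l2_unshift (xD k.+1).
have k0 : 0 <= 2 ^+ k :> R by rewrite exprn_ge0.
case: (@l2_dom _ _ _ _ (iter k opM (cre x)) (2 ^+ k) k0 _ ls) => [|lk lek].
  case=> [|n]; first by rewrite rnorm_iter_opM /= rnorm0 mulr0 mulr0.
  rewrite !rnorm_iter_opM exprSr mulrA mulrA -exprMn -natrM -mulrA.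
  rewrite ler_pM ?exprn_ge0 ?rnorm_ge0//.
    by rewrite le_exp_nat// mul2n -addnn addSn addnS !ltnS leq_addl.
  by rewrite (le_trans (rnorm_sqrt _ _))// ler_wpM2r ?rnorm_ge0// ler_nat.
by split=> //; rewrite (le_trans lek)// ler_wpM2l.
Qed.

Lemma domD_cre x : domD x -> domD (cre x).
Proof. by move=> xD; apply/domDP => k; case: (weight_cre k xD). Qed.

Lemma weight_mono k x : domD x -> l2norm (iter k opM x) <= l2norm (iter k.+1 opM x).
Proof.
move=> /domDP xD; case: (@l2_dom _ _ _ (iter k.+1 opM x) (iter k opM x) 1 ler01) => // n.
  rewrite mul1r !rnorm_iter_opM ler_wpM2r ?rnorm_ge0// exprS ler_peMl ?exprn_ge0//.
  by rewrite ler1n.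
by rewrite mul1r.
Qed.

Lemma domD_funM (f : R -> R) x : classC f -> domD x -> domD (funM f x).
Proof.
move=> [f0 [c fc] _ _]; apply: (@domD_dom _ _ c).
  by rewrite (le_trans (ltW (f0 0 _)) (fc 0 _)).
move=> n; rewrite /funM rnormZ rnormC gtr0_norm ?f0// ler_wpM2r ?rnorm_ge0//.
exact: fc.
Qed.

Lemma fdot_has x y : l2 x -> l2 y ->
  has_csum (fun n => (x n)^*%C * y n) (fdot x y) /\
  rnorm (fdot x y) <= 2 * (l2norm x * l2norm y).
Proof.
move=> lx ly; rewrite mulr_natl mulr2n; apply: abs_has_csum => m.
under eq_bigr do rewrite rnormM rnorm_conj.
apply: sum_mul_le; rewrite ?l2norm_ge0//.
- by move=> n; exact: rnorm_ge0.
- by move=> n; exact: rnorm_ge0.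
- exact: sum_le_l2norm.
- exact: sum_le_l2norm.
Qed.

Lemma rnorm_fdot x y : l2 x -> l2 y -> rnorm (fdot x y) <= 2 * (l2norm x * l2norm y).
Proof. by move=> lx ly; case: (fdot_has lx ly). Qed.

Lemma fdotC x y : l2 x -> l2 y -> fdot y x = (fdot x y)^*%C.
Proof.
move=> lx ly; have [h _] := fdot_has lx ly; apply: has_csumE.
have := has_csum_conj h; congr has_csum; apply/funext => n.
by rewrite conjcM conjcK mulrC.
Qed.

Lemma fdot_sumr (I : Type) (r : seq I) (P : pred I) x (c : I -> R[i]) (y : I -> nat -> R[i]^o) :
  l2 x -> (forall i, l2 (y i)) ->
  fdot x (fun n => \sum_(i <- r | P i) c i *: y i n) = \sum_(i <- r | P i) c i * fdot x (y i).
Proof.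
move=> lx ly; apply: has_csumE.
have := @has_csum_sum _ _ r P _ _ (fun i => has_csumZ (c i) (fdot_has lx (ly i)).1).
congr has_csum; apply/funext => n; rewrite mulr_sumr; apply: eq_bigr => i _.
by rewrite mulrCA.
Qed.

Lemma fdot_suml (I : Type) (r : seq I) (P : pred I) x (c : I -> R[i]) (y : I -> nat -> R[i]^o) :
  l2 x -> (forall i, l2 (y i)) ->
  fdot (fun n => \sum_(i <- r | P i) c i *: y i n) x =
  \sum_(i <- r | P i) (c i)^*%C * fdot (y i) x.
Proof.
move=> lx ly; have ls : l2 (fun n => \sum_(i <- r | P i) c i *: y i n).
  by apply: l2_sum => i; case: (l2Z (c i) (ly i)).
rewrite fdotC// fdot_sumr// conjc_sum; apply: eq_bigr => i _.
by rewrite conjcM -fdotC.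
Qed.

Lemma fdotZr (c : R[i]) x y : l2 x -> l2 y -> fdot x (fun n => c *: y n) = c * fdot x y.
Proof.
move=> lx ly; apply: has_csumE; have := has_csumZ c (fdot_has lx ly).1.
by congr has_csum; apply/funext => n; rewrite mulrCA.
Qed.

Lemma fdotBr x y z : l2 x -> l2 y -> l2 z ->
  fdot x (fun n => y n - z n) = fdot x y - fdot x z.
Proof.
move=> lx ly lz; apply: has_csumE.
have := has_csumD (fdot_has lx ly).1 (has_csumZ (-1) (fdot_has lx lz).1).
rewrite mulN1r; congr has_csum; apply/funext => n.
by rewrite mulN1r -mulrBr.
Qed.

Lemma fdot_iter_opM k x y : fdot (iter k opM x) y = fdot x (iter k opM y).
Proof.
rewrite /fdot; congr csum; apply/funext => n; rewrite !iter_opM conjcM.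
by rewrite -natrX conjc_nat mulrAC mulrA mulrC mulrA mulrC.
Qed.

Lemma fdot_funM (f : R -> R) x y : fdot (funM f x) y = fdot x (funM f y).
Proof.
rewrite /fdot; congr csum; apply/funext => n; rewrite /funM conjcM conjc_real.
by rewrite mulrAC mulrA mulrC mulrA mulrC.
Qed.

(** The two series differ by a shift of the index, absorbed by the vanishing coordinate 0 of
    [cre y]. *)
Lemma fdot_ann x y : l2 (ann x) -> l2 y -> fdot (ann x) y = fdot x (cre y).
Proof.
move=> lx ly; symmetry; apply: has_csumE; apply: has_csum_shift; first by rewrite mulr0.
have := (fdot_has lx ly).1; congr has_csum; apply/funext => n.
rewrite /ann /cre conjcM conjc_real.
by rewrite mulrAC mulrA mulrC mulrA mulrC.
Qed.

Definition basis_vector n : nat -> R[i]^o := fun m => (m == n)%:R.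

Lemma domD_basis n : domD (basis_vector n).
Proof.
apply: (@domD_finite _ n.+1) => m; rewrite /basis_vector; case: eqP => // ->.
by rewrite ltnn.
Qed.

Lemma fdot_basis n x : fdot x (basis_vector n) = (x n)^*%C.
Proof.
have h m : (n.+1 <= m)%N -> (x m)^*%C * basis_vector n m = 0.
  by move=> nm; rewrite /basis_vector gtn_eqF// mulr0.
rewrite /fdot (has_csumE (has_csum_finite h)) big_nat_recr//= big_nat big1 => [|m /andP[_ mn]].
  by rewrite add0r /basis_vector eqxx mulr1.
by rewrite /basis_vector ltn_eqF// mulr0.
Qed.

(* An adjoint defined on the dense domain makes the operator closable. *)
Lemma Lplus_adjoint (T T' : (nat -> R[i]^o) -> nat -> R[i]^o) :
  (forall (c : R[i]) x y, domD x -> domD y ->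
     T (fun n => c *: x n + y n) = fun n => c *: T x n + T y n) ->
  (forall x, domD x -> domD (T x)) -> (forall x, domD x -> domD (T' x)) ->
  (forall x y, domD x -> domD y -> fdot (T x) y = fdot x (T' y)) -> Lplus T.
Proof.
move=> Tlin TD T'D TT'; split=> //; last by move=> y yD; exists (T' y); [exact: T'D|move=> x xD; exact: TT'].
move=> u y uD [lu _ u0] [lTu ly Tuy]; apply/funext => n.
apply: rnorm_eq0; apply/eqP; rewrite eq_le rnorm_ge0 andbT.
apply/ler_addgt0Pr => e e0; rewrite add0r.
pose K := 2 * l2norm (T' (basis_vector n)) + 1.
have K0 : 0 < K by rewrite ltr_wpDl// mulr_ge0// l2norm_ge0.
have e2 : 0 < e / 2 by rewrite divr_gt0.
have eK : 0 < e / 2 / K by rewrite divr_gt0.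
move/cvgr0Pnorm_lt : u0 => /(_ _ eK) u0; move/cvgr0Pnorm_lt : Tuy => /(_ _ e2) Tuy.
have [m [h1 h2]] := filter_ex (filterI u0 Tuy).
rewrite -(subrK (T (u m) n) (y n)) (le_trans (rnormD _ _))// (splitr e) rnormB.
rewrite lerD//.
  apply: le_trans (ltW h2); rewrite ger0_norm ?l2norm_ge0//.
  exact: (rnorm_le_l2norm n (l2B (lTu m) ly)).
(* A coordinate of [T (u m)] is an inner product with a basis vector; moved to the right by [T'], it
   is small together with [u m]. *)
rewrite -rnorm_conj -fdot_basis TT'//; last exact: domD_basis.
have lT' := domD_l2 (T'D _ (@domD_basis n)).
rewrite (le_trans (rnorm_fdot (domD_l2 (uD m)) lT'))//.
have {h1} : l2norm (u m) < e / 2 / K.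
  move: h1; rewrite ger0_norm ?l2norm_ge0//.
  by rewrite (_ : (fun n => _) = u m)//; apply/funext => k; rewrite subr0.
rewrite ltr_pdivlMr// => h1; apply: le_trans (ltW h1).
rewrite mulrCA ler_wpM2l ?l2norm_ge0// /K.
by rewrite lerDl.
Qed.

End FockVectors.


(** * Trigonometric polynomials *)

Section MeanValue.
Context {R : realType}.
Implicit Types (f df g dg : R -> R).

Lemma mean_value f df a b : a <= b -> (forall x : R, is_derive x 1 f (df x)) ->
  exists2 c, a <= c <= b & f b - f a = df c * (b - a).
Proof.
move=> ab fdf; have [//|c] := @MVT_segment _ f df a b ab.
  by apply: derivable_within_continuous => x _; exact: ex_derive.
by rewrite in_itv/= => cab e; exists c.
Qed.

Lemma mean_value_bound f df (t e : R) : (forall x : R, is_derive x 1 f (df x)) ->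
  (forall x, `|x| <= `|t| -> `|df x| <= e) -> `|f t - f 0| <= e * `|t|.
Proof.
move=> fdf dfe; have [t0|t0] := leP 0 t.
  have [c /andP[c0 ct] ->] := mean_value t0 fdf.
  rewrite subr0 normrM ler_wpM2r// dfe// !ger0_norm//.
have [c /andP[ct c0] h] := mean_value (ltW t0) fdf.
rewrite distrC h sub0r normrM normrN ler_wpM2r// dfe//.
by rewrite !ler0_norm ?lerN2// ltW.
Qed.

Lemma is_derive_scale_arg f df (a : R) : (forall x : R, is_derive x 1 f (df x)) ->
  forall x : R, is_derive x 1 (fun y => f (y * a)) (a * df (x * a)).
Proof.
move=> fdf x; have h : is_derive x 1 (fun y : R => y * a) a.
  have -> : (fun y : R => y * a) = a \*: id by apply/funext => y; rewrite mulrC.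
  by apply: is_derive_eq; rewrite [LHS]mulr1.
have := @is_derive1_comp R f (fun y => y * a) x (df (x * a)) a (fdf _) h.
by rewrite mulrC.
Qed.

(** The function exp(- C x) g(x) has nonpositive derivative. *)
Lemma gronwall_ge0 g dg (C t : R) : 0 <= t -> (forall x : R, is_derive x 1 g (dg x)) ->
  (forall x, `|dg x| <= C * g x) -> g t <= expR (C * t) * g 0.
Proof.
move=> t0 gdg dgC.
pose f (x : R) := expR (x * - C) * g x.
have fdf (x : R) : is_derive x 1 f (expR (x * - C) * (dg x - C * g x)).
  have h := is_derive_scale_arg (- C) (@is_derive_expR R) x.
  have hh : is_derive x 1 f _ := is_deriveM h (gdg x); apply: (is_derive_eq hh).
  rewrite /GRing.scale/=; ring.
have [c _ h] := mean_value t0 fdf.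
have : f t <= f 0.
  rewrite -subr_le0 h subr0 mulr_le0_ge0// mulr_ge0_le0 ?expR_ge0//.
  by rewrite subr_le0 (le_trans (ler_norm _)).
rewrite /f mul0r expR0 mul1r mulrN expRN => ft.
rewrite -ler_pdivrMl ?expR_gt0//.
by rewrite [C * t]mulrC.
Qed.

Lemma gronwall g dg (C t : R) : (forall x : R, is_derive x 1 g (dg x)) ->
  (forall x, `|dg x| <= C * g x) -> g t <= expR (C * `|t|) * g 0.
Proof.
move=> gdg dgC; have [t0|t0] := leP 0 t; first by rewrite ger0_norm//; exact: gronwall_ge0 gdg dgC.
have := @gronwall_ge0 (fun x => g (x * -1)) (fun x => -1 * dg (x * -1)) C `|t|
  (normr_ge0 _) (is_derive_scale_arg (-1) gdg).
rewrite mul0r mulrN1 ltr0_norm// opprK; apply => x.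
by rewrite mulN1r normrN.
Qed.

End MeanValue.

(** * Complex exponentials and their finite sums *)

Section ComplexExponential.
Context {R : realType}.
Implicit Types t u : R.

Definition cexp t : R[i] := cos t +i* sin t.

Lemma cexp0 : cexp 0 = 1.
Proof. by rewrite /cexp cos0 sin0. Qed.

Lemma cexpD t u : cexp (t + u) = cexp t * cexp u.
Proof.
apply/eqP; rewrite eq_complex/= cosD sinD eqxx/=; apply/eqP; ring.
Qed.

Lemma conjc_cexp t : (cexp t)^*%C = cexp (- t).
Proof. by rewrite /cexp cosN sinN. Qed.

Lemma rnorm_cexp t : rnorm (cexp t) = 1.
Proof. by rewrite rnorm_def/= cos2Dsin2 sqrtr1. Qed.

(** The powers of i sort the exponential series into the series of [cos_coeff] and [sin_coeff]. *)
Lemma cexp_series t :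
  rnorm (\sum_(k < m) (('i%C * t%:C) ^+ k / k`!%:R) - cexp t) @[m --> \oo] --> (0 : R).
Proof.
have ik k : 'i%C ^+ k = (if odd k then 'i%C * ((-1) ^+ k./2)%:C else ((-1) ^+ k./2)%:C) :> R[i].
  rewrite rmorphXn/= rmorphN rmorph1 -sqr_i -exprM mul2n.
  rewrite -[k in LHS]odd_double_half exprD; case: (odd k); first by rewrite expr1.
  by rewrite expr0 mul1r.
have e k : ('i%C * t%:C) ^+ k / k`!%:R = cos_coeff t k +i* sin_coeff t k.
  rewrite exprMn ik -(rmorph_nat (real_complex R)) -fmorphV -rmorphXn/=.
  rewrite /cos_coeff /sin_coeff /= -exprnP.
  case: (boolP (odd k)) => ok; last first.
    by rewrite -!rmorphM/= !mul0r mul1r.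
  have -> : k.-1./2 = k./2 by case: k ok => // k /= /negbTE ok; rewrite uphalf_half ok.
  rewrite -!mulrA -!rmorphM/=; apply/eqP; rewrite eq_complex/=.
  by apply/andP; split; apply/eqP; ring.
have -> : (fun m => rnorm (\sum_(k < m) (('i%C * t%:C) ^+ k / k`!%:R) - cexp t)) =
   fun m => rnorm ((series (cos_coeff t) m - cos t) +i* (series (sin_coeff t) m - sin t)).
  apply/funext => m; congr rnorm; under eq_bigr do rewrite e.
  apply/eqP; rewrite eq_complex !complex_ReD !complex_ImD complex_Re_sum complex_Im_sum.
  by rewrite /series /= !big_mkord !eqxx.
have hc : series (cos_coeff t) @ \oo --> cos t.
  by rewrite unlock; exact: is_cvg_series_cos_coeff.
have hs : series (sin_coeff t) @ \oo --> sin t.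
  by rewrite unlock; exact: is_cvg_series_sin_coeff.
apply/cvgr0Pnorm_lt => e0 e00.
have e2 : 0 < e0 / 2 by rewrite divr_gt0.
move/cvgrPdist_lt : hc => /(_ _ e2) hc; move/cvgrPdist_lt : hs => /(_ _ e2) hs.
apply: filterS2 hc hs => m h1 h2.
rewrite ger0_norm ?rnorm_ge0// (le_lt_trans (rnorm_le_ReIm _))// (splitr e0).
by rewrite ltrD//= distrC.
Qed.

Section TrigonometricPolynomials.
Variables (I : finType) (w : I -> R) (c : I -> R[i]).

(** The general matrix element of a unitary group with finitely many real frequencies [w];
    differentiating it replaces vector-valued calculus. *)
Definition trig_poly t : R[i] := \sum_i cexp (t * w i) * c i.

Definition trig_poly' t : R[i] := \sum_i ('i%C * (w i)%:C) * (cexp (t * w i) * c i).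

Lemma is_derive_big (J : Type) (r : seq J) (f df : J -> R -> R) (x : R) :
  (forall j, is_derive x 1 (f j) (df j x)) ->
  is_derive x 1 (fun t => \sum_(j <- r) f j t) (\sum_(j <- r) df j x).
Proof.
move=> h; elim: r => [|j r IH].
  rewrite big_nil (_ : (fun t => _) = cst 0); first exact: is_derive_cst.
  by apply/funext => t; rewrite big_nil.
rewrite big_cons (_ : (fun t => _) = f j + (fun t => \sum_(j <- r) f j t)).
  exact: is_deriveD.
by apply/funext => t; rewrite big_cons.
Qed.

Lemma is_derive_Re_trig (x : R) :
  is_derive x 1 (fun t => complex.Re (trig_poly t)) (complex.Re (trig_poly' x)).
Proof.
rewrite /trig_poly /trig_poly' complex_Re_sum.
have -> : (fun t => complex.Re (\sum_i cexp (t * w i) * c i)) =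
    fun t => \sum_i complex.Re (cexp (t * w i) * c i).
  by apply/funext => t; rewrite complex_Re_sum.
apply: (@is_derive_big _ _ _ (fun i x => complex.Re _)) => i.
have h1 := is_derive_scale_arg (w i) (@is_derive_cos R) x.
have h2 := is_derive_scale_arg (w i) (@is_derive_sin R) x.
have -> : (fun t => complex.Re (cexp (t * w i) * c i)) =
  (complex.Re (c i) \*: (fun y => cos (y * w i))) - (complex.Im (c i) \*: (fun y => sin (y * w i))).
  by apply/funext => t; rewrite complex_ReM /= /GRing.scale /= ![_ * complex.Re _]mulrC ![_ * complex.Im _]mulrC.
apply: is_derive_eq; rewrite /GRing.scale /=; case: (c i) => a b /=; ring.
Qed.

Lemma is_derive_Im_trig (x : R) :
  is_derive x 1 (fun t => complex.Im (trig_poly t)) (complex.Im (trig_poly' x)).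
Proof.
rewrite /trig_poly /trig_poly' complex_Im_sum.
have -> : (fun t => complex.Im (\sum_i cexp (t * w i) * c i)) =
    fun t => \sum_i complex.Im (cexp (t * w i) * c i).
  by apply/funext => t; rewrite complex_Im_sum.
apply: (@is_derive_big _ _ _ (fun i x => complex.Im _)) => i.
have h1 := is_derive_scale_arg (w i) (@is_derive_cos R) x.
have h2 := is_derive_scale_arg (w i) (@is_derive_sin R) x.
have -> : (fun t => complex.Im (cexp (t * w i) * c i)) =
  (complex.Im (c i) \*: (fun y => cos (y * w i))) + (complex.Re (c i) \*: (fun y => sin (y * w i))).
  by apply/funext => t; rewrite complex_ImM /= /GRing.scale /= ![_ * complex.Re _]mulrC ![_ * complex.Im _]mulrC.
apply: is_derive_eq; rewrite /GRing.scale /=; case: (c i) => a b /=; ring.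
Qed.

(** The mean value bound for the sum corrected by the linear term t d. It holds for real functions,
    hence is applied to both parts, whence the factor 2. *)
Lemma trig_poly_bound (d : R[i]) t (e : R) :
  (forall u, `|u| <= `|t| -> rnorm (trig_poly' u + d) <= e) ->
  rnorm (trig_poly t + t%:C * d - trig_poly 0) <= 2 * e * `|t|.
Proof.
move=> h.
have ReB (f df : R -> R) (b : R) : (forall x : R, is_derive x 1 f (df x)) ->
    forall x : R, is_derive x 1 (fun y => f y + y * b) (df x + b).
  move=> fdf x; have := is_deriveD (fdf x) (is_deriveZ b (is_derive_id x (1 : R))).
  rewrite [b *: 1]mulr1.
  have -> // : f + b \*: id = fun y => f y + y * b.
  by apply/funext => y; rewrite mulrC.
have h1 := mean_value_bound (ReB _ _ (complex.Re d) is_derive_Re_trig) (t := t) (e := e).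
have h2 := mean_value_bound (ReB _ _ (complex.Im d) is_derive_Im_trig) (t := t) (e := e).
rewrite (le_trans (rnorm_le_ReIm _))// mulr2n mulrDl mulrDl mul1r lerD//.
- have := h1 _; rewrite mul0r addr0; set a := _ + _ - _ => /(_ _) k.
  rewrite (_ : complex.Re _ = a).
    by apply: k => x xt; rewrite -complex_ReD (le_trans (Re_le_rnorm _))// h.
  by rewrite /a raddfB /= !complex_ReD complex_ReM /= mul0r subr0.
- have := h2 _; rewrite mul0r addr0; set a := _ + _ - _ => /(_ _) k.
  rewrite (_ : complex.Im _ = a).
    by apply: k => x xt; rewrite -complex_ImD (le_trans (Im_le_rnorm _))// h.
  by rewrite /a !complex_ImD complex_ImM /= mul0r addr0; case: (trig_poly 0).
Qed.

End TrigonometricPolynomials.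

Lemma cexp_lip t u : rnorm (cexp t - cexp u) <= 2 * `|t - u|.
Proof.
have := @trig_poly_bound 'I_1 (fun=> 1) (fun=> 1) 0 (t - u) 1.
have e x : trig_poly (fun=> 1 : R) (fun _ : 'I_1 => 1) x = cexp x :> R[i].
  by rewrite /trig_poly big_ord1 !mulr1.
have -> : cexp t - cexp u = cexp u * (cexp (t - u) - 1).
  by rewrite mulrBr mulr1 -cexpD subrKC.
rewrite rnormM rnorm_cexp mul1r !e mulr0 addr0 mulr1 cexp0; apply => x _.
rewrite /trig_poly' big_ord1 addr0 !mulr1 rnormM rnorm_cexp mulr1.
by rewrite rnorm_def /= expr0n add0r expr1n sqrtr1.
Qed.

End ComplexExponential.


(** * The truncated field operator and its evolution *)

Lemma sum_option (V : nmodType) (I : finType) (F : option I -> V) :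
  \sum_j F j = F None + \sum_i F (Some i).
Proof.
rewrite (bigD1 None)//= (reindex_omap Some id)/=; last by case.
by congr (_ + _); apply: eq_bigl => i; rewrite eqxx.
Qed.

Section HermitianMatrices.
Context {R : realType}.

(** The spectral theorem in coordinates. The eigenvectors are the conjugates of the rows of [P]; the
    first two identities are their orthonormality and completeness. *)
Lemma hermitian_eigenbasis n (A : 'M[R[i]]_n) : (forall i j, (A i j)^*%C = A j i) ->
  exists (P : 'M[R[i]]_n) (ev : 'I_n -> R),
  [/\ forall j k, \sum_m P j m * (P k m)^*%C = (j == k)%:R,
      forall m m', \sum_j (P j m)^*%C * P j m' = (m == m')%:R &
      forall j m, \sum_k A m k * (P j k)^*%C = (ev j)%:C * (P j m)^*%C].
Proof.
move=> Aherm; have hA : A \is hermsymmx.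
  by apply/is_hermitianmxP; rewrite expr0 scale1r; apply/matrixP => i j; rewrite !mxE; exact/esym/Aherm.
pose P := spectralmx A; pose D := spectral_diag A.
have Pu : P \is unitarymx := spectral_unitarymx A.
have PP : P *m (map_mx Num.conj P^T) = 1%:M by exact/unitarymxP.
have PP' : (map_mx Num.conj P^T) *m P = 1%:M by exact: mulmx1C.
have AP : A *m (map_mx Num.conj P^T) = (map_mx Num.conj P^T) *m diag_mx D.
  have /orthomx_spectralP -> := hermitian_normalmx hA.
  by rewrite -/P -/D invmx_unitary// -!mulmxA PP mulmx1.
have Dr j : D 0 j = (complex.Re (D 0 j))%:C.
  rewrite RRe_real//; have /mxOverP := hermitian_spectral_diag_real hA.
  by apply.
exists P, (fun j => complex.Re (D 0 j)); split=> [j k|m m'|j m].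
- by have /matrixP/(_ j k) := PP; rewrite !mxE => <-; apply: eq_bigr => m _; rewrite !mxE.
- by have /matrixP/(_ m m') := PP'; rewrite !mxE => <-; apply: eq_bigr => k _; rewrite !mxE.
- have /matrixP/(_ m j) := AP; rewrite mul_mx_diag !mxE -Dr mulrC => <-.
  by apply: eq_bigr => k _; rewrite !mxE.
Qed.

End HermitianMatrices.

Section FieldOperator.
Context {R : realType}.
Implicit Types (x y : nat -> R[i]^o) (L : nat).

Definition fieldOp L x : nat -> R[i]^o := fun n => annL L x n + creL L x n.

(** The truncation is asymmetric at level [L]: the annihilation part would draw on level [L.+1] and
    is cut, the creation part is intact. *)
Lemma fieldOpE L x n : fieldOp L x n = if (n <= L)%N then
  (if (n < L)%N then (Num.sqrt n.+1%:R)%:C *: x n.+1 else 0) +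
  (if n is m.+1 then (Num.sqrt n%:R)%:C *: x m else 0) else 0.
Proof.
rewrite /fieldOp /annL /creL /opQ /ann /cre; have [nL|nL] := leqP n L; last by rewrite addr0.
case: n nL => [|n] nL; congr (_ + _); do ?by case: ifP => //; rewrite scaler0.
by rewrite (ltnW nL).
Qed.

Let fieldmx L : 'M[R[i]]_L.+1 := \matrix_(i, j)
  ((if (j == i.+1 :> nat) then (Num.sqrt i.+1%:R)%:C else 0) +
   (if (i == j.+1 :> nat) then (Num.sqrt i%:R)%:C else 0)).

Let sum_pick N (a : nat) (f : nat -> R[i]) :
  \sum_(k < N) (if (k == a :> nat) then f k else 0) = if (a < N)%N then f a else 0.
Proof.
case: ltnP => aN; last by rewrite big1// => k _; case: eqP => // ka; move: (ltn_ord k); rewrite ka ltnNge aN.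
rewrite (bigD1 (Ordinal aN))//= eqxx big1 ?addr0// => k.
by rewrite -val_eqE/= => /negbTE ->.
Qed.

Let fieldmxE L x (i : 'I_L.+1) : fieldOp L x i = \sum_k fieldmx L i k * x k.
Proof.
rewrite fieldOpE -ltnS ltn_ord.
transitivity (\sum_(k < L.+1) ((if (k == i.+1 :> nat) then (Num.sqrt i.+1%:R)%:C * x k else 0) +
   (if (i == k.+1 :> nat) then (Num.sqrt i%:R)%:C * x k else 0))); last first.
  by apply: eq_bigr => k _; rewrite mxE mulrDl; congr (_ + _); case: ifP => _//; rewrite mul0r.
rewrite big_split/= (sum_pick _ _ (fun k => (Num.sqrt i.+1%:R)%:C * x k)) ltnS; congr (_ + _).
case: (nat_of_ord i) (ltn_ord i) => [|m] mL; first by rewrite big1.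
under eq_bigr do rewrite eqSS eq_sym.
by rewrite (sum_pick _ _ (fun k => (Num.sqrt m.+1%:R)%:C * x k)) ltnW.
Qed.

Let fieldmx_herm L (i j : 'I_L.+1) : (fieldmx L i j)^*%C = fieldmx L j i.
Proof.
rewrite !mxE conjcD addrC; congr (_ + _).
  by case: ifP => [/eqP ->|_]; rewrite ?conjc0// conjc_real.
by case: ifP => [/eqP ->|_]; rewrite ?conjc0// conjc_real.
Qed.

(** The index [Some j] stands for an eigenvector of the matrix on the levels up to [L], [None] for
    the whole tail above [L], on which the truncated operator vanishes. Thus finitely many
    projections resolve the identity of the full Fock space. *)
Record field_spectrum L := FieldSpectrum {
  fev : option 'I_L.+1 -> R;
  fproj : option 'I_L.+1 -> (nat -> R[i]^o) -> nat -> R[i]^o;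
  fproj_lin : forall j (c : R[i]) x y,
    fproj j (fun n => c *: x n + y n) = fun n => c *: fproj j x n + fproj j y n;
  fproj_sum : forall x n, \sum_j fproj j x n = x n;
  fproj_orth : forall j k x, fproj j (fproj k x) = if j == k then fproj j x else fun=> 0;
  fproj_eig : forall j x, fieldOp L (fproj j x) = fun n => (fev j)%:C *: fproj j x n;
  fproj_out : forall j x n, (L < n)%N -> fproj j x n = if j is None then x n else 0;
  fproj_sa : forall j x y, fdot (fproj j x) y = fdot x (fproj j y)
}.

Lemma field_spectrum_exists L : field_spectrum L.
Proof.
have /cid[P /cid[ev [rows cols eig]]] := hermitian_eigenbasis (@fieldmx_herm L).
(* The coefficient of [x] along the j-th eigenvector, whose entries are the conjugates of row [j] of
   [P]. *)
pose c j x : R[i] := \sum_(m < L.+1) P j m * x m.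
pose F (j : option 'I_L.+1) x : nat -> R[i]^o := fun n =>
  if j is Some j then (if (n <= L)%N then (P j (inord n))^*%C * c j x else 0)
  else (if (n <= L)%N then 0 else x n).
have FE j x (n : 'I_L.+1) : F (Some j) x n = (P j n)^*%C * c j x.
  by rewrite /F -ltnS ltn_ord inord_val.
have cF j k x : c j (F (Some k) x) = (j == k)%:R * c k x.
  rewrite {1}/c; under eq_bigr do rewrite FE mulrA.
  by rewrite -mulr_suml rows.
have Fout j x n : (L < n)%N -> F j x n = if j is None then x n else 0.
  by move=> Ln; rewrite /F leqNgt Ln; case: j.
apply: (@FieldSpectrum L (fun j => if j is Some j then ev j else 0) F) => //.
- move=> [j|] a x y; apply/funext => n; rewrite /F; case: ifP => _; rewrite ?scaler0 ?addr0//.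
  rewrite /c; under eq_bigr do rewrite mulrDr.
  rewrite big_split/= mulrDr; congr (_ + _).
  rewrite /GRing.scale/= [RHS]mulrCA; congr (_ * _).
  by rewrite mulr_sumr; apply: eq_bigr => m _; rewrite mulrCA.
- move=> x n; rewrite sum_option.
  have [nL|nL] := leqP n L; last first.
    by rewrite Fout// big1 ?addr0// => j _; rewrite Fout.
  rewrite {1}/F nL add0r; have -> : n = Ordinal (nL : (n < L.+1)%N) by [].
  move: (Ordinal _) => {nL}n.
  under eq_bigr do rewrite FE /c mulr_sumr.
  rewrite exchange_big/= (bigD1 n)//= [X in _ + X]big1 ?addr0 => [|m mn].
    by under eq_bigr do rewrite mulrA; rewrite -mulr_suml cols eqxx mul1r.
  by under eq_bigr do rewrite mulrA; rewrite -mulr_suml cols eq_sym (negbTE mn) mul0r.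
- move=> [j|] [k|] x; apply/funext => n; rewrite ?(inj_eq (@Some_inj _)).
  + rewrite {1}/F cF; case: (eqVneq j k) => [->|jk]; first by rewrite mul1r.
    by rewrite mul0r mulr0 if_same.
  + rewrite /F; case: ifP => // nL; rewrite /c big1 ?mulr0// => m _.
    by rewrite -ltnS ltn_ord mulr0.
  + by rewrite /F; case: (n <= L)%N.
  + by rewrite /F; case: (n <= L)%N.
- move=> j x; apply/funext => n; have [nL|nL] := leqP n L; last first.
    rewrite fieldOpE leqNgt nL /= Fout//; case: j => [j|]; first by rewrite /= scaler0.
    by rewrite (rmorph0 (real_complex R)) scale0r.
  have -> : n = Ordinal (nL : (n < L.+1)%N) by [].
  move: (Ordinal _) => {nL}n; rewrite fieldmxE; case: j => [j|].
    under eq_bigr do rewrite FE mulrA.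
    by rewrite -mulr_suml eig FE /GRing.scale/= mulrA.
  rewrite (rmorph0 (real_complex R)) scale0r big1// => k _.
  by rewrite /F -ltnS ltn_ord mulr0.
- move=> [j|] x y; last first.
    rewrite /fdot; congr csum; apply/funext => n; rewrite /F.
    by case: ifP => _//; rewrite conjc0 mul0r mulr0.
  have h1 n : (L.+1 <= n)%N -> (F (Some j) x n)^*%C * y n = 0.
    by move=> nL; rewrite Fout// conjc0 mul0r.
  have h2 n : (L.+1 <= n)%N -> (x n)^*%C * F (Some j) y n = 0.
    by move=> nL; rewrite Fout// mulr0.
  rewrite /fdot (has_csumE (has_csum_finite h1)) (has_csumE (has_csum_finite h2)).
  rewrite !big_mkord; under eq_bigr do rewrite FE conjcM conjcK [_ * (c j x)^*%C]mulrC -mulrA.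
  under [RHS]eq_bigr do rewrite FE mulrA.
  rewrite -mulr_sumr -mulr_suml; congr (_ * _).
    rewrite /c conjc_sum; apply: eq_bigr => k _.
    by rewrite conjcM mulrC.
Qed.

End FieldOperator.


(** * Linear operators on sequences *)

Section SequenceOperators.
Context {R : realType} {E F : lmodType R[i]}.

Definition seq_lin (T : (nat -> E) -> nat -> F) := forall (c : R[i]) x y,
  T (fun n => c *: x n + y n) = fun n => c *: T x n + T y n.

Variable T : (nat -> E) -> nat -> F.
Hypothesis Tlin : seq_lin T.

Lemma seq_lin0 : T (fun=> 0) = fun=> 0.
Proof.
have e : (fun=> 0) = (fun n => 1 *: (fun=> 0) n + (fun=> 0) n) :> (nat -> E).
  by apply/funext => n; rewrite scaler0 addr0.
apply/funext => n; have := congr1 (fun f => T f n) e; rewrite (Tlin 1 (fun=> 0) (fun=> 0)) scale1r.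
by move=> /eqP; rewrite -subr_eq0 opprD addrA subrr sub0r oppr_eq0 => /eqP.
Qed.

Lemma seq_lin_sum (I : Type) (r : seq I) (c : I -> R[i]) (y : I -> nat -> E) :
  T (fun n => \sum_(i <- r) c i *: y i n) = fun n => \sum_(i <- r) c i *: T (y i) n.
Proof.
elim: r => [|i r IH].
  rewrite (_ : (fun n => _) = fun=> 0); last by apply/funext => n; rewrite big_nil.
  by rewrite seq_lin0; apply/funext => n; rewrite big_nil.
rewrite (_ : (fun n => _) = fun n => c i *: y i n + \sum_(i <- r) c i *: y i n).
  by rewrite Tlin IH; apply/funext => n; rewrite big_cons.
by apply/funext => n; rewrite big_cons.
Qed.

Lemma seq_linD x y : T (fun n => x n + y n) = fun n => T x n + T y n.
Proof.
have -> : (fun n => x n + y n) = fun n => 1 *: x n + y n.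
  by apply/funext => n; rewrite scale1r.
by rewrite Tlin; apply/funext => n; rewrite scale1r.
Qed.

Lemma seq_linZ c x : T (fun n => c *: x n) = fun n => c *: T x n.
Proof.
have -> : (fun n => c *: x n) = fun n => c *: x n + (fun=> 0) n.
  by apply/funext => n; rewrite addr0.
by rewrite Tlin seq_lin0; apply/funext => n; rewrite addr0.
Qed.

Lemma seq_linB x y : T (fun n => x n - y n) = fun n => T x n - T y n.
Proof.
have -> : (fun n => x n - y n) = fun n => x n + (-1) *: y n.
  by apply/funext => n; rewrite scaleN1r.
rewrite (seq_linD x (fun n => -1 *: y n)) (seq_linZ (-1) y); apply/funext => n.
by rewrite scaleN1r.
Qed.

End SequenceOperators.

Section BasicOperators.
Context {R : realType} {E : lmodType R[i]}.

Lemma ann_lin : seq_lin (@ann R E).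
Proof. by move=> c x y; apply/funext => n; rewrite /ann scalerDr !scalerA mulrC. Qed.

Lemma cre_lin : seq_lin (@cre R E).
Proof.
move=> c x y; apply/funext => -[|n]; rewrite /cre; first by rewrite scaler0 addr0.
by rewrite scalerDr !scalerA mulrC.
Qed.

Lemma opQ_lin L : seq_lin (@opQ R E L).
Proof.
move=> c x y; apply/funext => n; rewrite /opQ; case: ifP => // _.
by rewrite scaler0 addr0.
Qed.

Lemma opM_lin k : seq_lin (iter k (@opM R E)).
Proof.
by move=> c x y; apply/funext => n; rewrite !iter_opM scalerDr !scalerA mulrC.
Qed.

Lemma funM_lin f : seq_lin (@funM R E f).
Proof. by move=> c x y; apply/funext => n; rewrite /funM scalerDr !scalerA mulrC. Qed.

Lemma annL_lin L : seq_lin (@annL R E L).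
Proof. by move=> c x y; rewrite /annL opQ_lin ann_lin opQ_lin. Qed.

Lemma creL_lin L : seq_lin (@creL R E L).
Proof. by move=> c x y; rewrite /creL opQ_lin cre_lin opQ_lin. Qed.

End BasicOperators.

(** * Commutator of the field operator with the weights *)

Section WeightInequalities.
Context {R : realType}.

(** A discrete form of x (x^p)' = p x^p. The factor 2^p, due to x + 1 <= 2 x, gives the induction on
    [p] enough room. *)
Lemma weight_increment (n p : nat) :
  (n.+2%:R ^+ p - n.+1%:R ^+ p) * n.+1%:R <= (p * 2 ^ p)%:R * n.+1%:R ^+ p :> R.
Proof.
elim: p => [|p IH]; first by rewrite !expr0 subrr !mul0r.
set x : R := n.+1%:R; have x0 : 0 < x by rewrite ltr0n.
have x1 : 1 <= x by rewrite ler1n.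
have -> : n.+2%:R = x + 1 :> R by rewrite /x natr1.
move: IH; rewrite -/x (_ : n.+2%:R = x + 1 :> R); last by rewrite /x natr1.
set D := (x + 1) ^+ p - x ^+ p => IH.
have -> : (x + 1) ^+ p.+1 - x ^+ p.+1 = (x + 1) * D + x ^+ p by rewrite /D !exprS; ring.
have xp : 0 <= x ^+ p by rewrite exprn_ge0// ltW.
have h : (x + 1) * (D * x) <= (2 * x) * ((p * 2 ^ p)%:R * x ^+ p).
  apply: (@le_trans _ _ ((x + 1) * ((p * 2 ^ p)%:R * x ^+ p))).
    by rewrite ler_wpM2l// addr_ge0// ltW.
  rewrite ler_wpM2r ?mulr_ge0//; lra.
rewrite mulrDl -mulrA (le_trans (lerD h (lexx _)))//.
rewrite !natrM !natrX !exprS -natr1.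
have e : 0 <= x ^+ p * x by rewrite mulr_ge0// ltW.
have e2 : 1 <= 2 ^+ p :> R by rewrite exprn_ege1// ler1n.
have : x ^+ p * x <= 2 * 2 ^+ p * (x ^+ p * x).
  by rewrite ler_peMl//; lra.
by move: (x ^+ p) (2 ^+ p) xp e e2 => a b a0 ? ? hh; nra.
Qed.

Lemma sqrt_weight_increment (n p : nat) :
  (n.+2%:R ^+ p - n.+1%:R ^+ p) * Num.sqrt n.+1%:R <= (p * 2 ^ p)%:R * n.+1%:R ^+ p :> R.
Proof.
apply: le_trans (weight_increment n p); rewrite ler_wpM2l ?sqrt_le_nat//.
by rewrite subr_ge0 le_exp_nat.
Qed.

(* The sum is the expectation of the commutator of the field operator with the
   weight: the increments of the weight absorb the factor [sqrt n]. *)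
Lemma field_commutator_bound (L p : nat) (x : nat -> R[i]^o) :
  `|\sum_(0 <= n < L.+1) n.+1%:R ^+ p * complex.Im ((x n)^*%C * fieldOp L x n)| <=
  ((p * 2 ^ p)%:R *+ 2) * \sum_(0 <= n < L.+1) n.+1%:R ^+ p * rnorm (x n) ^+ 2.
Proof.
pose c n := complex.Im ((x n)^*%C * x n.+1).
pose w n : R := n.+1%:R ^+ p; pose b n : R := Num.sqrt n.+1%:R.
have e1 n : complex.Im ((x n.+1)^*%C * x n) = - c n.
  by rewrite /c; case: (x n) (x n.+1) => a b' [a' b''] /=; ring.
have ImZ (r : R) (z : R[i]) : complex.Im (r%:C * z) = r * complex.Im z.
  by rewrite complex_ImM /= mul0r addr0.
(* Summation by parts: the transitions from n to n + 1 and back have opposite imaginary parts, so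
   only increments of the weight remain. *)
have -> : \sum_(0 <= n < L.+1) n.+1%:R ^+ p * complex.Im ((x n)^*%C * fieldOp L x n) =
    \sum_(0 <= n < L) (w n - w n.+1) * b n * c n.
  transitivity (\sum_(0 <= n < L.+1) (if (n < L)%N then w n * (b n * c n) else 0) -
     \sum_(0 <= n < L.+1) (if n is m.+1 then w n * (b m * c m) else 0)).
    rewrite -sumrB [LHS]big_nat [RHS]big_nat; apply: eq_bigr => n /andP[_ nL].
    rewrite fieldOpE -ltnS nL mulrDr complex_ImD mulrDr; congr (_ + _).
      case: ifP => _; last by rewrite !mulr0.
      by rewrite [_^*%C * _]mulrCA ImZ.
    case: n nL => [|n] nL; first by rewrite !mulr0 oppr0.
    by rewrite [_^*%C * _]mulrCA ImZ e1 !mulrN.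
  rewrite big_nat_recr//= ltnn addr0 [X in _ - X]big_nat_recl//= add0r.
  rewrite big_nat [X in _ - X]big_nat -sumrB [RHS]big_nat; apply: eq_bigr => n /andP[_ nL].
  by rewrite nL; ring.
rewrite (le_trans (ler_norm_sum _ _ _))//.
apply: (@le_trans _ _ (\sum_(0 <= n < L) (p * 2 ^ p)%:R * (w n * rnorm (x n) ^+ 2 + w n.+1 * rnorm (x n.+1) ^+ 2))).
  apply: ler_sum => n _; rewrite !normrM.
  have -> : `|w n - w n.+1| = w n.+1 - w n by rewrite distrC ger0_norm// subr_ge0 le_exp_nat.
  have -> : `|b n| = b n by rewrite ger0_norm// sqrtr_ge0.
  have w0 : 0 <= w n by rewrite exprn_ge0.
  have ww : w n <= w n.+1 by rewrite le_exp_nat.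
  have cn : `|c n| <= rnorm (x n) ^+ 2 + rnorm (x n.+1) ^+ 2.
    rewrite (le_trans (Im_le_rnorm _))// rnormM rnorm_conj.
    have := sqr_ge0 (rnorm (x n) - rnorm (x n.+1)).
    have := sqr_ge0 (rnorm (x n)); have := sqr_ge0 (rnorm (x n.+1)).
    move: (rnorm (x n)) (rnorm (x n.+1)) => u v; nra.
  apply: (@le_trans _ _ ((p * 2 ^ p)%:R * w n * (rnorm (x n) ^+ 2 + rnorm (x n.+1) ^+ 2))).
    by rewrite ler_pM ?mulr_ge0 ?sqrtr_ge0 ?subr_ge0 ?sqrt_weight_increment.
  rewrite -mulrA ler_wpM2l// mulrDr lerD2l ler_wpM2r ?sqr_ge0//.
(* A level belongs to at most two neighbouring pairs, hence the doubled constant. *)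
rewrite -mulr_sumr mulr2n mulrDl -mulrDr ler_wpM2l// big_split/= lerD//.
  by rewrite [leRHS]big_nat_recr//= lerDl mulr_ge0 ?sqr_ge0 ?exprn_ge0.
by rewrite [leRHS]big_nat_recl//= lerDr mulr_ge0 ?sqr_ge0 ?exprn_ge0.
Qed.

End WeightInequalities.

Section GrowthFactor.
Context {R : realType}.
Implicit Types (k : nat) (t u : R).

(* Locked: conversion must not evaluate the unary number [2 ^ (k * 2)]. *)
Definition growth k t : R := locked (expR ((k * 2 * 2 ^ (k * 2))%:R *+ 4 * `|t|)).

Lemma growth_ge0 k t : 0 <= growth k t.
Proof. by rewrite /growth -lock expR_ge0. Qed.

Lemma growth_le k t u : `|t| <= `|u| -> growth k t <= growth k u.
Proof. by move=> tu; rewrite /growth -!lock ler_expR ler_wpM2l// mulrn_wge0. Qed.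

Lemma growthN k t : growth k (- t) = growth k t.
Proof. by rewrite /growth normrN. Qed.

Lemma growth_ge1 k t : 1 <= growth k t.
Proof. by rewrite /growth -lock -expR0 ler_expR mulr_ge0// mulrn_wge0. Qed.

End GrowthFactor.

(** * The unitary group of the truncated field operator *)

Section FieldEvolution.
Context {R : realType} {L : nat} (r : field_spectrum (R := R) L).
Implicit Types (x y : nat -> R[i]^o) (t u : R).

Definition fevol t x : nat -> R[i]^o := fun n => \sum_j cexp (t * fev r j) *: fproj r j x n.

(** At level [L.+1] the field operator vanishes while the tail projection acts as the identity; the
    constant sequence 1 reads off the eigenvalue. *)
Lemma fev_None : fev r None = 0.
Proof.
have := congr1 (fun f => f L.+1) (fproj_eig r None (fun=> 1)).
rewrite /= fieldOpE ltnn fproj_out// /GRing.scale/= mulr1 => /esym.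
by move/(congr1 (@complex.Re R)).
Qed.

Lemma fevol_lin t : seq_lin (fevol t).
Proof.
move=> c x y; apply/funext => n; rewrite /fevol scaler_sumr -big_split; apply: eq_bigr => j _ /=.
by rewrite fproj_lin scalerDr !scalerA [c * _]mulrC.
Qed.

Lemma fevol_out t x n : (L < n)%N -> fevol t x n = x n.
Proof.
move=> Ln; rewrite /fevol sum_option big1 => [|j _]; last by rewrite fproj_out// scaler0.
by rewrite fproj_out// fev_None mulr0 cexp0 scale1r addr0.
Qed.

Lemma domD_tail x y : (forall n, (L < n)%N -> y n = x n) -> domD x -> domD y.
Proof.
move=> yx xD.
have -> : y = fun n => opQ L (fun n => y n - x n) n + x n.
  apply/funext => n; rewrite /opQ; case: leqP => nL; first by rewrite subrK.
  by rewrite add0r yx.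
apply: domDD => //; apply: (@domD_finite _ _ L.+1) => n nL.
by rewrite /opQ leqNgt nL.
Qed.

Lemma fevol_D t x : domD x -> domD (fevol t x).
Proof. by apply: domD_tail => n; exact: fevol_out. Qed.

Lemma fproj_D j x : domD x -> domD (fproj r j x).
Proof.
case: j => [j|] xD; last by apply: domD_tail xD => n nL; rewrite fproj_out.
by apply: (@domD_finite _ _ L.+1) => n nL; rewrite fproj_out.
Qed.

Lemma fevolD t u x : fevol t (fevol u x) = fevol (t + u) x.
Proof.
apply/funext => n; rewrite {1}/fevol; apply: eq_bigr => j _.
rewrite /fevol (seq_lin_sum (fproj_lin r j)) (bigD1 j)//= fproj_orth eqxx big1 => [|k kj].
  by rewrite addr0 scalerA -cexpD mulrDl.
by rewrite fproj_orth eq_sym (negbTE kj) scaler0.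
Qed.

Lemma fevol0 x : fevol 0 x = x.
Proof.
apply/funext => n; rewrite /fevol -[RHS](fproj_sum r); apply: eq_bigr => j _.
by rewrite mul0r cexp0 scale1r.
Qed.

Lemma fevolK t x : fevol t (fevol (- t) x) = x.
Proof. by rewrite fevolD subrr fevol0. Qed.

Lemma fevol_adjoint t x y : domD x -> domD y ->
  fdot (fevol t x) y = fdot x (fevol (- t) y).
Proof.
move=> xD yD; rewrite /fevol fdot_suml ?fdot_sumr; try exact: domD_l2; last 2 first.
- by move=> j; exact/domD_l2/fproj_D.
- by move=> j; exact/domD_l2/fproj_D.
by apply: eq_bigr => j _; rewrite conjc_cexp mulNr fproj_sa.
Qed.

Lemma fieldOp_lin : seq_lin (@fieldOp R L).
Proof.
move=> c x y; apply/funext => n; rewrite /fieldOp annL_lin creL_lin scalerDr.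
by rewrite addrACA.
Qed.

Lemma fieldOp_spectral x n : fieldOp L x n = \sum_j (fev r j)%:C *: fproj r j x n.
Proof.
rewrite -[in LHS](_ : (fun n => \sum_j 1 *: fproj r j x n) = x).
  rewrite (seq_lin_sum fieldOp_lin); apply: eq_bigr => j _.
  by rewrite scale1r fproj_eig.
by apply/funext => m; under eq_bigr do rewrite scale1r; rewrite fproj_sum.
Qed.

Lemma fieldOp_fevol t x n :
  fieldOp L (fevol t x) n = \sum_j cexp (t * fev r j) *: ((fev r j)%:C *: fproj r j x n).
Proof.
rewrite /fevol (seq_lin_sum fieldOp_lin); apply: eq_bigr => j _.
by rewrite fproj_eig.
Qed.

Lemma fevol_fieldOp t x n :
  fevol t (fieldOp L x) n = \sum_j cexp (t * fev r j) *: ((fev r j)%:C *: fproj r j x n).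
Proof.
apply: eq_bigr => j _; congr (_ *: _).
have -> : fieldOp L x = fun n => \sum_j (fev r j)%:C *: fproj r j x n.
  by apply/funext => m; exact: fieldOp_spectral.
rewrite (seq_lin_sum (fproj_lin r j)) (bigD1 j)//= fproj_orth eqxx big1 ?addr0// => k kj.
by rewrite fproj_orth eq_sym (negbTE kj) scaler0.
Qed.

Lemma fieldOp_D x : domD (fieldOp L x).
Proof.
by apply: (@domD_finite _ _ L.+1) => n nL; rewrite fieldOpE leqNgt nL.
Qed.

(** Gronwall for the squared weighted norm: its derivative is the expectation of the commutator of
    the field operator with the weight, bounded by a multiple of the norm itself that is independent
    of [L]. *)
Lemma fevol_weight_finite k t x :
  \sum_(0 <= n < L.+1) rnorm (iter k opM (fevol t x) n) ^+ 2 <=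
  growth k t *
  \sum_(0 <= n < L.+1) rnorm (iter k opM x n) ^+ 2.
Proof.
pose w n : R := n.+1%:R ^+ (k * 2).
pose p n s : R := complex.Re (fevol s x n); pose q n s : R := complex.Im (fevol s x n).
pose g s := \sum_(0 <= n < L.+1) w n * (p n s * p n s + q n s * q n s).
pose p' n s : R := - complex.Im (fieldOp L (fevol s x) n).
pose q' n s : R := complex.Re (fieldOp L (fevol s x) n).
pose dg s := \sum_(0 <= n < L.+1) w n * (2 * (p n s * p' n s + q n s * q' n s)).
have tp n s : trig_poly (fev r) (fun j => fproj r j x n) s = fevol s x n by [].
have tp' n s : trig_poly' (fev r) (fun j => fproj r j x n) s = 'i%C * fieldOp L (fevol s x) n.
  rewrite fieldOp_fevol mulr_sumr; apply: eq_bigr => j _.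
  by rewrite /GRing.scale/= -mulrA; congr (_ * _); rewrite mulrCA.
have dp n (s : R) : is_derive s 1 (p n) (p' n s).
  have := is_derive_Re_trig (fev r) (fun j => fproj r j x n) s.
  by rewrite tp' complex_ReM /= mul0r mul1r sub0r.
have dq n (s : R) : is_derive s 1 (q n) (q' n s).
  have := is_derive_Im_trig (fev r) (fun j => fproj r j x n) s.
  by rewrite tp' complex_ImM /= mul0r mul1r add0r.
have gdg (s : R) : is_derive s 1 g (dg s).
  apply: (@is_derive_big _ _ _ (fun n s => w n * (p n s * p n s + q n s * q n s))
    (fun n s => w n * (2 * (p n s * p' n s + q n s * q' n s)))) => n.
  have h := is_deriveZ (w n) (is_deriveD (is_deriveM (dp n s) (dp n s)) (is_deriveM (dq n s) (dq n s))).
  have h' : is_derive s 1 (fun s => w n * (p n s * p n s + q n s * q n s)) _ := h.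
  apply: (is_derive_eq h'); rewrite /GRing.scale/=; ring.
have gE s : g s = \sum_(0 <= n < L.+1) rnorm (iter k opM (fevol s x) n) ^+ 2.
  apply: eq_bigr => n _; rewrite rnorm_iter_opM exprMn -exprM rnorm_sq /w.
  by rewrite /p /q; ring.
(* The squared norm has weight exponent 2 k. Differentiating the square doubles the constant, and
   the commutator bound carries another factor 2. *)
have dgC s : `|dg s| <= (k * 2 * 2 ^ (k * 2))%:R *+ 4 * g s.
  have -> : dg s = - 2 * \sum_(0 <= n < L.+1) w n * complex.Im ((fevol s x n)^*%C * fieldOp L (fevol s x) n).
    rewrite mulr_sumr; apply: eq_bigr => n _; rewrite complex_ImM /p' /q' /p /q.
    by case: (fevol s x n) => a b /=; ring.
  have key := ler_wpM2l (ler0n R 2) (field_commutator_bound L (k * 2) (fevol s x)).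
  rewrite normrM normrN normr_nat (le_trans key)//.
  move: (k * 2 * _)%:R => K.
  rewrite (_ : g s = \sum_(0 <= n < L.+1) w n * rnorm (fevol s x n) ^+ 2).
    by rewrite mulrA (_ : 2 * (K *+ 2) = K *+ 4)//; ring.
  by apply: eq_bigr => n _; rewrite rnorm_sq /p /q; congr (_ * _); ring.
have := gronwall t gdg dgC; rewrite !gE.
by rewrite fevol0 /growth -lock.
Qed.

(** Above [L] the evolution is the identity, so a growth factor at least 1 covers the tail; the same
    property allows the factor itself in place of its square root. *)
Lemma fevol_weight k t x : domD x ->
  l2norm (iter k opM (fevol t x)) <=
  growth k t * l2norm (iter k opM x).
Proof.
move=> xD; set e := growth k t; have e1 : 1 <= e := growth_ge1 k t.
have e0 : 0 <= e := growth_ge0 k t.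
have lx : l2 (iter k opM x) by move/domDP: xD.
apply: (l2norm_le _ _).2; first by rewrite mulr_ge0// l2norm_ge0.
move=> m; apply: (@le_trans _ _ (\sum_(0 <= n < L.+1 + m) rnorm (iter k opM (fevol t x) n) ^+ 2)).
  rewrite [leRHS](@big_cat_nat _ _ _ m)//= ?leq_addl// lerDl.
  by apply: sumr_ge0 => n _; rewrite sqr_ge0.
rewrite exprMn; apply: (@le_trans _ _ (e * l2norm (iter k opM x) ^+ 2)); last first.
  by rewrite ler_wpM2r ?sqr_ge0// expr2 ler_peMr.
rewrite (le_trans _ (ler_wpM2l e0 (sum_le_l2norm (L.+1 + m) lx)))//.
rewrite (@big_cat_nat _ _ _ L.+1)//= ?leq_addr// [X in _ <= _ * X](@big_cat_nat _ _ _ L.+1)//= ?leq_addr//.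
rewrite mulrDr lerD ?fevol_weight_finite//.
rewrite mulr_sumr big_nat [leRHS]big_nat; apply: ler_sum => n /andP[nL _].
by rewrite !rnorm_iter_opM fevol_out// ler_peMl ?sqr_ge0.
Qed.

End FieldEvolution.


(** * Commutators of the truncated field operator with ladder operators *)

Section Commutators.
Context {R : realType}.
Implicit Types (x y z : nat -> R[i]^o) (L k : nat).

Lemma fieldOp_ann_cre L x n : fieldOp L x n =
  if (n <= L)%N then (if (n < L)%N then ann x n else 0) + cre x n else 0.
Proof. by rewrite fieldOpE; case: n. Qed.

Lemma ann_creE x n : ann (cre x) n = n.+1%:R *: x n.
Proof. by rewrite /ann /cre scalerA sqrt_natC. Qed.

Lemma cre_ann_natE x n : cre (ann x) n = n%:R *: x n.
Proof. by rewrite cre_annE. Qed.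

(** Where n + 1 < L the cutoff is invisible and the canonical commutation relation gives exactly -1;
    the remaining cases are the levels L - 1, L and those above L. *)
Lemma ann_commutator L x n :
  rnorm (fieldOp L (ann x) n - ann (fieldOp L x) n - (-1) *: x n) <=
  if (L <= n.+1)%N then n.+1%:R * rnorm (x n) + rnorm (ann (ann x) n) else 0.
Proof.
have -> : ann (fieldOp L x) n = if (n < L)%N then
    (if (n.+1 < L)%N then ann (ann x) n else 0) + n.+1%:R *: x n else 0.
  rewrite {1}/ann fieldOp_ann_cre; case: ifP => _; last by rewrite scaler0.
  rewrite scalerDr; congr (_ + _); first by case: ifP => _ //; rewrite scaler0.
  exact: ann_creE.
rewrite fieldOp_ann_cre cre_ann_natE scaleN1r opprK.
have [nL1|nL1] := ltnP n.+1 L.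
  have nL : (n < L)%N by rewrite ltnW.
  rewrite nL (ltnW nL) /= opprD addrACA subrr add0r.
  by rewrite -natr1 scalerDl scale1r opprD addrA subrr add0r addNr rnorm0.
have [nL|nL] := ltnP n L.
  rewrite (ltnW nL) add0r -natr1 scalerDl scale1r opprD addrA addrK subrK.
  by rewrite lerDr mulr_ge0// rnorm_ge0.
rewrite subr0; case: leqP => nL'.
  rewrite add0r -{2}[x n]scale1r -scalerDl natr1 rnormZ rnorm_nat.
  by rewrite lerDl rnorm_ge0.
by rewrite add0r ler_wpDr ?rnorm_ge0// ler_peMl ?rnorm_ge0// ler1n.
Qed.

Lemma cre_commutator L x n :
  rnorm (fieldOp L (cre x) n - cre (fieldOp L x) n - 1 *: x n) <=
  if (L <= n.+1)%N then n.+1%:R * rnorm (x n) + rnorm (cre (cre x) n) else 0.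
Proof.
have -> : cre (fieldOp L x) n = if (n <= L.+1)%N then
    (if (n <= L)%N then n%:R *: x n else 0) + cre (cre x) n else 0.
  case: n => [|n]; first by rewrite /= scale0r addr0.
  rewrite {1}/cre fieldOp_ann_cre ltnS; case: ifP => _; last by rewrite scaler0.
  rewrite scalerDr; congr (_ + _); case: ifP => _; rewrite ?scaler0//.
  by rewrite -cre_ann_natE.
rewrite fieldOp_ann_cre ann_creE scale1r.
have [nL|nL] := ltnP n L.
  rewrite (ltnW nL) (leqW (ltnW nL)) opprD addrACA subrr addr0 -natr1 scalerDl scale1r.
  rewrite -addrA -opprD subrr rnorm0; case: ifP => // _.
  by rewrite addr_ge0 ?mulr_ge0 ?rnorm_ge0.
rewrite (leq_trans nL (leqnSn n)).
have [nL'|nL'] := leqP n L.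
  rewrite (leqW nL') add0r opprD addrCA subrr addr0 -opprD -{2}[x n]scale1r -scalerDl natr1.
  by rewrite rnormN rnormZ rnorm_nat lerDl rnorm_ge0.
case: ifP => _; rewrite ?add0r ?sub0r ?oppr0 ?add0r.
  rewrite -opprD rnormN addrC (le_trans (rnormD _ _))// lerD// ler_peMl ?rnorm_ge0//.
  by rewrite ler1n.
by rewrite rnormN ler_wpDr ?rnorm_ge0// ler_peMl ?rnorm_ge0// ler1n.
Qed.

(** The source of the decay in [L]: on the support of [z] one has L <= n + 1, so a factor [L] is
    paid for by one power of [M]. Multiplying by [L] instead of dividing includes L = 0. *)
Lemma commutator_weight k L x y z : domD x -> domD y ->
  (forall n, rnorm (z n) <=
     if (L <= n.+1)%N then n.+1%:R * rnorm (x n) + rnorm (y n) else 0) ->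
  L%:R * l2norm (iter k opM z) <=
  2 * (l2norm (iter k.+2 opM x) + l2norm (iter k.+1 opM y)).
Proof.
move=> /domDP xD /domDP yD hz.
have h n : rnorm ((L%:R : R[i]) *: (iter k opM z n : R[i]^o)) <=
    rnorm (iter k.+2 opM x n) + rnorm (iter k.+1 opM y n).
  rewrite rnormZ rnorm_nat !rnorm_iter_opM.
  have [Ln|nL] := leqP L n.+1; last first.
    have := hz n; rewrite leqNgt nL /= => z0.
    have -> : rnorm (z n) = 0 by apply/eqP; rewrite eq_le z0 rnorm_ge0.
    by rewrite !mulr0; apply: addr_ge0; apply: mulr_ge0; rewrite ?exprn_ge0 ?rnorm_ge0.
  have := hz n; rewrite Ln => zn.
  rewrite (@le_trans _ _ (n.+1%:R * (n.+1%:R ^+ k * rnorm (z n))))//.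
    by rewrite ler_wpM2r ?ler_nat// mulr_ge0 ?exprn_ge0 ?rnorm_ge0.
  rewrite mulrA -exprS (le_trans (ler_wpM2l (exprn_ge0 _ (ler0n _ _)) zn))//.
  by rewrite mulrDr lerD2r mulrA -exprSr.
have [lz lez] := l2_dom2 h (xD _) (yD _).
apply: le_trans lez.
have [|l] := leqP L 0.
  by rewrite leqn0 => /eqP ->; rewrite mul0r l2norm_ge0.
have L0 : 0 < L%:R :> R by rewrite ltr0n.
rewrite mulrC -ler_pdivlMr// mulrC -[L%:R^-1]ger0_norm ?invr_ge0//.
rewrite -(rnormC L%:R^-1); apply: (@l2_dom _ _ _ (fun n => (L%:R : R[i]) *: (iter k opM z n : R[i]^o)) _ _ _ _ lz).2.
  exact: rnorm_ge0.
move=> n; rewrite rnormZ rnorm_nat rnormC ger0_norm ?invr_ge0//.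
by rewrite mulrA mulVf ?gt_eqF// mul1r.
Qed.

Lemma ann_commutator_weight k L x : domD x ->
  L%:R * l2norm (iter k opM (fun n => fieldOp L (ann x) n - ann (fieldOp L x) n - (-1) *: x n)) <=
  4 * l2norm (iter k.+3 opM x).
Proof.
move=> xD; have aD := domD_ann xD; have aaD := domD_ann aD.
apply: le_trans (commutator_weight k xD aaD (ann_commutator L x)) _.
have h1 := weight_mono k.+2 xD.
have h2 := le_trans (weight_ann k.+1 aD).2 (weight_ann k.+2 xD).2.
by rewrite (le_trans (ler_wpM2l _ (lerD h1 h2)))//; lra.
Qed.

Lemma cre_commutator_weight k L x : domD x ->
  L%:R * l2norm (iter k opM (fun n => fieldOp L (cre x) n - cre (fieldOp L x) n - 1 *: x n)) <=
  (2 * (1 + 2 ^+ k.+1 * 2 ^+ k.+2)) * l2norm (iter k.+3 opM x).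
Proof.
move=> xD; have aD := domD_cre xD; have aaD := domD_cre aD.
apply: le_trans (commutator_weight k xD aaD (cre_commutator L x)) _.
have h1 := weight_mono k.+2 xD.
have c0 : 0 <= 2 ^+ k.+1 :> R by rewrite exprn_ge0.
have h2 := le_trans (weight_cre k.+1 aD).2 (ler_wpM2l c0 (weight_cre k.+2 xD).2).
rewrite (le_trans (ler_wpM2l _ (lerD h1 h2)))//.
by rewrite -mulrA ler_wpM2l// mulrDl mul1r mulrA.
Qed.

Lemma fieldOp_weight k L x : domD x ->
  l2norm (iter k opM (fieldOp L x)) <= 2 * (1 + 2 ^+ k) * l2norm (iter k.+1 opM x).
Proof.
move=> xD; have [la lea] := weight_ann k xD; have [lc lec] := weight_cre k xD.
have h n : rnorm (iter k opM (fieldOp L x) n) <=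
    rnorm (iter k opM (ann x) n) + rnorm (iter k opM (cre x) n).
  rewrite !rnorm_iter_opM -mulrDr ler_wpM2l ?exprn_ge0// fieldOp_ann_cre.
  case: ifP => _; last by rewrite rnorm0 addr_ge0 ?rnorm_ge0.
  rewrite (le_trans (rnormD _ _))// lerD2r; case: ifP => // _.
  by rewrite rnorm0 rnorm_ge0.
have [_ le] := l2_dom2 h la lc; rewrite (le_trans le)// -mulrA ler_wpM2l//.
by rewrite mulrDl mul1r lerD.
Qed.

End Commutators.

(** The arithmetic of estimating an evolution, a commutator remainder and the inverse evolution one
    after the other, with time-dependent factors [C1], [C3] replaced by uniform ones. [D3] carries
    no sign assumption: a negative K (D3 N) would contradict the chain. *)
Lemma mul_chain (R : realType) (l a X1 X2 X3 N C1 D1 C3 D3 K : R) :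
  0 <= l -> 0 <= a -> 0 <= N -> 0 <= X2 -> 0 <= K -> 0 <= C1 ->
  X1 <= C1 * X2 -> l * X2 <= K * X3 -> X3 <= C3 * N -> C1 <= D1 -> C3 <= D3 ->
  l * (2 * (a * X1)) <= 2 * (D1 * (K * D3)) * (a * N).
Proof.
move=> l0 a0 N0 X20 K0 C10 b1 b2 b3 c1 c3.
have h1 : l * X1 <= C1 * (K * (D3 * N)).
  rewrite (le_trans (ler_wpM2l l0 b1))// mulrCA ler_wpM2l// (le_trans b2)// ler_wpM2l//.
  by rewrite (le_trans b3)// ler_wpM2r.
have h0 : 0 <= l * X2 by rewrite mulr_ge0.
have [n0|n0] := leP 0 (K * (D3 * N)); last first.
  have : K * X3 < 0.
    by apply: le_lt_trans n0; rewrite ler_wpM2l// (le_trans b3)// ler_wpM2r.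
  by rewrite ltNge (le_trans h0 b2).
have h2 : l * X1 <= D1 * (K * (D3 * N)) by rewrite (le_trans h1)// ler_wpM2r.
have -> : l * (2 * (a * X1)) = 2 * (a * (l * X1)) by ring.
have -> : 2 * (D1 * (K * D3)) * (a * N) = 2 * (a * (D1 * (K * (D3 * N)))) by ring.
by rewrite ler_wpM2l// ler_wpM2l.
Qed.

(** * Conjugation of an operator by the field evolution *)

Section EvolvedOperator.
Context {R : realType}.
Implicit Types (x y chi : nat -> R[i]^o).

Section OneOperator.
Variables (T : (nat -> R[i]^o) -> nat -> R[i]^o) (c : R[i]) (K : nat -> R).
Hypothesis Tlin : seq_lin T.
Hypothesis TD : forall x, domD x -> domD (T x).
Hypothesis K0 : forall k, 0 <= K k.
Hypothesis Tcomm : forall k L x, domD x ->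
  L%:R * l2norm (iter k opM (fun n => fieldOp L (T x) n - T (fieldOp L x) n - c *: x n)) <=
  K k * l2norm (iter k.+3 opM x).

Let C k t : R := 4 * (growth k t * (K k * growth k.+3 t)) * `|t|.

(** With A the field operator and U_s its group, the matrix element of U_s T U_(-s) is an
    exponential sum whose frequencies are differences of eigenvalues and whose derivative is i times
    the matrix element of U_s [A, T] U_(-s). [T] is abstract so as to cover the annihilation
    operator (c = -1) and its adjoint (c = 1). *)
Lemma evolved_commutator_bound k L (r : field_spectrum (R := R) L) t chi y :
  (0 < L)%N -> domD chi -> domD y ->
  L%:R * rnorm (fdot (iter k opM chi)
    (fun n => fevol r t (T (fevol r (- t) y)) n - T y n - (t%:C * ('i%C * c)) *: y n)) <=
  C k t * (l2norm chi * l2norm (iter k.+3 opM y)).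
Proof.
move=> L0 chiD yD; set chi' : nat -> R[i]^o := iter k opM chi.
have lchi' : l2 chi' by have /domDP := chiD; exact.
pose J := (option 'I_L.+1 * option 'I_L.+1)%type.
pose w (q : J) := fev r q.1 - fev r q.2.
pose W (q : J) := fproj r q.1 (T (fproj r q.2 y)).
have WD q : domD (W q) by apply/fproj_D/TD/fproj_D.
have exp1 s : fevol r s (T (fevol r (- s) y)) = fun n => \sum_q cexp (s * w q) *: W q n.
  apply/funext => n; rewrite -(pair_big xpredT xpredT (fun j j' => cexp (s * w (j, j')) *: W (j, j') n))/=.
  apply: eq_bigr => j _; rewrite [fevol r (- s) y]/fevol (seq_lin_sum Tlin) (seq_lin_sum (fproj_lin r j)).
  rewrite scaler_sumr; apply: eq_bigr => j' _; rewrite scalerA -cexpD /w /= mulrBr mulNr.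
  by [].
have exp2 s : (fun n => fevol r s (fieldOp L (T (fevol r (- s) y))) n -
    fevol r s (T (fieldOp L (fevol r (- s) y))) n) =
    fun n => \sum_q ((w q)%:C * cexp (s * w q)) *: W q n.
  apply/funext => n.
  rewrite -(pair_big xpredT xpredT (fun j j' => ((w (j, j'))%:C * cexp (s * w (j, j'))) *: W (j, j') n))/=.
  rewrite fevol_fieldOp /(fevol r s) -sumrB; apply: eq_bigr => j _.
  have -> : fieldOp L (fevol r (- s) y) =
      fun n => \sum_j (cexp (- s * fev r j) * (fev r j)%:C) *: fproj r j y n.
    by apply/funext => m; rewrite fieldOp_fevol; apply: eq_bigr => j' _; rewrite scalerA.
  rewrite [fevol r (- s) y]/fevol !(seq_lin_sum Tlin) !(seq_lin_sum (fproj_lin r j)).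
  rewrite !scaler_sumr -sumrB; apply: eq_bigr => j' _; rewrite !scalerA -scalerBl.
  congr (_ *: _); rewrite /w /= mulrBr -mulNr cexpD rmorphB/=.
  by ring.
(* Cancels the contribution of the constant part [c] of the commutator to the derivative; what is
   left is the evolved remainder [g]. *)
pose d := - ('i%C * c) * fdot chi' y.
have yl : l2 y := domD_l2 yD.
pose h := trig_poly w (fun q => fdot chi' (W q)).
have hE s : h s = fdot chi' (fevol r s (T (fevol r (- s) y))).
  by rewrite exp1 fdot_sumr// => q; exact: domD_l2.
pose g s n := fieldOp L (T (fevol r (- s) y)) n - T (fieldOp L (fevol r (- s) y)) n - c *: fevol r (- s) y n.
have gD s : domD (g s).
  have gE : g s = fun n => (fieldOp L (T (fevol r (- s) y)) n + (-1) *: T (fieldOp L (fevol r (- s) y)) n) +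
    (- c) *: fevol r (- s) y n.
    by apply/funext => n; rewrite scaleN1r scaleNr.
  rewrite gE; apply: domDD; last by apply/domDZ/fevol_D.
  by apply: domDD; [exact: fieldOp_D|apply/domDZ/TD/fieldOp_D].
have h'E s : trig_poly' w (fun q => fdot chi' (W q)) s + d = 'i%C * fdot chi' (fevol r s (g s)).
  have gE : fevol r s (g s) = fun n => (\sum_q ((w q)%:C * cexp (s * w q)) *: W q n) - c *: y n.
    apply/funext => n; have := congr1 (fun f => f n) (exp2 s); rewrite /= => <-; rewrite /g.
    rewrite (seq_linB (fevol_lin r s) (fun n => fieldOp L (T (fevol r (- s) y)) n - T (fieldOp L (fevol r (- s) y)) n)
      (fun n => c *: fevol r (- s) y n)).
    rewrite (seq_linB (fevol_lin r s)) (seq_linZ (fevol_lin r s)) fevolK.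
    by [].
  have lW : l2 (fun n => \sum_q ((w q)%:C * cexp (s * w q)) *: W q n).
    by apply: l2_sum => q; case: (l2Z ((w q)%:C * cexp (s * w q)) (domD_l2 (WD q))).
  rewrite gE fdotBr//; last by case: (l2Z c yl).
  rewrite fdotZr// fdot_sumr//; last by move=> q; exact: domD_l2.
  rewrite mulrBr /d mulNr mulrA; congr (_ - _).
  by rewrite /trig_poly' mulr_sumr; apply: eq_bigr => q _; rewrite !mulrA.
have Lp : 0 < L%:R :> R by rewrite ltr0n.
pose e := L%:R^-1 * (2 * (growth k t * (K k * growth k.+3 t)) * (l2norm chi * l2norm (iter k.+3 opM y))).
have bound s : `|s| <= `|t| -> rnorm (trig_poly' w (fun q => fdot chi' (W q)) s + d) <= e.
  move=> st; rewrite h'E rnormM rnorm_def /= expr0n add0r expr1n sqrtr1 mul1r.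
  have fgD : domD (fevol r s (g s)) by exact: fevol_D.
  rewrite /chi' fdot_iter_opM (le_trans (rnorm_fdot (domD_l2 chiD) _))//.
    by move/domDP: fgD.
  rewrite /e ler_pdivlMl//.
  have b1 := fevol_weight r k s (gD s).
  have b2 : L%:R * l2norm (iter k opM (g s)) <= K k * l2norm (iter k.+3 opM (fevol r (- s) y)) :=
    Tcomm k L (@fevol_D _ _ r (- s) _ yD).
  have b3 := fevol_weight r k.+3 (- s) yD.
  rewrite growthN in b3.
  exact: (mul_chain (ltW Lp) (l2norm_ge0 chi) (l2norm_ge0 _) (l2norm_ge0 _) (K0 k)
    (growth_ge0 k s) b1 b2 b3 (growth_le k st) (growth_le k.+3 st)).
have := trig_poly_bound bound; rewrite -/h !hE oppr0 !fevol0 => main.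
have -> : fdot chi' (fun n => fevol r t (T (fevol r (- t) y)) n - T y n - (t%:C * ('i%C * c)) *: y n) =
    fdot chi' (fevol r t (T (fevol r (- t) y))) + t%:C * d - fdot chi' (T y).
  have l1 : l2 (fevol r t (T (fevol r (- t) y))) by apply/domD_l2/fevol_D/TD/fevol_D.
  have l2' : l2 (T y) by exact/domD_l2/TD.
  rewrite fdotBr//; [|exact: l2B|by case: (l2Z (t%:C * ('i%C * c)) yl)].
  by rewrite fdotBr// fdotZr// [RHS]addrAC /d mulNr mulrN -[t%:C * _ * _]mulrA.
rewrite (le_trans (ler_wpM2l (ltW Lp) main))// /e /C.
have reorder (a1 a2 a3 a4 : R) : a1 != 0 ->
    a1 * (2 * (a1^-1 * (2 * a2 * a3)) * a4) = 4 * a2 * a4 * a3 by move=> ?; field.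
by rewrite reorder// gt_eqF.
Qed.

End OneOperator.

(** The derivative is now i times the field operator applied to the evolved vector, at the cost of
    one power of [M]. The linear factor |t| matters: it will be of order 1/|V|. *)
Lemma fevol_sub_bound k L (r : field_spectrum (R := R) L) t chi y :
  domD chi -> domD y ->
  rnorm (fdot (iter k opM chi) (fun n => fevol r t y n - y n)) <=
  (8 * (1 + 2 ^+ k) * growth k.+1 t) * `|t| * (l2norm chi * l2norm (iter k.+1 opM y)).
Proof.
move=> chiD yD; set chi' : nat -> R[i]^o := iter k opM chi.
have lchi' : l2 chi' by have /domDP := chiD; exact.
have pD j : l2 (fproj r j y) by exact/domD_l2/fproj_D.
pose h := trig_poly (fev r) (fun j => fdot chi' (fproj r j y)).
have hE s : h s = fdot chi' (fevol r s y) by rewrite /fevol fdot_sumr.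
have h'E s : trig_poly' (fev r) (fun j => fdot chi' (fproj r j y)) s + 0 =
    'i%C * fdot chi' (fieldOp L (fevol r s y)).
  have -> : fieldOp L (fevol r s y) =
      fun n => \sum_j (cexp (s * fev r j) * (fev r j)%:C) *: fproj r j y n.
    by apply/funext => m; rewrite fieldOp_fevol; apply: eq_bigr => j' _; rewrite scalerA.
  rewrite addr0 fdot_sumr// mulr_sumr; apply: eq_bigr => j _; ring.
pose e := 4 * (1 + 2 ^+ k) * growth k.+1 t * (l2norm chi * l2norm (iter k.+1 opM y)).
have k0 : 0 <= 2 ^+ k :> R by rewrite exprn_ge0.
have bound s : `|s| <= `|t| -> rnorm (trig_poly' (fev r) (fun j => fdot chi' (fproj r j y)) s + 0) <= e.
  move=> st; rewrite h'E rnormM rnorm_def /= expr0n add0r expr1n sqrtr1 mul1r.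
  have ED := @fevol_D _ _ r s _ yD; have fD : domD (fieldOp L (fevol r s y)) by exact: fieldOp_D.
  rewrite /chi' fdot_iter_opM (le_trans (rnorm_fdot (domD_l2 chiD) _))//.
    by move/domDP: fD.
  have b1 := fieldOp_weight k L ED.
  have b2 := fevol_weight r k.+1 s yD.
  have reorder (a1 a2 a3 a4 : R) : 4 * a1 * a2 * (a3 * a4) = 2 * (a3 * (2 * a1 * (a2 * a4))) by ring.
  rewrite /e reorder; apply: ler_wpM2l; first exact: ler0n.
  apply: ler_wpM2l; first exact: l2norm_ge0.
  apply: (le_trans b1); apply: ler_wpM2l; first by rewrite mulr_ge0// addr_ge0.
  by apply: (le_trans b2); apply: ler_wpM2r; [exact: l2norm_ge0|exact: growth_le].
have := trig_poly_bound bound; rewrite -/h !hE fevol0 mulr0 addr0 -fdotBr//; last 2 first.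
- exact/domD_l2/fevol_D.
- exact: domD_l2.
move=> main; rewrite (le_trans main)// /e.
have reorder (a1 a2 a3 a4 : R) : 2 * (4 * a1 * a2 * a3) * a4 = 8 * a1 * a2 * a4 * a3 by ring.
by rewrite reorder.
Qed.

End EvolvedOperator.


(** * The Hamiltonian and the Heisenberg evolution *)

Section OperatorExponential.
Context {R : realType} {d : nat} {S : spinSystem R d}.

Lemma l2norm_sum_cvg0 (I : Type) (r : seq I) (a : I -> nat -> R[i]) (y : I -> nat -> S) :
  (forall q, l2 (y q)) -> (forall q, rnorm (a q m) @[m --> \oo] --> (0 : R)) ->
  l2norm (fun n => \sum_(q <- r) a q m *: y q n) @[m --> \oo] --> (0 : R).
Proof.
move=> ly a0.
have [b b0 hb] : exists2 b : nat -> R, b m @[m --> \oo] --> (0 : R) &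
    forall m, l2norm (fun n => \sum_(q <- r) a q m *: y q n) <= b m.
  elim: r => [|q r [b b0 hb]].
    exists (fun=> 0); first exact: cvg_cst.
    move=> m; have [_ <-] := l2norm0 S; rewrite le_eqVlt; apply/orP; left.
    by apply/eqP; congr l2norm; apply/funext => n; rewrite big_nil.
  exists (fun m => 2 * (rnorm (a q m) * l2norm (y q) + b m)).
    have e : 2 * (0 * l2norm (y q) + 0) = 0 :> R by rewrite mul0r addr0 mulr0.
    rewrite -e; by apply: cvgM; [exact: cvg_cst|apply: cvgD => //; apply: cvgM => //; exact: cvg_cst].
  move=> m; have [l1 le1] := l2Z (a q m) (ly q).
  have ls : l2 (fun n => \sum_(q <- r) a q m *: y q n).
    by apply: l2_sum => p; case: (l2Z (a p m) (ly p)).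
  have h n : rnorm (\sum_(q <- q :: r) a q m *: y q n) <=
      rnorm (a q m *: y q n) + rnorm (\sum_(q <- r) a q m *: y q n).
    by rewrite big_cons rnormD.
  have [_ le] := l2_dom2 h l1 ls.
  by apply: (le_trans le); apply: ler_wpM2l; [exact: ler0n|exact: lerD].
apply/cvgr0Pnorm_lt => e e0; move/cvgr0Pnorm_lt: b0 => /(_ _ e0); apply: filterS => m bm.
rewrite ger0_norm ?l2norm_ge0// (le_lt_trans (hb m))// (le_lt_trans _ bm)//.
exact: ler_norm.
Qed.

(** On a finite sum of eigenvectors the series converges coefficient by coefficient; uniqueness of
    l^2 limits identifies the vector chosen by [xget]. *)
Lemma op_exp_eigen (H : (nat -> S) -> nat -> S) (I : finType) (h : I -> R)
    (y : I -> nat -> S) t :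
  seq_lin H -> (forall q, l2 (y q)) ->
  (forall q, H (y q) = fun n => (h q)%:C *: y q n) ->
  op_exp ('i%C * t%:C) H (fun n => \sum_q y q n) =
  fun n => \sum_q cexp (t * h q) *: y q n.
Proof.
move=> Hlin ly Hy.
have it k : iter k H (fun n => \sum_q y q n) = fun n => \sum_q (h q ^+ k)%:C *: y q n.
  elim: k => [|k IH].
    by apply/funext => n; apply: eq_bigr => q _; rewrite expr0 scale1r.
  rewrite iterS IH (seq_lin_sum Hlin); apply/funext => n; apply: eq_bigr => q _.
  by rewrite Hy scalerA -rmorphM exprSr.
pose a m q : R[i] := \sum_(k < m) (('i%C * (t * h q)%:C) ^+ k / k`!%:R).
have part m : (fun n => \sum_(k < m) (('i%C * t%:C) ^+ k / k`!%:R) *: iter k H (fun n => \sum_q y q n) n) =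
    fun n => \sum_q a m q *: y q n.
  apply/funext => n; under eq_bigr do rewrite it scaler_sumr.
  rewrite exchange_big; apply: eq_bigr => q _ /=; rewrite /a scaler_suml; apply: eq_bigr => k _.
  rewrite scalerA; congr (_ *: _).
  have -> : 'i%C * (t * h q)%:C = 'i%C * t%:C * (h q)%:C by rewrite rmorphM mulrA.
  by rewrite [in RHS]exprMn rmorphXn/= mulrAC.
have lc (c : I -> R[i]) : l2 (fun n => \sum_q c q *: y q n).
  by apply: l2_sum => q; case: (l2Z (c q) (ly q)).
have cv : l2_cvg (fun m n => \sum_(k < m) (('i%C * t%:C) ^+ k / k`!%:R) *: iter k H (fun n => \sum_q y q n) n)
    (fun n => \sum_q cexp (t * h q) *: y q n).
  split=> [m||]; [by rewrite part|exact: lc|].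
  have -> : (fun m => l2norm (fun n => \sum_(k < m) (('i%C * t%:C) ^+ k / k`!%:R) *: iter k H (fun n => \sum_q y q n) n -
      \sum_q cexp (t * h q) *: y q n)) =
      fun m => l2norm (fun n => \sum_(q <- index_enum I) (a m q - cexp (t * h q)) *: y q n).
    apply/funext => m; congr l2norm; apply/funext => n.
    have /= -> := congr1 (fun f => f n) (part m).
    by rewrite -sumrB; apply: eq_bigr => q _; rewrite scalerBl.
  apply: (@l2norm_sum_cvg0 _ _ (fun q m => a m q - cexp (t * h q))) => // q.
  exact: cexp_series.
rewrite /op_exp; set A := [set eta | _].
have Aeta : A (xget (fun=> 0) A).
  by apply: xgetPex; exists (fun n => \sum_q cexp (t * h q) *: y q n).
exact: l2_cvg_uniq Aeta cv.
Qed.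

End OperatorExponential.

Section Hamiltonian.
Context {R : realType} {d : nat} {S : spinSystem R d}.
Implicit Types (V : {fset lattice d}) (psi : S) (x : nat -> R[i]^o).

Local Notation Z := (fun i : lattice d => @sigma R d S ax3 i).

Lemma spin_resolution (l : seq (lattice d)) : joint_resolution Z l.
Proof.
apply: joint_resolution_exists.
- by move=> i; exact: sigma_lin.
- by move=> i x y; exact: sigma_sa.
- by move=> i x; exact: sigma_sq.
- by move=> i j x; exact: sigma3_comm.
Qed.

Definition mag V (eps : lattice d -> R) : R := (#|` V|%:R)^-1 * \sum_(i <- V) eps i.

Lemma sigma3_eigenvector V (eps : lattice d -> R) psi :
  (forall j, j \in V -> sigma ax3 j psi = (eps j)%:C *: psi) ->
  sigma3 V psi = (mag V eps)%:C *: psi.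
Proof.
move=> h; rewrite /sigma3 /mag rmorphM/= fmorphV rmorph_nat -scalerA; congr (_ *: _).
rewrite rmorph_sum/= scaler_suml big_seq [RHS]big_seq; apply: eq_bigr => j jV.
exact: h.
Qed.

Lemma sigma3_lin V : lin (@sigma3 R d S V).
Proof.
move=> c x y; rewrite /sigma3 scalerA mulrC -scalerA -scalerDr; congr (_ *: _).
rewrite scaler_sumr -big_split; apply: eq_bigr => i _ /=.
exact: sigma_lin.
Qed.

Lemma rnorm_sigma3 V psi : rnorm (sigma3 V psi) <= rnorm psi.
Proof.
rewrite /sigma3 rnormZ -(rmorph_nat (real_complex R)) -fmorphV rnormC ger0_norm ?invr_ge0//.
apply: (@le_trans _ _ (#|` V|%:R^-1 * (#|` V|%:R * rnorm psi))).
  rewrite ler_wpM2l ?invr_ge0// (le_trans (rnorm_sum _ _ _))//.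
  under eq_bigr do rewrite rnorm_sigma.
  by rewrite big_const_seq count_predT iter_addr addr0 mulr_natl.
have [->|n0] := eqVneq (#|` V|%:R : R) 0; first by rewrite invr0 mul0r rnorm_ge0.
by rewrite mulrA mulVf// mul1r.
Qed.

Lemma opQ_ptens L psi x : opQ L (ptens psi x) = ptens psi (opQ L x).
Proof. by apply/funext => n; rewrite /opQ /ptens; case: ifP => //; rewrite scale0r. Qed.

Lemma ann_ptens psi x : ann (ptens psi x) = ptens psi (ann x).
Proof. by apply/funext => n; rewrite /ann /ptens scalerA. Qed.

Lemma cre_ptens psi x : cre (ptens psi x) = ptens psi (cre x).
Proof. by apply/funext => -[|n]; rewrite /cre /ptens ?scale0r// scalerA. Qed.

Lemma opM_ptens k psi x : iter k opM (ptens psi x) = ptens psi (iter k opM x).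
Proof. by apply/funext => n; rewrite iter_opM /ptens iter_opM scalerA. Qed.

Lemma funM_ptens f psi x : funM f (ptens psi x) = ptens psi (funM f x).
Proof. by apply/funext => n; rewrite /funM /ptens scalerA. Qed.

Lemma l2_ptens psi x : l2 x -> l2 (ptens psi x).
Proof.
move=> lx; case: (@l2_dom _ _ _ x (ptens psi x) (rnorm psi)) => // [|n].
  exact: rnorm_ge0.
by rewrite /ptens rnormZ mulrC.
Qed.

Lemma hamiltonian_lin J gamma V L : seq_lin (@hamiltonian R d S J gamma V L).
Proof.
move=> c x y; have sl := sigma3_lin V.
have e : (fun m => sigma3 V (c *: x m + y m)) = fun m => c *: sigma3 V (x m) + sigma3 V (y m).
  by apply/funext => m; rewrite sl.
apply/funext => n; rewrite /hamiltonian e annL_lin creL_lin !sl.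
have -> (A B A' B' : S) : c *: A + B + (c *: A' + B') = c *: (A + A') + (B + B').
  by rewrite scalerDr addrACA.
have key (a b : R[i]) (X Y U W : S) :
    a *: (c *: X + Y) + b *: (c *: U + W) = c *: (a *: X + b *: U) + (a *: Y + b *: W).
  by rewrite !scalerDr !scalerA [a * c]mulrC [b * c]mulrC addrACA.
exact: key.
Qed.

Lemma hamiltonian_eigenvector J gamma V L (r : field_spectrum (R := R) L)
    (eps : lattice d -> R) psi x j :
  (forall j, j \in V -> sigma ax3 j psi = (eps j)%:C *: psi) ->
  hamiltonian J gamma V L (ptens psi (fproj r j x)) =
  fun n => (J * #|` V|%:R * mag V eps ^+ 2 + gamma * mag V eps * fev r j)%:C *:
    ptens psi (fproj r j x) n.
Proof.
move=> /sigma3_eigenvector h; have sl := sigma3_lin V; apply/funext => n; rewrite /hamiltonian.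
have sp y m : sigma3 V (ptens psi y m) = (mag V eps)%:C *: ptens psi y m.
  by rewrite /ptens (linZ sl) h !scalerA mulrC.
have -> : (fun m => sigma3 V (ptens psi (fproj r j x) m)) =
    fun m => (mag V eps)%:C *: ptens psi (fproj r j x) m by apply/funext => m; rewrite sp.
rewrite (seq_linZ (annL_lin L)) (seq_linZ (creL_lin L)) sp (linZ sl) sp.
rewrite -scalerDr /annL /creL !opQ_ptens ann_ptens cre_ptens !opQ_ptens.
have -> : ptens psi (opQ L (ann (opQ L (fproj r j x)))) n + ptens psi (opQ L (cre (opQ L (fproj r j x)))) n =
    ptens psi (fieldOp L (fproj r j x)) n by rewrite /ptens -scalerDl.
rewrite fproj_eig /ptens !scalerA -scalerDl; congr (_ *: _).
rewrite /GRing.scale/= rmorphD/= !rmorphM/= rmorph_nat; ring.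
Qed.

(** An arbitrary finite index type, because each exponential multiplies the index by the set of spin
    sectors. *)
Definition tsum (I : finType) (psi : I -> S) (x : I -> nat -> R[i]^o) : nat -> S :=
  fun n => \sum_l ptens (psi l) (x l) n.

Section Evolution.
Variables (J gamma : R) (V : {fset lattice d}) (L : nat).
Variables (rs : joint_resolution Z (enum_fset V)) (rf : field_spectrum (R := R) L).

Definition mg (q : idx rs) : R := mag V (eigv rs q).

Definition phase t (q : idx rs) : R[i] := cexp (t * (J * #|` V|%:R * mg q ^+ 2)).

(** On sector [q] and the j-th field eigenvector, the Hamiltonian is the number J |V| mu^2 + gamma
    mu lambda_j. The first term gives the phase; summing over [j] rebuilds the field evolution at
    time t gamma mu. *)
Lemma op_exp_hamiltonian t (I : finType) (psi : I -> S) (x : I -> nat -> R[i]^o) :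
  (forall l, l2 (x l)) -> (forall l j, l2 (fproj rf j (x l))) ->
  op_exp ('i%C * t%:C) (hamiltonian J gamma V L) (tsum psi x) =
  tsum (fun lq : I * idx rs => phase t lq.2 *: jproj rs lq.2 (psi lq.1))
       (fun lq => fevol rf (t * (gamma * mg lq.2)) (x lq.1)).
Proof.
move=> lx lfx.
pose K := (I * idx rs * option 'I_L.+1)%type.
pose y (k : K) := ptens (jproj rs k.1.2 (psi k.1.1)) (fproj rf k.2 (x k.1.1)).
pose h (k : K) := J * #|` V|%:R * mg k.1.2 ^+ 2 + gamma * mg k.1.2 * fev rf k.2.
have -> : tsum psi x = fun n => \sum_k y k n.
  apply/funext => n.
  rewrite -(pair_big xpredT xpredT (fun lq j => y (lq, j) n)) /=.
  rewrite -(pair_big xpredT xpredT (fun l q => \sum_j y (l, q, j) n)) /=.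
  apply: eq_bigr => l _; rewrite /ptens -[psi l in LHS](proj_sum rs) scaler_sumr.
  apply: eq_bigr => q _; rewrite /y /ptens /= -scaler_suml; congr (_ *: _).
  by rewrite fproj_sum.
rewrite (@op_exp_eigen _ _ _ _ _ h); first last.
- move=> [[l q] j]; rewrite /y /h /=; apply: hamiltonian_eigenvector => i iV.
  exact: (proj_eig rs).
- by move=> [[l q] j]; apply: l2_ptens; exact: lfx.
- exact: hamiltonian_lin.
apply/funext => n.
rewrite -(pair_big xpredT xpredT (fun lq j => cexp (t * h (lq, j)) *: y (lq, j) n)) /=.
apply: eq_bigr => -[l q] _ /=; rewrite /fevol /ptens scaler_suml; apply: eq_bigr => j _.
rewrite /y /h /ptens /phase /= !scalerA; congr (_ *: _).
have -> : t * (J * #|` V|%:R * mg q ^+ 2 + gamma * mg q * fev rf j) =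
  t * (J * #|` V|%:R * mg q ^+ 2) + t * (gamma * mg q) * fev rf j.
  by rewrite mulrDr !mulrA.
by rewrite cexpD /GRing.scale/= [RHS]mulrC [RHS]mulrA.
Qed.

End Evolution.

End Hamiltonian.


(** * Heisenberg evolution of operators that are simple tensors *)

Section HeisenbergEvolution.
Context {R : realType} {d : nat} {S : spinSystem R d}.
Implicit Types (V : {fset lattice d}) (psi : S) (x : nat -> R[i]^o).

Local Notation Z := (fun i : lattice d => @sigma R d S ax3 i).

Lemma ptens0l x n : ptens (0 : S) x n = 0.
Proof. exact: scaler0. Qed.

Lemma ptens_suml (I : finType) (psi : I -> S) x n :
  \sum_q ptens (psi q) x n = ptens (\sum_q psi q) x n.
Proof. by rewrite /ptens scaler_sumr. Qed.

Lemma ptens_tsum psi x : ptens psi x = tsum (fun _ : 'I_1 => psi) (fun=> x).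
Proof. by apply/funext => n; rewrite /tsum big_ord1. Qed.

Lemma in_algebra_fin (I : finType) (B : I -> S -> S)
    (T : I -> (nat -> R[i]^o) -> nat -> R[i]^o) (X : (nat -> S) -> nat -> S) :
  (forall j, bounded_op (B j)) -> (forall j, Lplus (T j)) ->
  (forall n (psi : 'I_n -> S) (x : 'I_n -> nat -> R[i]^o), (forall l, domD (x l)) ->
     X (tsum psi x) = fun r => \sum_j \sum_l ptens (B j (psi l)) (T j (x l)) r) ->
  in_algebra X.
Proof.
move=> Bb TL XE; exists #|I|, (fun j => B (enum_val j)), (fun j => T (enum_val j)).
split=> // n psi x xD; have := XE n psi x xD; rewrite /tsum => ->.
by apply/funext => m; rewrite (reindex (@enum_val I I))//=; exact/onW_bij/enum_val_bij.
Qed.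

Section Alpha.
Variables (J gamma t : R) (V : {fset lattice d}) (L : nat).
Variables (G : S -> S) (T T' : (nat -> R[i]^o) -> nat -> R[i]^o).
Variable X : (nat -> S) -> nat -> S.
Hypothesis Gb : bounded_op G.
Hypothesis Tlin : seq_lin T.
Hypothesis TD : forall x, domD x -> domD (T x).
Hypothesis T'D : forall x, domD x -> domD (T' x).
Hypothesis TT' : forall x y, domD x -> domD y -> fdot (T x) y = fdot x (T' y).
Hypothesis XE : forall (I : finType) (psi : I -> S) (x : I -> nat -> R[i]^o),
  X (tsum psi x) = tsum (fun l => G (psi l)) (fun l => T (x l)).

Section Formula.
Variables (rs : joint_resolution Z (enum_fset V)) (rf : field_spectrum (R := R) L).

Let ph t q := @phase R d S J V rs t q.
Let mu q := @mg R d S V rs q.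

(** The sectors [k.1.2] before and [k.2] after the action of [G] are independent indices; they
    become linked once commutation relations of [G] are known. *)
Lemma alpha_tsum (I : finType) (psi : I -> S) (x : I -> nat -> R[i]^o) :
  (forall l, domD (x l)) ->
  alpha J gamma t X (V, L) (tsum psi x) =
  tsum (fun k : I * idx rs * idx rs =>
      ph t k.2 *: jproj rs k.2 (G (ph (- t) k.1.2 *: jproj rs k.1.2 (psi k.1.1))))
    (fun k => fevol rf (t * (gamma * mu k.2))
      (T (fevol rf (- t * (gamma * mu k.1.2)) (x k.1.1)))).
Proof.
move=> xD; rewrite /alpha /=.
have -> : - ('i%C * t%:C) = 'i%C * (- t)%:C :> R[i] by rewrite rmorphN mulrN.
rewrite (op_exp_hamiltonian _ _ rs (rf := rf)); first last.
- by move=> l j; exact/domD_l2/fproj_D.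
- by move=> l; exact/domD_l2.
rewrite XE (op_exp_hamiltonian _ _ rs (rf := rf))//.
- by move=> l; exact/domD_l2/TD/fevol_D.
- by move=> l j; exact/domD_l2/fproj_D/TD/fevol_D.
Qed.

Lemma alpha_ptens psi x : domD x ->
  alpha J gamma t X (V, L) (ptens psi x) = fun n => \sum_q \sum_q'
    ptens (ph t q' *: jproj rs q' (G (ph (- t) q *: jproj rs q psi)))
      (fevol rf (t * (gamma * mu q')) (T (fevol rf (- t * (gamma * mu q)) x))) n.
Proof.
move=> xD; rewrite ptens_tsum alpha_tsum//; apply/funext => n; rewrite /tsum.
rewrite -(pair_big xpredT xpredT (fun lq q' =>
    ptens (ph t q' *: jproj rs q' (G (ph (- t) lq.2 *: jproj rs lq.2 psi)))
      (fevol rf (t * (gamma * mu q')) (T (fevol rf (- t * (gamma * mu lq.2)) x))) n)) /=.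
rewrite -(pair_big xpredT xpredT (fun (l : 'I_1) q => \sum_q'
    ptens (ph t q' *: jproj rs q' (G (ph (- t) q *: jproj rs q psi)))
      (fevol rf (t * (gamma * mu q')) (T (fevol rf (- t * (gamma * mu q)) x))) n)) /=.
by rewrite big_ord1.
Qed.

Lemma alpha_in_algebra_aux : in_algebra (alpha J gamma t X (V, L)).
Proof.
apply: (@in_algebra_fin (idx rs * idx rs)%type
  (fun k psi => ph t k.2 *: jproj rs k.2 (G (ph (- t) k.1 *: jproj rs k.1 psi)))
  (fun k x => fevol rf (t * (gamma * mu k.2)) (T (fevol rf (- t * (gamma * mu k.1)) x)))).
- move=> k.
  have b1 := bounded_scale (ph (- t) k.1) (proj_bounded k.1).
  exact: (bounded_scale (ph t k.2) (bounded_comp (proj_bounded k.2) (bounded_comp Gb b1))).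
- move=> k; apply: (@Lplus_adjoint _ _ (fun y => fevol rf (- (- t * (gamma * mu k.1)))
    (T' (fevol rf (- (t * (gamma * mu k.2))) y)))).
  + by move=> c x y _ _; rewrite fevol_lin Tlin fevol_lin.
  + by move=> x xD; exact/fevol_D/TD/fevol_D.
  + by move=> x xD; exact/fevol_D/T'D/fevol_D.
  + move=> x y xD yD; rewrite fevol_adjoint//; last exact/TD/fevol_D.
    by rewrite TT' ?fevol_adjoint//; [exact/T'D/fevol_D|exact: fevol_D|exact: fevol_D].
- move=> n psi x xD; rewrite alpha_tsum//; apply/funext => m; rewrite /tsum.
  pose W l q q' := ptens (ph t q' *: jproj rs q' (G (ph (- t) q *: jproj rs q (psi l))))
      (fevol rf (t * (gamma * mu q')) (T (fevol rf (- t * (gamma * mu q)) (x l)))) m.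
  rewrite -(pair_big xpredT xpredT (fun lq q' => W lq.1 lq.2 q')) /=.
  rewrite -(pair_big xpredT xpredT (fun l q => \sum_q' W l q q')) /=.
  rewrite -(pair_big xpredT xpredT (fun q q' => \sum_l W l q q')) /=.
  rewrite exchange_big; apply: eq_bigr => q _ /=.
  by rewrite exchange_big.
Qed.

End Formula.

Lemma alpha_in_algebra : in_algebra (alpha J gamma t X (V, L)).
Proof.
exact: alpha_in_algebra_aux (spin_resolution (enum_fset V)) (field_spectrum_exists L).
Qed.

End Alpha.

Lemma ann_tsum (I : finType) (psi : I -> S) (x : I -> nat -> R[i]^o) :
  ann (tsum psi x) = tsum (fun l => psi l) (fun l => ann (x l)).
Proof.
apply/funext => n; rewrite /ann /tsum scaler_sumr; apply: eq_bigr => l _.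
by rewrite /ptens scalerA.
Qed.

Lemma lin_tsum (G : S -> S) (I : finType) (psi : I -> S) (x : I -> nat -> R[i]^o) :
  lin G -> (fun n => G (tsum psi x n)) = tsum (fun l => G (psi l)) x.
Proof.
move=> Gl; apply/funext => n; rewrite /tsum (lin_sum Gl); apply: eq_bigr => l _.
by rewrite /ptens (linZ Gl).
Qed.

Section Formulas.
Variables (J gamma t : R) (V : {fset lattice d}) (L : nat).
Variables (rs : joint_resolution Z (enum_fset V)) (rf : field_spectrum (R := R) L).

Let phaseK (q : idx rs) : phase J t q * phase J (- t) q = 1 :> R[i].
Proof. by rewrite /phase -cexpD mulNr subrr cexp0. Qed.

(** With the identity as spin factor, the sectors before and after coincide and the phases cancel,
    so that [J] disappears. *)
Lemma alpha_ann_ptens psi x : domD x ->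
  alpha J gamma t ann (V, L) (ptens psi x) = fun n => \sum_q ptens (jproj rs q psi)
    (fevol rf (t * (gamma * mg q)) (ann (fevol rf (- (t * (gamma * mg q))) x))) n.
Proof.
move=> xD; rewrite (@alpha_ptens J gamma t V L id ann ann domD_ann ann_tsum rs rf)//.
apply/funext => n; apply: eq_bigr => q _.
rewrite (bigD1 q)//= big1 => [|q' q'q]; last first.
  rewrite (linZ (proj_lin rs q')) proj_orth (negbTE q'q) !scaler0.
  exact: ptens0l.
rewrite addr0 (linZ (proj_lin rs q)) proj_orth eqxx scalerA phaseK scale1r.
by rewrite mulNr.
Qed.

Let spin_tsum al i (I : finType) (psi : I -> S) (x : I -> nat -> R[i]^o) :
  spin_obs al i (tsum psi x) = tsum (fun l => sigma al i (psi l)) (fun l => id (x l)).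
Proof. exact: lin_tsum (sigma_lin al i). Qed.

Lemma alpha_sigma3_ptens i psi x : domD x ->
  alpha J gamma t (spin_obs ax3 i) (V, L) (ptens psi x) = ptens (sigma ax3 i psi) x.
Proof.
move=> xD; rewrite (@alpha_ptens J gamma t V L (sigma ax3 i) id (spin_obs ax3 i) (fun _ xD => xD) (spin_tsum ax3 i) rs rf)//.
apply/funext => n; transitivity (\sum_q ptens (jproj rs q (sigma ax3 i psi)) x n); last first.
  by rewrite ptens_suml proj_sum.
apply: eq_bigr => q _.
have comm q' y : sigma ax3 i (jproj rs q' y) = jproj rs q' (sigma ax3 i y).
  by apply: proj_comm; [exact: sigma_lin|move=> j z _; exact: sigma3_comm].
rewrite (bigD1 q)//= big1 => [|q' q'q]; last first.
  rewrite (linZ (sigma_lin _ _)) comm (linZ (proj_lin rs q')) proj_orth (negbTE q'q) !scaler0.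
  exact: ptens0l.
rewrite addr0 (linZ (sigma_lin _ _)) comm (linZ (proj_lin rs q)) proj_orth eqxx.
by rewrite scalerA phaseK scale1r mulNr fevolK.
Qed.

(* [sigma al i] reverses the sign of the eigenvalue of [sigma ax3 i]. *)
Definition flipped i (eps : lattice d -> R) : lattice d -> R :=
  fun j => if j == i then - eps j else eps j.

(** Flipping the sign at [i] changes mu into m' = mu - 2 eps_i / |V|, and |V| (m'^2 - mu^2) = -4 (mu
    eps_i - 1/|V|). *)
Definition flip_energy i (eps : lattice d -> R) : R := mag V eps * eps i - (#|` V|%:R)^-1.

Lemma mag_ext (e e' : lattice d -> R) : {in V, e =1 e'} -> mag V e = mag V e'.
Proof.
by move=> h; rewrite /mag big_seq [in RHS]big_seq; congr (_ * _); apply: eq_bigr => j /h.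
Qed.

Lemma mag_flipped i eps : i \in V ->
  mag V (flipped i eps) = mag V eps - 2 * eps i / #|` V|%:R.
Proof.
move=> iV; rewrite /mag !(bigD1_seq i iV (fset_uniq V))/= /flipped eqxx.
have -> : \sum_(j <- V | j != i) (if j == i then - eps j else eps j) = \sum_(j <- V | j != i) eps j.
  by apply: eq_bigr => j /negbTE ->.
ring.
Qed.

Lemma alpha_sigma_ptens al i psi x : al <> ax3 -> i \in V -> domD x ->
  alpha J gamma t (spin_obs al i) (V, L) (ptens psi x) = fun n => \sum_q
    ptens (cexp (- (4 * t * J) * flip_energy i (eigv rs q)) *: sigma al i (jproj rs q psi))
      (fevol rf (- (2 * t * gamma) * eigv rs q i / #|` V|%:R) x) n.
Proof.
move=> al3 iV xD.
rewrite (@alpha_ptens J gamma t V L (sigma al i) id (spin_obs al i) (fun _ xD => xD) (spin_tsum al i) rs rf)//.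
apply/funext => n; apply: eq_bigr => q _.
set y := sigma al i (jproj rs q psi); set eps := eigv rs q.
have n0 : #|` V|%:R != 0 :> R by rewrite pnatr_eq0 cardfs_eq0; apply/fset0Pn; exists i.
have yeig j : j \in V -> sigma ax3 j y = (flipped i eps j)%:C *: y.
  move=> jV; rewrite /flipped; have [->|ji] := eqVneq j i.
    rewrite -[LHS]opprK -sigma_anticomm// (proj_eig rs q _ iV) (linZ (sigma_lin _ _)).
    by rewrite rmorphN scaleNr.
  by rewrite -sigma_comm 1?eq_sym// (proj_eig rs q _ jV) (linZ (sigma_lin _ _)).
pose m' := mag V (flipped i eps).
(* Every sector [q'] in which [y] has a component has magnetization [m'], so phase and field
   evolution no longer depend on [q'] and the projections sum to the identity. *)
transitivity (\sum_q' ptens (cexp (t * (J * #|` V|%:R * m' ^+ 2)) * phase J (- t) q *: jproj rs q' y)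
    (fevol rf (t * (gamma * m') - t * (gamma * mg q)) x) n).
  apply: eq_bigr => q' _; rewrite (linZ (sigma_lin _ _)) -/y (linZ (proj_lin rs q')) scalerA.
  have [->|h] := proj_joint_eigenvector (fun i => sigma_lin ax3 i) sigma3_comm q' yeig.
    by rewrite !scaler0 !ptens0l.
  have mE : mg q' = m' by exact: mag_ext.
  by rewrite /phase mE /= fevolD !mulNr.
rewrite ptens_suml -scaler_sumr proj_sum /phase -cexpD.
have e2 : eps i * eps i = 1 by rewrite -expr2 eigv_sq.
have -> : t * (J * #|` V|%:R * m' ^+ 2) + - t * (J * #|` V|%:R * mg q ^+ 2) =
    - (4 * t * J) * flip_energy i eps.
  have -> : flip_energy i eps = mag V eps * eps i - eps i * eps i / #|` V|%:R.
    by rewrite e2 mul1r.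
  rewrite /m' mag_flipped// /mg -/eps.
  by move: (mag V eps) (eps i) => m e; field.
have -> : t * (gamma * m') - t * (gamma * mg q) = - (2 * t * gamma) * eps i / #|` V|%:R.
  by rewrite /m' mag_flipped// /mg -/eps; move: (mag V eps) (eps i) => m e; field.
by [].
Qed.

End Formulas.

End HeisenbergEvolution.


(** * The topology *)

Section FockSeminorms.
Context {R : realType}.
Implicit Types (x y chi phi : nat -> R[i]^o) (f : R -> R).

(** Beyond some [M] rapid decay gives the bound 1; up to [M] the bound [b] on [f] is used. *)
Lemma classC_bound f p : classC f ->
  exists2 c : R, 0 <= c & forall n : nat, n.+1%:R ^+ p * f n.+1%:R <= c.
Proof.
move=> [f0 [b fb] _ fdec].
have /cvgr0Pnorm_lt/(_ _ ltr01)[M [_ hM]] := fdec p.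
have b0 : 0 <= b by rewrite (le_trans (ltW (f0 0 _)) (fb 0 _)).
exists (`|M| ^+ p * b + 1); first by rewrite addr_ge0// mulr_ge0// exprn_ge0.
move=> n; have [nM|Mn] := leP n.+1%:R M.
  apply: ler_wpDr => //; apply: ler_pM; rewrite ?exprn_ge0 ?fb//.
    by rewrite ltW// f0.
  by rewrite lerXn2r ?nnegrE// (le_trans nM)// ler_norm.
apply: ler_wpDl; first by rewrite mulr_ge0// exprn_ge0.
by rewrite (le_trans (ler_norm _))// ltW// hM.
Qed.

Lemma weight_funM f p : classC f -> exists2 c : R, 0 <= c &
  forall x, l2 x -> l2 (iter p opM (funM f x)) /\
    l2norm (iter p opM (funM f x)) <= c * l2norm x.
Proof.
move=> fC; have [c c0 hc] := classC_bound p fC; have [f0 _ _ _] := fC.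
exists c => // x; apply: l2_dom => // n.
rewrite rnorm_iter_opM /funM rnormZ rnormC gtr0_norm ?f0// mulrA.
by rewrite ler_wpM2r ?rnorm_ge0.
Qed.

Lemma funM_l2_D f x : classC f -> l2 x -> domD (funM f x).
Proof. by move=> fC lx; apply/domDP => p; have [c _ h] := weight_funM p fC; case: (h x lx). Qed.

(** Test vectors of the seminorms are merely in l^2, whereas weak bounds require the domain;
    truncations lie in the domain and suffice up to a factor 2. *)
Lemma fdot_truncation x y (e : R) : l2 x -> l2 y ->
  (forall m, rnorm (fdot (opQ m x) y) <= e) -> rnorm (fdot x y) <= e + e.
Proof.
move=> lx ly h; have [[hr hi] _] := fdot_has lx ly.
have part m : rnorm (\sum_(0 <= n < m.+1) (x n)^*%C * y n) <= e.
  have := h m; have h0 n : (m.+1 <= n)%N -> (opQ m x n)^*%C * y n = 0.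
    by move=> mn; rewrite /opQ ifN -?ltnNge// conjc0 mul0r.
  rewrite {1}/fdot (has_csumE (has_csum_finite h0)).
  rewrite big_nat (eq_bigr (fun n => (x n)^*%C * y n)) -?big_nat// => n /andP[_ nm].
  by rewrite /opQ -ltnS nm.
have lim (u : nat -> R) (l : R) : series u @ \oo --> l -> (forall m, `|series u m.+1| <= e) -> `|l| <= e.
  move=> ul ue; apply/ler_addgt0Pr => d d0.
  move: ul; rewrite -cvg_shiftS => /cvgrPdist_lt/(_ _ d0)/filter_ex[m hm].
  rewrite -(subrK (series u m.+1) l) (le_trans (ler_normD _ _))// addrC lerD//.
  exact: ltW.
rewrite (le_trans (rnorm_le_ReIm _))// lerD//.
- apply: (lim _ _ hr) => m; rewrite /series /= -complex_Re_sum.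
  exact: le_trans (Re_le_rnorm _) (part m).
- apply: (lim _ _ hi) => m; rewrite /series /= -complex_Im_sum.
  exact: le_trans (Im_le_rnorm _) (part m).
Qed.

(* [b] bounds [M^k F M^-p] and [M^k F' M^-p], where [F'] is the adjoint of [F]. *)
Definition weak_bound (k p : nat) (b : R) (F F' : (nat -> R[i]^o) -> nat -> R[i]^o) :=
  [/\ forall x, domD x -> domD (F x), forall x, domD x -> domD (F' x),
      forall x y, domD x -> domD y -> fdot (F x) y = fdot x (F' y),
      forall chi y, domD chi -> domD y ->
        rnorm (fdot (iter k opM chi) (F y)) <= b * (l2norm chi * l2norm (iter p opM y)) &
      forall chi y, domD chi -> domD y ->
        rnorm (fdot (iter k opM chi) (F' y)) <= b * (l2norm chi * l2norm (iter p opM y))].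

(** For f(M) F M^k the roles are exchanged: M^k phi becomes the left vector and F' acts on f(M) chi,
    which lies in the domain. For M^k F f(M) the left vector [chi] is truncated before M^k is moved
    onto it. *)
Lemma weak_bound_seminorm k p b F F' f (c : R) chi phi : 0 <= b -> 0 <= c -> classC f ->
  (forall x, l2 x -> l2norm (iter p opM (funM f x)) <= c * l2norm x) ->
  weak_bound k p b F F' -> l2 chi -> l2norm chi <= 1 -> domD phi -> l2norm phi <= 1 ->
  rnorm (fdot chi (funM f (F (iter k opM phi)))) <= b * c *+ 2 /\
  rnorm (fdot chi (iter k opM (F (funM f phi)))) <= b * c *+ 2.
Proof.
move=> b0 c0 fC hc [FD F'D FF' Fb F'b] lchi chi1 phiD phi1.
have kphiD : domD (iter k opM phi) := @domD_opM _ k _ phiD.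
have fD y : l2 y -> domD (funM f y) := funM_l2_D fC.
have bound y (z : nat -> R[i]^o) : l2norm y <= 1 -> l2 z -> l2norm z <= 1 ->
    b * (l2norm y * l2norm (iter p opM (funM f z))) <= b * c.
  move=> y1 lz z1; apply: ler_wpM2l => //; rewrite -[leRHS]mul1r.
  apply: ler_pM => //; try exact: l2norm_ge0.
  by rewrite (le_trans (hc z lz))// ler_piMr.
split.
  have fchiD := fD _ lchi; have FkD := FD _ kphiD.
  rewrite -fdot_funM (fdotC (domD_l2 FkD) (domD_l2 fchiD)) (FF' _ _ kphiD fchiD) rnorm_conj.
  apply: le_trans (F'b _ _ phiD fchiD) _; apply: le_trans (bound _ _ phi1 lchi chi1) _.
  by rewrite mulr2n lerDl mulr_ge0.
have lphi := domD_l2 phiD; have ffD := fD _ lphi.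
rewrite mulr2n; apply: fdot_truncation; [exact: lchi|exact: (domD_l2 (@domD_opM _ k _ (FD _ ffD)))|].
move=> m; have mD : domD (opQ m chi).
  by apply: (@domD_finite _ _ m.+1) => n mn; rewrite /opQ leqNgt mn.
have m1 : l2norm (opQ m chi) <= 1.
  case: (@l2_dom _ _ _ chi (opQ m chi) 1 ler01) => // [n|_ le].
    by rewrite mul1r /opQ; case: ifP => _//; rewrite rnorm0 rnorm_ge0.
  by rewrite (le_trans le)// mul1r.
rewrite -fdot_iter_opM; apply: le_trans (Fb _ _ mD ffD) _.
exact: (bound _ _ m1 lphi phi1).
Qed.

Lemma weight_mono_le k p x : (k <= p)%N -> domD x -> l2norm (iter k opM x) <= l2norm (iter p opM x).
Proof.
move=> kp xD; rewrite -(subnK kp); elim: (p - k)%N => [//|m IH].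
by rewrite addSn (le_trans IH)// weight_mono.
Qed.

Lemma weak_bound_id k p : (k <= p)%N -> weak_bound k p 2 id id.
Proof.
move=> kp.
have h chi y : domD chi -> domD y ->
    rnorm (fdot (iter k opM chi) y) <= 2 * (l2norm chi * l2norm (iter p opM y)).
  move=> chiD yD; rewrite fdot_iter_opM (le_trans (rnorm_fdot (domD_l2 chiD) (domD_l2 (@domD_opM _ k _ yD))))//.
  apply: ler_wpM2l; first exact: ler0n.
  by apply: ler_wpM2l; [exact: l2norm_ge0|exact: weight_mono_le].
by split.
Qed.

End FockSeminorms.

Section TauSeminorms.
Context {R : realType} {d : nat} {S : spinSystem R d}.
Implicit Types (Psi : S) (f : R -> R).

Lemma kdot_tensors (I : finType) (chi1 : S) (chi2 : nat -> R[i]^o) (psi : I -> S)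
    (y : I -> nat -> R[i]^o) : l2 chi2 -> (forall q, l2 (y q)) ->
  kdot (ptens chi1 chi2) (fun n => \sum_q ptens (psi q) (y q) n) =
  \sum_q dot chi1 (psi q) * fdot chi2 (y q).
Proof.
move=> l2c ly; apply: has_csumE.
have := @has_csum_sum _ _ (index_enum I) xpredT _ _ (fun q => has_csumZ (dot chi1 (psi q)) (fdot_has l2c (ly q)).1).
congr has_csum; apply/funext => n; rewrite /ptens dot_sumr; apply: eq_bigr => q _.
by rewrite dotZl dotZr mulrC mulrA.
Qed.

Lemma Psi_norm_le Psi (Y : (nat -> S) -> nat -> S) (e : R) :
  (forall (chi1 : S) (chi2 phi2 : nat -> R[i]^o), rnorm chi1 <= 1 ->
     l2 chi2 -> l2norm chi2 <= 1 -> domD phi2 -> l2norm phi2 <= 1 ->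
     rnorm (kdot (ptens chi1 chi2) (Y (ptens Psi phi2))) <= e) ->
  (Psi_norm Psi Y <= e%:E)%E.
Proof.
move=> h; apply: ge_ereal_sup => _ [chi1 [chi2 [phi2 [c1 [l2c c2] [pD p1] ->]]]].
by rewrite lee_fin h.
Qed.

Lemma Psi_norm_ge0 Psi (Y : (nat -> S) -> nat -> S) : (0 <= Psi_norm Psi Y)%E.
Proof.
have [lz ez] := l2norm0 (R[i]^o).
apply: (@le_trans _ _ (rnorm (kdot (ptens (0 : S) (fun=> 0)) (Y (ptens Psi (fun=> 0)))))%:E).
  by rewrite lee_fin rnorm_ge0.
apply: ereal_sup_ubound; exists 0, (fun=> 0), (fun=> 0).
split; rewrite ?rnorm0 ?ez ?ler01//; split => //; rewrite ?ez//.
exact: domD0.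
Qed.

Lemma tau_seminorm_ge0 f k Psi (Y : (nat -> S) -> nat -> S) : (0 <= tau_seminorm f k Psi Y)%E.
Proof. by rewrite /tau_seminorm le_max Psi_norm_ge0. Qed.

(** The common estimate behind all limits. Spin and boson factors decouple: a weak bound [b q] for
    each boson operator, weighted by the overlap of its spin vector with a test vector of norm at
    most 1. *)
Lemma tau_seminorm_le f k p Psi (Y : (nat -> S) -> nat -> S) (I : finType) (psi : I -> S)
    (F F' : I -> (nat -> R[i]^o) -> nat -> R[i]^o) (b : I -> R) (c A : R) :
  classC f -> 0 <= c ->
  (forall x : nat -> R[i]^o, l2 x -> l2norm (iter p opM (funM f x)) <= c * l2norm x) ->
  (forall q, 0 <= b q) -> (forall q, weak_bound k p (b q) (F q) (F' q)) ->
  (forall phi, domD phi -> Y (ptens Psi phi) = fun n => \sum_q ptens (psi q) (F q phi) n) ->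
  (forall chi : S, rnorm chi <= 1 -> \sum_q rnorm (dot chi (psi q)) * b q <= A) ->
  (tau_seminorm f k Psi Y <= (2 * c * A)%:E)%E.
Proof.
move=> fC c0 hc b0 Fb YE hA.
have tensor (T : (nat -> S) -> nat -> S) (T0 : (nat -> R[i]^o) -> nat -> R[i]^o) phi :
    seq_lin T -> (forall psi x, T (ptens psi x) = ptens psi (T0 x)) -> domD phi ->
    T (Y (ptens Psi phi)) = fun n => \sum_q ptens (psi q) (T0 (F q phi)) n.
  move=> Tlin TT0 phiD; rewrite YE//.
  have -> : (fun n => \sum_q ptens (psi q) (F q phi) n) = fun n => \sum_q 1 *: ptens (psi q) (F q phi) n.
    by apply/funext => n; apply: eq_bigr => q _; rewrite scale1r.
  rewrite (seq_lin_sum Tlin); apply/funext => n; apply: eq_bigr => q _.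
  by rewrite scale1r TT0.
have main (chi1 : S) (chi2 : nat -> R[i]^o) (y : I -> nat -> R[i]^o) : rnorm chi1 <= 1 -> l2 chi2 ->
    (forall q, l2 (y q)) -> (forall q, rnorm (fdot chi2 (y q)) <= b q * c *+ 2) ->
    rnorm (kdot (ptens chi1 chi2) (fun n => \sum_q ptens (psi q) (y q) n)) <= 2 * c * A.
  move=> chi1le lchi2 ly hy; rewrite kdot_tensors// (le_trans (rnorm_sum _ _ _))//.
  have c20 : 0 <= 2 * c by rewrite mulr_ge0.
  rewrite (le_trans _ (ler_wpM2l c20 (hA chi1 chi1le)))// mulr_sumr; apply: ler_sum => q _.
  rewrite rnormM mulrCA ler_wpM2l ?rnorm_ge0// (le_trans (hy q))//.
  by rewrite -mulr_natl -mulrA [b q * c]mulrC.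
rewrite /tau_seminorm ge_max; apply/andP; split; apply: Psi_norm_le => chi1 chi2 phi2 c1 lc2 c2 pD p1 /=.
- rewrite opM_ptens (tensor _ (funM f) _ (funM_lin f) (funM_ptens f))//; last exact: domD_opM.
  apply: main => // q; have [FD _ _ _ _] := Fb q.
    by apply/domD_l2/domD_funM => //; apply/FD/domD_opM.
  by case: (weak_bound_seminorm (b0 q) c0 fC hc (Fb q) lc2 c2 pD p1).
- have fD : domD (funM f phi2) by exact: domD_funM.
  rewrite funM_ptens (tensor _ (iter k opM) _ (opM_lin k) (opM_ptens k))//.
  apply: main => // q; have [FD _ _ _ _] := Fb q.
    by apply/domD_l2/domD_opM/FD.
  by case: (weak_bound_seminorm (b0 q) c0 fC hc (Fb q) lc2 c2 pD p1).
Qed.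

Lemma ereal_cvg0 (T : Type) (G : set_system T) (GG : Filter G) (u : T -> \bar R) :
  (forall p, 0 <= u p)%E -> (forall e : R, 0 < e -> \forall p \near G, (u p <= e%:E)%E) ->
  u @ G --> 0%E.
Proof.
move=> u0 ue; apply/fine_cvgP; split.
  have := ue _ ltr01; apply: filterS => p up.
  by rewrite ge0_fin_numE// (le_lt_trans up)// ltry.
apply/cvgr0Pnorm_lt => e e0; have := ue _ (divr_gt0 e0 (ltr0n R 2)); apply: filterS => p /=.
have := u0 p; case: (u p) => [r| |]//=; rewrite !lee_fin => r0 re.
by rewrite ger0_norm// (le_lt_trans re)// ltr_pdivrMr// ltr_pMr// ltr1n.
Qed.

End TauSeminorms.


(** * The limits *)

Section EvolvedAnnihilator.
Context {R : realType}.
Implicit Types (x y z : nat -> R[i]^o).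

Lemma domDB x y : domD x -> domD y -> domD (fun n => x n - y n).
Proof.
move=> xD yD; have -> : (fun n => x n - y n) = fun n => x n + (-1) *: y n.
  by apply/funext => n; rewrite scaleN1r.
by apply: domDD => //; exact: domDZ.
Qed.

Lemma fdotBl x y z : l2 x -> l2 y -> l2 z ->
  fdot (fun n => x n - y n) z = fdot x z - fdot y z.
Proof.
move=> lx ly lz; rewrite (fdotC lz (l2B lx ly)) fdotBr// conjcD conjcN.
by rewrite -(fdotC lz lx) -(fdotC lz ly).
Qed.

Lemma fdotZl (c : R[i]) x y : l2 x -> l2 y -> fdot (fun n => c *: x n) y = c^*%C * fdot x y.
Proof.
by move=> lx ly; rewrite (fdotC ly (l2Z c lx).1) fdotZr// conjcM -(fdotC ly lx).
Qed.

Section Deviation.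
Variables (L : nat) (rf : field_spectrum (R := R) L) (th : R).

Definition deviation (T : (nat -> R[i]^o) -> nat -> R[i]^o) (c : R[i]) x : nat -> R[i]^o :=
  fun n => fevol rf th (T (fevol rf (- th) x)) n - T x n - (th%:C * ('i%C * c)) *: x n.

Lemma deviation_D T c x : (forall x, domD x -> domD (T x)) -> domD x -> domD (deviation T c x).
Proof.
move=> TD xD; apply: domDB; last exact: domDZ.
by apply: domDB; [exact/fevol_D/TD/fevol_D|exact: TD].
Qed.

(** The constants match because th is real and the conjugate of i (-1) is i. *)
Lemma deviation_adjoint x y : domD x -> domD y ->
  fdot (deviation ann (-1) x) y = fdot x (deviation cre 1 y).
Proof.
move=> xD yD; have lx := domD_l2 xD; have ly := domD_l2 yD.
have uxD : domD (fevol rf (- th) x) by exact: fevol_D.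
have uyD : domD (fevol rf (- th) y) by exact: fevol_D.
have aD := domD_ann xD; have cD := domD_cre yD.
have auD := domD_ann uxD; have cuD := domD_cre uyD.
have uauD : domD (fevol rf th (ann (fevol rf (- th) x))) by exact: fevol_D.
have ucuD : domD (fevol rf th (cre (fevol rf (- th) y))) by exact: fevol_D.
rewrite /deviation fdotBl; [|exact: l2B (domD_l2 uauD) (domD_l2 aD)|exact: (l2Z _ lx).1|exact: ly].
rewrite fdotBr; [|exact: lx|exact: l2B (domD_l2 ucuD) (domD_l2 cD)|exact: (l2Z _ ly).1].
rewrite (fdotBl (domD_l2 uauD) (domD_l2 aD) ly) (fdotBr lx (domD_l2 ucuD) (domD_l2 cD)).
rewrite (fdotZl _ lx ly) (fdotZr _ lx ly) (fdot_ann (domD_l2 aD) ly).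
rewrite (fevol_adjoint rf th auD yD) (fdot_ann (domD_l2 auD) (domD_l2 uyD)).
have e := fevol_adjoint rf (- th) xD cuD; rewrite opprK in e; rewrite e; congr (_ - _ * _).
rewrite conjcM conjc_real conjcM; congr (_ * _); rewrite conjcN conjc1 mulrN1 mulr1.
by apply/eqP; rewrite eq_complex /= oppr0 opprK !eqxx.
Qed.

End Deviation.

(** One constant for all times up to [T0]: the times t gamma mu of the different sectors satisfy
    this bound since |mu| <= 1. The two summands of the constant serve the operator and its
    adjoint. *)
Lemma weak_bound_deviation k (T0 : R) : exists2 C : R, 0 <= C &
  forall (L : nat) (rf : field_spectrum (R := R) L) th, (0 < L)%N -> `|th| <= `|T0| ->
  weak_bound k k.+3 (C / L%:R) (deviation rf th ann (-1)) (deviation rf th cre 1).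
Proof.
pose K1 (j : nat) : R := 4; pose K2 j : R := 2 * (1 + 2 ^+ j.+1 * 2 ^+ j.+2).
have K10 j : 0 <= K1 j by [].
have K20 j : 0 <= K2 j by rewrite mulr_ge0// addr_ge0// mulr_ge0// exprn_ge0.
pose C (K : nat -> R) t : R := 4 * (growth k t * (K k * growth k.+3 t)) * `|t|.
have C0 K t : (forall j, 0 <= K j) -> 0 <= C K t.
  move=> K0; apply: mulr_ge0 => //; apply: mulr_ge0; first exact: ler0n.
  by do 2!(apply: mulr_ge0; rewrite ?growth_ge0 ?K0//).
have Cle K t : (forall j, 0 <= K j) -> `|t| <= `|T0| -> C K t <= C K T0.
  move=> K0 tT; apply: ler_pM => //.
    apply: mulr_ge0; first exact: ler0n.
    by do 2!(apply: mulr_ge0; rewrite ?growth_ge0 ?K0//).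
  apply: ler_wpM2l; first exact: ler0n.
  apply: ler_pM; [exact: growth_ge0|by rewrite mulr_ge0 ?growth_ge0|exact: growth_le|].
  by apply: ler_wpM2l; [exact: K0|exact: growth_le].
exists (C K1 T0 + C K2 T0); first by rewrite addr_ge0// C0.
move=> L rf th L0 thT; have Lp : 0 < L%:R :> R by rewrite ltr0n.
have fin (r a b n : R) : 0 <= n -> L%:R * r <= a * n -> a <= b -> r <= b / L%:R * n.
  move=> n0 h ab; rewrite mulrAC ler_pdivlMr// mulrC (le_trans h)//.
  by rewrite ler_wpM2r.
have norms (chi y : nat -> R[i]^o) : 0 <= l2norm chi * l2norm (iter k.+3 opM y).
  by apply: mulr_ge0; exact: l2norm_ge0.
split.
- by move=> x; apply: deviation_D; exact: domD_ann.
- by move=> x; apply: deviation_D; exact: domD_cre.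
- by move=> x y; exact: deviation_adjoint.
- move=> chi y chiD yD.
  apply: (fin _ _ _ _ (norms chi y)
    (evolved_commutator_bound ann_lin domD_ann K10 (fun k L x xD => ann_commutator_weight k L xD) k rf th L0 chiD yD)).
  by apply: (le_trans (Cle K1 th K10 thT)); rewrite lerDl C0.
- move=> chi y chiD yD.
  apply: (fin _ _ _ _ (norms chi y)
    (evolved_commutator_bound cre_lin domD_cre K20 (fun k L x xD => cre_commutator_weight k L xD) k rf th L0 chiD yD)).
  by apply: (le_trans (Cle K2 th K20 thT)); rewrite lerDr C0.
Qed.

Lemma weak_bound_fevol_sub k (T0 : R) : exists2 C : R, 0 <= C &
  forall (L : nat) (rf : field_spectrum (R := R) L) th, `|th| <= `|T0| ->
  weak_bound k k.+1 (C * `|th|) (fun x n => fevol rf th x n - x n) (fun x n => fevol rf (- th) x n - x n).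
Proof.
pose a : R := 8 * (1 + 2 ^+ k).
have a0 : 0 <= a by rewrite mulr_ge0// addr_ge0// exprn_ge0.
exists (a * growth k.+1 T0); first by rewrite mulr_ge0// growth_ge0.
move=> L rf th thT.
have key s : `|s| = `|th| -> forall chi y, domD chi -> domD y ->
    rnorm (fdot (iter k opM chi) (fun n => fevol rf s y n - y n)) <=
    a * growth k.+1 T0 * `|th| * (l2norm chi * l2norm (iter k.+1 opM y)).
  move=> sth chi y chiD yD; apply: (le_trans (fevol_sub_bound k rf s chiD yD)).
  rewrite -/a sth; apply: ler_wpM2r; first by apply: mulr_ge0; exact: l2norm_ge0.
  apply: ler_wpM2r => //; apply: ler_wpM2l => //; apply: growth_le.
  by rewrite sth.
split.
- by move=> x xD; apply: domDB => //; exact: fevol_D.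
- by move=> x xD; apply: domDB => //; exact: fevol_D.
- move=> x y xD yD; have lx := domD_l2 xD; have ly := domD_l2 yD.
  have ux : domD (fevol rf th x) by exact: fevol_D.
  have uy : domD (fevol rf (- th) y) by exact: fevol_D.
  by rewrite (fdotBl (domD_l2 ux) lx ly) (fdotBr lx (domD_l2 uy) ly) (fevol_adjoint rf th xD yD).
- exact: key.
- by apply: key; rewrite normrN.
Qed.

End EvolvedAnnihilator.

Section Limits.
Context {R : realType} {d : nat} {S : spinSystem R d}.
Variable VV : set_system {fset lattice d}.
Hypothesis VVproper : ProperFilter VV.
Hypothesis VVdiverges : forall n, \forall V \near VV, (n <= #|` V|)%N.
Variables (J gamma t : R).

Local Notation Z := (fun i : lattice d => @sigma R d S ax3 i).

Let rs V : joint_resolution Z (enum_fset V) := spin_resolution (enum_fset V).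
Let rf L : field_spectrum (R := R) L := field_spectrum_exists L.

Lemma sigma3_spectral V (Psi : S) : sigma3 V Psi = \sum_q (mg q)%:C *: jproj (rs V) q Psi.
Proof.
rewrite -{1}(proj_sum (rs V) Psi) (lin_sum (sigma3_lin V)); apply: eq_bigr => q _.
by rewrite (@sigma3_eigenvector _ _ _ V (eigv (rs V) q))// => j jV; exact: proj_eig.
Qed.

Lemma mag_le1 (V : {fset lattice d}) (eps : lattice d -> R) : (forall j, eps j ^+ 2 = 1) -> `|mag V eps| <= 1.
Proof.
move=> e1; rewrite /mag normrM ger0_norm ?invr_ge0//.
have [->|n0] := eqVneq (#|` V|%:R : R) 0; first by rewrite invr0 mul0r.
have np : 0 < #|` V|%:R :> R by rewrite lt_neqAle eq_sym n0 ler0n.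
rewrite ler_pdivrMl// mulr1 (le_trans (ler_norm_sum _ _ _))//.
rewrite (eq_bigr (fun=> 1)) => [|j _]; first by rewrite big_const_seq count_predT iter_addr addr0.
by apply/eqP; rewrite -sqrp_eq1// real_normK ?num_real// e1.
Qed.

Lemma near_prod (P : set {fset lattice d}) (Q : set nat) (A : set ({fset lattice d} * nat)) :
  VV P -> \oo Q -> (forall V L, P V -> Q L -> A (V, L)) -> filter_prod VV \oo A.
Proof.
move=> PV QL h; exists (P, Q) => //= -[V L] [/= VP LQ].
exact: h.
Qed.

Lemma small_multiple (a e : R) : 0 <= a -> 0 < e -> exists2 delta : R, 0 < delta & a * delta <= e.
Proof.
move=> a0 e0; have a1 : 0 < a + 1 by rewrite ltr_wpDl.
exists (e / (a + 1)); first by rewrite divr_gt0.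
by rewrite mulrCA ler_piMr ?ltW// ltr_pdivrMr// mul1r ltrDl.
Qed.

Lemma large_divisor (a e : R) : 0 <= a -> 0 < e -> \forall n \near \oo, (0 < n)%N /\ a / n%:R <= e.
Proof.
move=> a0 e0; near=> n.
have n0 : (0 < n)%N by near: n; exact: nbhs_infty_gt.
split=> //; rewrite ler_pdivrMr ?ltr0n// mulrC -ler_pdivrMr//.
by near: n; exact: nbhs_infty_ger.
Unshelve. all: by end_near. Qed.

Lemma relevant_rcauchy (Psi : S) : relevant VV Psi -> rcauchy VV (fun V => sigma3 V Psi).
Proof. by move=> [z [_ _]] /cvg_rcauchy. Qed.

Let rearrange (W u s b : S) (c z : R[i]) :
  W - (u - c *: (z *: b)) = z *: (- c *: (s - b)) + (W - u + (c * z) *: s).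
Proof.
rewrite !scalerA mulrN [z * c]mulrC scaleNr scalerBr !opprB.
by rewrite [RHS]addrC -[RHS]addrA [_ *: s + _]addrC subrK addrA addrAC.
Qed.

Lemma annihilator_limit : exists X : (nat -> S) -> nat -> S,
  tau_cvg VV (filter_prod VV \oo) (alpha J gamma t ann) X.
Proof.
have [B Bb BP] := bounded_strong_limit VVproper (fun V => @sigma3_lin _ _ S V) (fun V => @rnorm_sigma3 _ _ S V).
pose c0 : R[i] := 'i%C * (t * gamma)%:C.
exists (fun xi n => ann xi n - c0 *: B (xi n)); split.
- move=> [V L]; exact: (alpha_in_algebra J gamma t V L bounded_id ann_lin domD_ann domD_cre
    (fun x y xD yD => fdot_ann (domD_l2 (domD_ann xD)) (domD_l2 yD)) ann_tsum).
- apply: (@in_algebra_fin _ _ _ bool (fun b => if b then id else fun psi => - c0 *: B psi)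
    (fun b => if b then ann else id)).
  + by case; [exact: bounded_id|exact: bounded_scale].
  + case.
      apply: (@Lplus_adjoint _ _ cre) => *; [by rewrite ann_lin|exact: domD_ann|exact: domD_cre|].
      by rewrite fdot_ann//; [exact/domD_l2/domD_ann|exact: domD_l2].
    by apply: (@Lplus_adjoint _ _ id).
  + move=> n psi x xD; apply/funext => m; rewrite big_bool /= ann_tsum; congr (_ + _).
    rewrite /tsum (lin_sum Bb.1) scaler_sumr -sumrN; apply: eq_bigr => l _.
    by rewrite /ptens (linZ Bb.1) scaleNr scalerN !scalerA [c0 * _]mulrC.
move=> f k Psi fC rel.
have BPsi := BP Psi (relevant_rcauchy rel).
have [C C0 hC] := @weak_bound_deviation R k (t * gamma).
have [c c0' hc'] := weight_funM k.+3 fC.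
have hc (x : nat -> R[i]^o) lx := (hc' x lx).2.
(* The spin error, from sigma_3^V Psi against its limit, plus the boson error summed over the
   sectors. Below, the index [None] carries the former and [Some q] the latter. *)
pose A V (L : nat) : R := 2 * (`|t * gamma| * rnorm (sigma3 V Psi - B Psi)) +
  C / L%:R * (1 + rnorm Psi ^+ 2).
have bound V L : (0 < L)%N -> (tau_seminorm f k Psi (fun xi n => (alpha J gamma t ann (V, L) xi n -
    (ann xi n - c0 *: B (xi n)))%R) <= (2 * c * A V L)%:E)%E.
  move=> L0; pose th (q : idx (rs V)) : R := t * (gamma * mg q).
  have thT q : `|th q| <= `|t * gamma|.
    rewrite /th mulrA normrM ler_piMr// mag_le1// => j.
    exact: eigv_sq.
  have CL0 : 0 <= C / L%:R by rewrite divr_ge0.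
  apply: (@tau_seminorm_le _ _ _ f k k.+3 Psi _ _
    (fun o => if o is Some q then jproj (rs V) q Psi else - c0 *: (sigma3 V Psi - B Psi))
    (fun o => if o is Some q then deviation (rf L) (th q) ann (-1) else id)
    (fun o => if o is Some q then deviation (rf L) (th q) cre 1 else id)
    (fun o => if o is Some q then C / L%:R else 2) c (A V L)) => //.
  - by case.
  - by case=> [q|]; [exact: hC|apply: weak_bound_id; rewrite -addn3 leq_addr].
  - move=> phi phiD; apply/funext => n; rewrite sum_option (alpha_ann_ptens J gamma t (rs V) (rf L) Psi phiD).
    have -> : B (ptens Psi phi n) = phi n *: B Psi by rewrite /ptens (linZ Bb.1).
    have -> : \sum_q ptens (jproj (rs V) q Psi) (deviation (rf L) (th q) ann (-1) phi) n =
       \sum_q ptens (jproj (rs V) q Psi) (fevol (rf L) (t * (gamma * mg q)) (ann (fevol (rf L) (- (t * (gamma * mg q))) phi))) n -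
       ptens Psi (ann phi) n + (c0 * phi n) *: sigma3 V Psi.
      rewrite -[in ptens Psi _](proj_sum (rs V) Psi) -ptens_suml -sumrB sigma3_spectral scaler_sumr -big_split.
      apply: eq_bigr => q _; rewrite /ptens /deviation -/(th q) /= !scalerBl scalerA; congr (_ - _ + _).
      rewrite -scaleNr; congr (_ *: _); rewrite /GRing.scale/= /th /c0 !rmorphM/=; ring.
    rewrite ann_ptens; set W := \sum_q _; rewrite {2}/ptens.
    exact: rearrange.
  - move=> chi chi1; rewrite sum_option -mulr_suml; apply: lerD.
      rewrite mulrC ler_wpM2l// (le_trans (rnorm_dot _ _))// rnormZ rnormN.
      rewrite /c0 rnormM rnormC (_ : rnorm ('i%C : R[i]) = 1) ?mul1r; last first.
        by rewrite rnorm_def /= expr0n add0r expr1n sqrtr1.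
      by rewrite ler_piMl// mulr_ge0// rnorm_ge0.
    rewrite mulrC ler_wpM2l// (le_trans (sum_rnorm_dot_proj (rs V) chi Psi))// lerD2r.
    by rewrite expr_le1// rnorm_ge0.
apply: ereal_cvg0 => [p|e e0]; first exact: tau_seminorm_ge0.
have e2 : 0 < e / 2 by rewrite divr_gt0.
have a0 : 0 <= 2 * c * (2 * `|t * gamma|) by rewrite !mulr_ge0.
have b0 : 0 <= 2 * c * (C * (1 + rnorm Psi ^+ 2)).
  by rewrite !mulr_ge0// addr_ge0// sqr_ge0.
have [delta d0 hd] := small_multiple a0 e2.
move/cvg_rnormP : BPsi => /(_ _ d0) BPsi.
apply: (near_prod BPsi (large_divisor b0 e2)) => V L /= hV [L0 hL].
apply: (le_trans (bound V L L0)); rewrite lee_fin /A mulrDr (splitr e) lerD//.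
  by rewrite (le_trans _ hd)// -mulrA mulrA !mulrA ler_wpM2l// ?(ltW hV)// !mulr_ge0.
by apply: le_trans hL; rewrite le_eqVlt; apply/orP; left; apply/eqP; rewrite !mulrA; ring.
Qed.

(** * Limits of the evolved spin observables *)

Section SpinLimit.
Variables (i : lattice d) (al : axis).
Hypothesis iVV : \forall V \near VV, i \in V.

Let flip_phase (V : {fset lattice d}) (eps : lattice d -> R) : R[i] :=
  cexp (- (4 * t * J) * flip_energy V i eps).

Let flip_evol (V : {fset lattice d}) : S -> S := spectral_fun (rs V) (flip_phase V).

Let inv_card (V : {fset lattice d}) : R := (#|` V|%:R)^-1.

Lemma flip_phase_lipschitz V V' eps : eps i ^+ 2 = 1 ->
  rnorm (flip_phase V eps - flip_phase V' eps) <=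
  2 * `|4 * t * J| * (`|mag V eps - mag V' eps| + `|inv_card V - inv_card V'|).
Proof.
move=> e1; apply: (le_trans (cexp_lip _ _)).
rewrite -mulrBr normrM normrN -[leRHS]mulrA ler_wpM2l// ler_wpM2l// /flip_energy.
have -> : mag V eps * eps i - inv_card V - (mag V' eps * eps i - inv_card V') =
  (mag V eps - mag V' eps) * eps i - (inv_card V - inv_card V') by ring.
rewrite (le_trans (ler_normB _ _))// lerD2r normrM.
have -> : `|eps i| = 1 by apply/eqP; rewrite -sqrp_eq1// real_normK ?num_real// e1.
by rewrite mulr1.
Qed.

(** On the joint eigenvectors for the sites of both volumes everything is diagonal, and the phases
    are Lipschitz in the magnetization. Pythagoras turns this into a bound by the difference of the
    sigma_3 vectors; the Cauchy property of these is thereby transferred to the phases. *)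
Lemma flip_evol_sub V V' (Psi : S) : i \in V -> i \in V' ->
  rnorm (flip_evol V Psi - flip_evol V' Psi) <=
  4 * `|4 * t * J| * (rnorm (sigma3 V Psi - sigma3 V' Psi) + `|inv_card V - inv_card V'| * rnorm Psi).
Proof.
move=> iV iV'; pose W := spin_resolution (S := S) (enum_fset V ++ enum_fset V').
have Zl j : lin (@sigma R d S ax3 j) := sigma_lin ax3 j.
have ev (U : {fset lattice d}) q : i \in U -> {subset U <= enum_fset V ++ enum_fset V'} ->
    flip_evol U (jproj W q Psi) = flip_phase U (eigv W q) *: jproj W q Psi /\
    sigma3 U (jproj W q Psi) = (mag U (eigv W q))%:C *: jproj W q Psi.
  move=> iU UW; have yeig j : j \in U -> sigma ax3 j (jproj W q Psi) = (eigv W q j)%:C *: jproj W q Psi.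
    by move=> /UW; exact: proj_eig.
  split; last exact: sigma3_eigenvector.
  apply: (@spectral_fun_eigenvector _ _ _ _ Zl sigma3_comm (enum_fset U) (rs U) (flip_phase U)) => // e e' ee.
  by rewrite /flip_phase /flip_energy (mag_ext ee) (ee i iU).
have VW : {subset V <= enum_fset V ++ enum_fset V'} by move=> j jV; rewrite mem_cat jV.
have V'W : {subset V' <= enum_fset V ++ enum_fset V'} by move=> j jV; rewrite mem_cat jV orbT.
have dK : flip_evol V Psi - flip_evol V' Psi =
    \sum_q (flip_phase V (eigv W q) - flip_phase V' (eigv W q)) *: jproj W q Psi.
  have split U : flip_evol U Psi = \sum_q flip_evol U (jproj W q Psi).
    by rewrite -[in LHS](proj_sum W Psi) /flip_evol (lin_sum (spectral_fun_lin (rs U) (flip_phase U))).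
  rewrite !split -sumrB; apply: eq_bigr => q _.
  by rewrite (ev V q iV VW).1 (ev V' q iV' V'W).1 scalerBl.
have dS : sigma3 V Psi - sigma3 V' Psi =
    \sum_q (mag V (eigv W q) - mag V' (eigv W q))%:C *: jproj W q Psi.
  have split U : sigma3 U Psi = \sum_q sigma3 U (jproj W q Psi).
    by rewrite -[in LHS](proj_sum W Psi) (lin_sum (sigma3_lin U)).
  rewrite !split -sumrB; apply: eq_bigr => q _.
  by rewrite (ev V q iV VW).2 (ev V' q iV' V'W).2 rmorphB scalerBl.
set c1 := `|4 * t * J|; set eta := `|inv_card V - inv_card V'|.
have c10 : 0 <= c1 := normr_ge0 _. have eta0 : 0 <= eta := normr_ge0 _.
have D0 := rnorm_ge0 (sigma3 V Psi - sigma3 V' Psi); have N0 := rnorm_ge0 Psi.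
rewrite -(@ler_pXn2r _ 2) ?nnegrE ?rnorm_ge0 ?mulr_ge0 ?addr_ge0 ?mulr_ge0//.
have sq : rnorm (flip_evol V Psi - flip_evol V' Psi) ^+ 2 <=
    8 * c1 ^+ 2 * (rnorm (sigma3 V Psi - sigma3 V' Psi) ^+ 2 + eta ^+ 2 * rnorm Psi ^+ 2).
  rewrite dK dS !rnorm_sum_proj -(sum_rnorm_proj W Psi) mulr_sumr -big_split mulr_sumr.
  apply: ler_sum => q _ /=; rewrite -mulrDl [leRHS]mulrA ler_wpM2r ?sqr_ge0// rnormC.
  have := flip_phase_lipschitz V V' (eigv_sq W q i); rewrite -/c1 -/eta.
  have := rnorm_ge0 (flip_phase V (eigv W q) - flip_phase V' (eigv W q)).
  have := normr_ge0 (mag V (eigv W q) - mag V' (eigv W q)).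
  move: (rnorm (flip_phase V _ - _)) `|mag V _ - _| => u v v0 u0 uv.
  have : u ^+ 2 <= (2 * c1 * (v + eta)) ^+ 2.
    by rewrite ler_pXn2r ?nnegrE// !mulr_ge0// addr_ge0.
  move=> h; apply: le_trans h _; rewrite !exprMn.
  have -> : 2 ^+ 2 * c1 ^+ 2 * (v + eta) ^+ 2 = 4 * c1 ^+ 2 * (v + eta) ^+ 2 by ring.
  have -> : 8 * c1 ^+ 2 * (v ^+ 2 + eta ^+ 2) = 4 * c1 ^+ 2 * (2 * (v ^+ 2 + eta ^+ 2)) by ring.
  apply: ler_wpM2l; first by rewrite mulr_ge0// sqr_ge0.
  by have := sqr_ge0 (v - eta); rewrite sqrrB sqrrD; lra.
apply: (le_trans sq); rewrite !exprMn.
move: (rnorm (sigma3 V Psi - _)) (rnorm Psi) D0 N0 => D N D0 N0.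
have -> : 4 ^+ 2 * c1 ^+ 2 * (D + eta * N) ^+ 2 = 8 * c1 ^+ 2 * (2 * (D + eta * N) ^+ 2) by ring.
apply: ler_wpM2l; first by rewrite mulr_ge0// sqr_ge0.
have e0 : 0 <= eta * N by rewrite mulr_ge0.
rewrite -exprMn; move: (eta * N) e0 => u u0.
by have := sqr_ge0 (D + u); have := mulr_ge0 D0 u0; rewrite sqrrD; lra.
Qed.

Lemma inv_card_small (e : R) : 0 < e -> \forall V \near VV, i \in V /\ inv_card V <= e.
Proof.
move=> e0; have [N _ hN] := near_infty_natSinv_lt (PosNum e0).
apply: filterS2 iVV (VVdiverges N.+1) => V iV NV; split=> //.
rewrite /inv_card (le_trans _ (ltW (hN N (leqnn N))))//.
by rewrite lef_pV2 ?posrE ?ltr0n ?(leq_trans _ NV)// ler_nat.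
Qed.

Lemma flip_evol_rcauchy (Psi : S) : relevant VV Psi -> rcauchy VV (fun V => flip_evol V Psi).
Proof.
move=> /relevant_rcauchy sc e e0.
pose a : R := 4 * `|4 * t * J|; have a0 : 0 <= a by rewrite mulr_ge0.
have [delta d0 hd] := small_multiple a0 (divr_gt0 e0 (ltr0n R 2)).
have b0 : 0 <= a * (2 * rnorm Psi) by rewrite !mulr_ge0// rnorm_ge0.
have [eta eta0 heta] := small_multiple b0 (divr_gt0 e0 (ltr0n R 2)).
have [A VA hA] := sc _ d0.
exists (A `&` [set V : {fset lattice d} | i \in V /\ inv_card V <= eta]).
  by apply: filterI => //; exact: inv_card_small.
move=> V V' [AV [iV nV]] [AV' [iV' nV']].
apply: (le_trans (flip_evol_sub Psi iV iV')); rewrite -/a mulrDr (splitr e) lerD//.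
  by rewrite (le_trans _ hd)// ler_wpM2l// hA.
rewrite (le_trans _ heta)// -mulrA ler_wpM2l// mulrAC ler_wpM2r ?rnorm_ge0//.
rewrite (le_trans (ler_normB _ _))// !ger0_norm ?invr_ge0// mulr_natl mulr2n lerD//.
Qed.

Lemma flipping_limit (D : set ({fset lattice d} * nat)) : al <> ax3 ->
  exists X : (nat -> S) -> nat -> S,
  tau_cvg VV (within D (filter_prod VV \oo)) (alpha J gamma t (spin_obs al i)) X.
Proof.
move=> al3.
have phase1 V q : rnorm (flip_phase V (eigv (rs V) q)) <= 1 by rewrite rnorm_cexp.
have [B Bb BP] := bounded_strong_limit VVproper (fun V => spectral_fun_lin (rs V) (flip_phase V))
  (fun V x => rnorm_sum_proj_le x (phase1 V)).
have sl : lin (@sigma R d S al i) := sigma_lin al i.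
exists (fun xi n => sigma al i (B (xi n))); split.
- move=> [V L]; apply: (alpha_in_algebra J gamma t V L (sigma_bounded S al i)
    (T := id) (T' := id)) => //.
  by move=> I psi x; exact: lin_tsum.
- apply: (@in_algebra_fin _ _ _ 'I_1 (fun _ psi => sigma al i (B psi)) (fun=> id)).
  + by move=> _; exact: (bounded_comp (sigma_bounded S al i) Bb).
  + by move=> _; apply: (@Lplus_adjoint _ _ id).
  + move=> n psi x xD; apply/funext => m; rewrite big_ord1.
    have := @lin_tsum _ _ _ (fun x => sigma al i (B x)) _ psi x.
    move=> /(_ (fun c x y => etrans (congr1 _ (Bb.1 c x y)) (sl _ _ _))) h.
    by have := congr1 (fun g => g m) h.
move=> f k Psi fC rel.
have BPsi := BP Psi (flip_evol_rcauchy rel).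
have [C C0 hC] := @weak_bound_fevol_sub R k (2 * t * gamma).
have [c c0' hc'] := weight_funM k.+1 fC.
have hc (x : nat -> R[i]^o) lx := (hc' x lx).2.
(* The distance of the spin phase from its strong limit, plus the deviation of the field evolution
   from 1, whose time has modulus |2 t gamma| / |V| in every sector. *)
pose A (V : {fset lattice d}) : R := 2 * rnorm (flip_evol V Psi - B Psi) +
  C * (`|2 * t * gamma| * inv_card V) * (1 + rnorm Psi ^+ 2).
have bound V L : i \in V -> (tau_seminorm f k Psi (fun xi n => (alpha J gamma t (spin_obs al i) (V, L) xi n -
    sigma al i (B (xi n)))%R) <= (2 * c * A V)%:E)%E.
  move=> iV; pose th (q : idx (rs V)) : R := - (2 * t * gamma) * eigv (rs V) q i / #|` V|%:R.
  have n1 : 1 <= #|` V|%:R :> R.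
    by rewrite ler1n cardfs_gt0; apply/fset0Pn; exists i.
  have np : 0 < #|` V|%:R :> R by rewrite (lt_le_trans ltr01).
  have thE q : `|th q| = `|2 * t * gamma| * inv_card V.
    rewrite /th normrM normrM normrN.
    have -> : `|eigv (rs V) q i| = 1.
      by apply/eqP; rewrite -sqrp_eq1// real_normK ?num_real// eigv_sq.
    by rewrite mulr1 (ger0_norm (_ : 0 <= #|` V|%:R^-1)) ?invr_ge0.
  have thT q : `|th q| <= `|2 * t * gamma|.
    by rewrite thE ler_piMr// invf_le1.
  have Cq0 q : 0 <= C * `|th q| by rewrite mulr_ge0.
  apply: (@tau_seminorm_le _ _ _ f k k.+1 Psi _ _
    (fun o => if o is Some q then flip_phase V (eigv (rs V) q) *: sigma al i (jproj (rs V) q Psi)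
      else sigma al i (flip_evol V Psi - B Psi))
    (fun o => if o is Some q then (fun x n => fevol (rf L) (th q) x n - x n) else id)
    (fun o => if o is Some q then (fun x n => fevol (rf L) (- th q) x n - x n) else id)
    (fun o => if o is Some q then C * `|th q| else 2) c (A V)) => //.
  - by case.
  - by case=> [q|]; [exact: hC|apply: weak_bound_id].
  - move=> phi phiD; apply/funext => n; rewrite sum_option (alpha_sigma_ptens J gamma t (rs V) (rf L) Psi al3 iV phiD).
    have -> : B (ptens Psi phi n) = phi n *: B Psi by rewrite /ptens (linZ Bb.1).
    rewrite (linZ sl) (linB sl).
    have -> : sigma al i (flip_evol V Psi) =
        \sum_q flip_phase V (eigv (rs V) q) *: sigma al i (jproj (rs V) q Psi).
      by rewrite /flip_evol /spectral_fun (lin_sum sl); apply: eq_bigr => q _; rewrite (linZ sl).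
    set G := \sum_q flip_phase V _ *: _.
    have -> : \sum_q ptens (flip_phase V (eigv (rs V) q) *: sigma al i (jproj (rs V) q Psi))
         (fun n => fevol (rf L) (th q) phi n - phi n) n =
      \sum_q ptens (flip_phase V (eigv (rs V) q) *: sigma al i (jproj (rs V) q Psi))
         (fevol (rf L) (th q) phi) n - phi n *: G.
      rewrite /G scaler_sumr -sumrB; apply: eq_bigr => q _.
      by rewrite /ptens scalerBl.
    have e : ptens (G - sigma al i (B Psi)) phi n = phi n *: G - phi n *: sigma al i (B Psi) := scalerBr _ _ _.
    by rewrite e [RHS]addrC subrKA.
  - move=> chi chi1; rewrite sum_option; apply: lerD.
      rewrite mulrC ler_wpM2l// (le_trans (rnorm_dot _ _))// rnorm_sigma.
      by rewrite ler_piMl// rnorm_ge0.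
    under eq_bigr do rewrite thE.
    rewrite -mulr_suml mulrC; apply: ler_wpM2l; first by rewrite !mulr_ge0// invr_ge0.
    have schi1 : rnorm (sigma al i chi) <= 1 by rewrite rnorm_sigma.
    (* The isometry [sigma al i] is self-adjoint and moves to the test vector, so the sector bound
       applies again. *)
    apply: (@le_trans _ _ (\sum_q rnorm (dot (sigma al i chi) (jproj (rs V) q Psi)))).
      by apply: ler_sum => q _; rewrite dotZr rnormM rnorm_cexp mul1r sigma_sa.
    rewrite (le_trans (sum_rnorm_dot_proj (rs V) _ Psi))// lerD2r.
    by rewrite expr_le1// rnorm_ge0.
apply: ereal_cvg0 => [p|e e0]; first exact: tau_seminorm_ge0.
have e2 : 0 < e / 2 by rewrite divr_gt0.
have a0 : 0 <= 2 * c * 2 by rewrite !mulr_ge0.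
have b0 : 0 <= 2 * c * (C * `|2 * t * gamma| * (1 + rnorm Psi ^+ 2)).
  by rewrite !mulr_ge0// addr_ge0// sqr_ge0.
have [delta d0 hd] := small_multiple a0 e2.
have [eta eta0 heta] := small_multiple b0 e2.
move/cvg_rnormP : BPsi => /(_ _ d0) BPsi.
have near : \forall p \near filter_prod VV \oo, (tau_seminorm f k Psi
    (fun xi n => (alpha J gamma t (spin_obs al i) p xi n - sigma al i (B (xi n)))%R) <= e%:E)%E.
  apply: (near_prod (filterI BPsi (inv_card_small eta0)) (nbhs_infty_gt 0)) => V L [/= hV [iV nV]] _.
  apply: (le_trans (bound V L iV)); rewrite lee_fin /A mulrDr (splitr e) lerD//.
    by rewrite (le_trans _ hd)// mulrA ler_wpM2l// ltW.
  rewrite (le_trans _ heta)//.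
  have -> : 2 * c * (C * (`|2 * t * gamma| * inv_card V) * (1 + rnorm Psi ^+ 2)) =
    2 * c * (C * `|2 * t * gamma| * (1 + rnorm Psi ^+ 2)) * inv_card V by ring.
  by rewrite ler_wpM2l.
exact: cvg_within near.
Qed.

(** sigma_3^i commutes with the Hamiltonian and does not evolve; the difference from the limit is
    treated as an empty sum of tensors. *)
Lemma sigma3_limit (G : set_system ({fset lattice d} * nat)) (GG : Filter G) :
  exists X : (nat -> S) -> nat -> S, tau_cvg VV G (alpha J gamma t (spin_obs ax3 i)) X.
Proof.
have sl : lin (@sigma R d S ax3 i) := sigma_lin ax3 i.
exists (spin_obs ax3 i); split.
- move=> [V L]; apply: (alpha_in_algebra J gamma t V L (sigma_bounded S ax3 i)
    (T := id) (T' := id)) => //.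
  by move=> I psi x; exact: lin_tsum.
- apply: (@in_algebra_fin _ _ _ 'I_1 (fun _ psi => sigma ax3 i psi) (fun=> id)).
  + by move=> _; exact: (sigma_bounded S ax3 i).
  + by move=> _; apply: (@Lplus_adjoint _ _ id).
  + move=> n psi x xD; apply/funext => m; rewrite big_ord1.
    by have := congr1 (fun g => g m) (lin_tsum psi x sl).
move=> f k Psi fC _.
have [c c0 hc'] := weight_funM k fC; have hc (x : nat -> R[i]^o) lx := (hc' x lx).2.
apply: ereal_cvg0 => [p|e e0]; first exact: tau_seminorm_ge0.
apply: nearW => -[V L].
apply: (@le_trans _ _ (2 * c * 0)%:E); last by rewrite mulr0 lee_fin ltW.
apply: (@tau_seminorm_le _ _ _ f k k Psi _ 'I_0 (fun=> 0) (fun=> id) (fun=> id) (fun=> 0)) => //.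
- by case.
- move=> phi phiD; rewrite (alpha_sigma3_ptens J gamma t (rs V) (rf L) i Psi phiD).
  apply/funext => n; rewrite big_ord0 /spin_obs /ptens (linZ sl).
  exact: subrr.
- by move=> chi _; rewrite big_ord0.
Qed.

End SpinLimit.

End Limits.

(* In (2) the site i must eventually lie in V: when i is not in V, sigma_al^i
   commutes with H_{V,L} and is constant in t, so that no limit could exist
   along a net of volumes which goes on both containing i and missing it. *)
Theorem proposition5p1 (R : realType) (d : nat) (S : spinSystem R d)
    (VV : set_system {fset lattice d}) (VVproper : ProperFilter VV)
    (VVdiverges : forall n, \forall V \near VV, (n <= #|` V|)%N)
    (J gamma : R) :
  (forall t : R, exists X : (nat -> S) -> nat -> S,
     tau_cvg VV (filter_prod VV \oo) (alpha J gamma t ann) X) /\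
  (forall (r : nat) (t : R) (i : lattice d) (al : axis), (1 < r)%N ->
     (\forall V \near VV, i \in V) ->
     exists X : (nat -> S) -> nat -> S,
       tau_cvg VV (within [set p | #|` p.1| = (p.2 ^ r)%N] (filter_prod VV \oo))
         (alpha J gamma t (spin_obs al i)) X).
Proof.
split=> [t|r t i al _ iVV]; first exact: annihilator_limit.
case: al; [exact: flipping_limit|exact: flipping_limit|exact: sigma3_limit].
Qed.
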